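(* Let $k$ be an algebraically closed field of characteristic zero, $F$ an algebraically closed extension of $k$ of transcendence degree $n$, $1\le n\le\infty$, $G=\mathrm{Aut}(F/k)$, and let $G^{\circ}$ be the subgroup of $G$ generated by the compact subgroups of $G$. If $n<\infty$, then any non-trivial subgroup of $G$ normalized by $G^{\circ}$ is dense in $G^{\circ}$ (i.e. its closure in $G$ contains $G^{\circ}$). If $n=\infty$, then any non-trivial normal subgroup of $G$ is dense in $G$.
   Context: Topology on $G$: for a subfield $k\subseteq K\subseteq F$ put $U_K=\mathrm{Aut}(F/K)$; the subgroups $U_{k(x)}$, $x\in F$, generate the neighbourhoods of $1$ (equivalently, the $U_L$ with $L$ finitely generated over $k$ form a base of neighbourhoods of $1$). If $n=\infty$, the transcendence degree is countable. *)

(* Defs.v *)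
From HB Require Import structures.
From mathcomp Require Import all_boot all_algebra.
From mathcomp Require Import finmap all_classical topology.
From mathcomp Require Import -(notations) mpoly.

Set Implicit Arguments.
Unset Strict Implicit.
Unset Printing Implicit Defensive.

Import GRing.Theory.

Local Open Scope classical_set_scope.
Local Open Scope ring_scope.

Section Subfields.
Context {k F : fieldType} (iota : {rmorphism k -> F}).
Implicit Types S L B : set F.

Definition is_subfield L := divring_closed [in L].

(* The subfield k(S) of F, k being identified with its image in F. *)
Definition subfield_gen S := smallest is_subfield (range iota `|` S).

Definition finitely_generated L :=
  exists2 S, finite_set S & L = subfield_gen S.

Definition algebraic_over_subfield L (u : F) :=
  exists2 p : {poly F}, p != 0 & p \is a polyOver [in L] /\ root p u.

Definition algebraically_independent B :=
  forall (m : nat) (x : 'I_m -> F), injective x -> (forall i, B (x i)) ->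
  forall p : mpoly m k, mmap iota x p = 0 -> p = 0.

Definition transcendence_basis B :=
  algebraically_independent B /\
  forall u : F, algebraic_over_subfield (subfield_gen B) u.

(* Only the cardinality of C matters: C is `I_n for transcendence degree n and
   [set: nat] for countably infinite transcendence degree. *)
Definition has_trdeg (C : set nat) :=
  exists2 B, transcendence_basis B & (B #= C)%card.

Lemma subfield_gen_sub S T :
  S `<=` subfield_gen T -> subfield_gen S `<=` subfield_gen T.
Proof.
move=> ST x Sx M [Msub TM]; apply: Sx; split=> // y [ky|/ST Ty].
  by apply: TM; left.
exact: Ty.
Qed.

Lemma sub_subfield_gen S : S `<=` subfield_gen S.
Proof. by move=> x Sx M [_]; apply; right. Qed.

End Subfields.

Section Automorphisms.
Context {k F : fieldType} (iota : {rmorphism k -> F}).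

Record aut := Aut {
  aut_val :> {rmorphism F -> F};
  aut_bij : bijective aut_val;
  aut_fix : forall c : k, aut_val (iota c) = iota c
}.

Lemma aut_ext (f g : aut) : f =1 g -> f = g.
Proof.
case: f g => [f fb ff] [g gb gf] /= fg.
have e : f = g.
  move: fg; clear; case: f g => [f cf] [g cg] /= /funext fg; subst g.
  congr GRing.RMorphism.Pack; case: cf cg => [[a] [b]] [[c] [d]].
  by rewrite (Prop_irrelevance a c) (Prop_irrelevance b d).
subst g.
by rewrite (Prop_irrelevance fb gb) (Prop_irrelevance ff gf).
Qed.

HB.instance Definition _ := gen_eqMixin aut.
HB.instance Definition _ := gen_choiceMixin aut.

Definition aut_one : aut :=
  @Aut idfun (Bijective (fun=> erefl) (fun=> erefl)) (fun=> erefl).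

Lemma aut_mul_fix (f g : aut) (c : k) : (f \o g) (iota c) = iota c.
Proof. by rewrite /= !aut_fix. Qed.

Definition aut_mul (f g : aut) : aut :=
  @Aut (f \o g) (bij_comp (aut_bij f) (aut_bij g)) (aut_mul_fix f g).

Lemma aut_inv_subproof (f : aut) : {g : aut | cancel f g /\ cancel g f}.
Proof.
apply: cid; have [g fK gK] := aut_bij f.
have gB : zmod_morphism g.
  by move=> x y; apply: (bij_inj (aut_bij f)); rewrite rmorphB !gK.
have gM : monoid_morphism g.
  split=> [|x y]; apply: (bij_inj (aut_bij f)); first by rewrite gK rmorph1.
  by rewrite rmorphM !gK.
pose gA := GRing.isZmodMorphism.Build F F g gB.
pose gR := GRing.isMonoidMorphism.Build F F g gM.
pose g' : {rmorphism F -> F} := HB.pack g gA gR.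
have g'fix c : g' (iota c) = iota c.
  by apply: (bij_inj (aut_bij f)); rewrite gK aut_fix.
by exists (@Aut g' (Bijective gK fK) g'fix).
Qed.

Definition aut_inv (f : aut) : aut := sval (aut_inv_subproof f).

Lemma aut_invK (f : aut) : cancel f (aut_inv f).
Proof. by case: (svalP (aut_inv_subproof f)). Qed.

Lemma aut_Kinv (f : aut) : cancel (aut_inv f) f.
Proof. by case: (svalP (aut_inv_subproof f)). Qed.

Lemma aut_mulA : associative aut_mul.
Proof. by move=> f g h; apply: aut_ext. Qed.

Lemma aut_mul1g : left_id aut_one aut_mul.
Proof. by move=> f; apply: aut_ext. Qed.

Lemma aut_mulg1 : right_id aut_one aut_mul.
Proof. by move=> f; apply: aut_ext. Qed.

Lemma aut_mulVg : left_inverse aut_one aut_inv aut_mul.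
Proof. by move=> f; apply: aut_ext => x; apply: aut_invK. Qed.

Lemma aut_mulgV : right_inverse aut_one aut_inv aut_mul.
Proof. by move=> f; apply: aut_ext => x; apply: aut_Kinv. Qed.

HB.instance Definition _ :=
  isGroup.Build aut aut_mulA aut_mul1g aut_mulg1 aut_mulVg aut_mulgV.

(* U_L = Aut(F/L) *)
Definition fixing_subgroup (L : set F) : set aut :=
  [set g | forall x, L x -> g x = x].

(* The group topology for which the U_L, with L finitely generated over k, form
   a base of neighbourhoods of 1. *)
Definition nbhs_aut (g : aut) : set_system aut :=
  filter_from (finitely_generated iota)
    (fun L => [set (g * u)%g | u in fixing_subgroup L]).

HB.instance Definition _ := hasNbhs.Build aut nbhs_aut.

Lemma nbhs_aut_filter (g : aut) : ProperFilter (nbhs g).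
Proof.
apply: filter_from_proper.
  apply: filter_from_filter.
    by exists (subfield_gen iota set0), set0 => //; exact: finite_set0.
  move=> _ _ [S finS ->] [T finT ->].
  exists (subfield_gen iota (S `|` T)).
    by exists (S `|` T); rewrite ?finite_setU.
  move=> _ [u uST <-]; split; exists u => // x Lx; apply: uST;
  move: Lx; apply: subfield_gen_sub => y ?; apply: sub_subfield_gen.
    by left.
  by right.
by move=> L _; exists (g * 1)%g, 1%g.
Qed.

Lemma nbhs_aut_singleton (g : aut) (A : set aut) : nbhs g A -> A g.
Proof. by case=> L _; apply; exists 1%g => //; rewrite mulg1. Qed.

Lemma nbhs_aut_nbhs (g : aut) (A : set aut) : nbhs g A -> nbhs g (nbhs^~ A).
Proof.
case=> L fgL LA; exists L => // _ [u uL <-]; exists L => // _ [v vL <-].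
apply: LA; exists (u * v)%g; last by rewrite mulgA.
by move=> x Lx; rewrite /= vL // uL.
Qed.

HB.instance Definition _ := Nbhs_isNbhsTopological.Build aut
  nbhs_aut_filter nbhs_aut_singleton nbhs_aut_nbhs.

Lemma fixed_field_is_subfield (u : aut) : is_subfield [set x | u x = x].
Proof.
split=> [|x y|x y]; rewrite ?inE /= ?rmorph1 // => ux uy.
  by rewrite rmorphB ux uy.
by rewrite fmorph_div ux uy.
Qed.

(* The U_{k(x)}, x in F, generate the neighbourhoods of 1. *)
Lemma nbhs_aut1E : nbhs (1%g : aut) =
  smallest (fun N : set_system aut => Filter N)
    [set fixing_subgroup (subfield_gen iota [set x]) | x in [set: F]].
Proof.
apply/seteqP; split=> [A [L [S finS ->] SA] N [FN UN]|].
  have [D SD] := finite_fsetP.1 finS.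
  have : N (\bigcap_(x in [set` D])
      fixing_subgroup (subfield_gen iota [set x])).
    by apply: filter_bigI => x _; apply: UN; exists x.
  apply: filterS => u uD; apply: SA; exists u; last by rewrite mul1g.
  move=> x /(_ [set y | u y = y]); apply.
  split; first exact: fixed_field_is_subfield.
  move=> y [[c _ <-]|]; first exact: aut_fix.
  by rewrite SD => /uD; apply; apply: sub_subfield_gen.
apply: smallest_sub => [|_ [x _ <-]]; first exact: nbhs_filter.
exists (subfield_gen iota [set x]).
  by exists [set x] => //; exact: finite_set1.
by move=> _ [u ux <-]; rewrite mul1g.
Qed.

End Automorphisms.

Section Subgroups.
Context {G : groupType}.
Implicit Types H K : set G.

Definition is_subgroup H := group_closed [in H].

Definition generated_subgroup (A : set G) := smallest is_subgroup A.

Definition normalized_by H K := forall g h, K g -> H h -> H (h ^ g)%g.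

End Subgroups.

Definition aut_circ {k F : fieldType}
    (iota : {rmorphism k -> F}) : set (aut iota) :=
  generated_subgroup
    (\bigcup_(K in [set K : set (aut iota) | is_subgroup K /\ compact K]) K).

Arguments aut_circ {k F} iota _.

(* Main.v *)
(** Write U_L for the automorphisms fixing a subfield L; if F is algebraic over
    L then U_L is compact.  Let sigma in H move z.  If u fixes sigma t then
    u sigma^-1 u^-1 sigma lies in H and agrees with u at t.  Taking
    t^p = c - z with p a large prime and c generic in k, Kummer theory provides
    such a u which multiplies t by a primitive p-th root of unity zeta and fixes
    any prescribed finite set.  Commutators of the resulting element of H with
    translations of t yield elements of H which send t to t + b.

    Let x be an independent family such that H contains, for each i, an element
    T_i with T_i x_i = x_i + 1 fixing the algebraic closure C_i of the field
    generated by the other x_j.  Let M be the field of all elements algebraic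
    over K = k(x) and fixed by H :&: U_K.  The T_i commute with U_K on M.
    Elements of M integral over C_i[x_i] and of bounded degree form a finite
    dimensional space stable under T_i; an eigenvector argument (an algebraic
    eigenvector of a shift is a constant) shows that M lies in C_i(x_i).
    Descending through the variables gives M = K, so that H :&: U_K is dense in
    U_K, at least on elements algebraic over K.

    In finite transcendence degree every compact subgroup lies in some U_K with
    K generated by a transcendence basis.  In infinite transcendence degree
    the elements t |-> t + b with b new allow H to move any finite independent
    family to any other one of the same size, which reduces the density of H to
    that of H :&: U_K in U_K. *)

From HB Require Import structures.
Require Import Defs.
From mathcomp Require Import all_boot all_algebra.
From mathcomp Require Import all_classical topology.
From mathcomp Require Import -(notations) mpoly.

Set Implicit Arguments.
Unset Strict Implicit.
Unset Printing Implicit Defensive.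

Import GRing.Theory.

Local Open Scope classical_set_scope.
Local Open Scope ring_scope.

(** * Subfields and algebraic closure *)

Section Subfield.
Context {F : fieldType}.
Implicit Types L M : divringClosed F.

(** Two constraints shape the proof. In finite transcendence degree H may be conjugated only by
    elements of G°, so every auxiliary automorphism has to be traced back to compact subgroups. This
    is why fields are enlarged to a maximal R over which a given z stays transcendental: F is then
    algebraic over R(z), so U_{R(z)} is compact. It is also why translations are built from two
    reflections. The second constraint is that the shift argument needs an element of H fixing the
    whole algebraic closure C of the other variables, while a first commutator fixes only a finite
    list. Once the list of the other variables is fixed, C is preserved, and a second commutator
    fixes C pointwise. The price is that z is replaced by t', with t'^p' = c' - t and t^p = c - z;
    powers of the two Kummer elements bring an automorphism fixing z back to one fixing t'. The
    prime p exceeds the number d of conjugates over R(z) of an element y separating the finite data,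
    so that d is nonzero modulo p. *)

Definition alg (L : {pred F}) (u : F) :=
  exists2 p : {poly F}, p != 0 & p \is a polyOver L /\ root p u.

Section Pred.
Context (L : set F) (HL : is_subfield L).
(** The [let] keeps the closure proof [HL] as a parameter of the predicate, so that the
    [divringClosed] instance can be attached to it. *)
Definition set_pred : {pred F} := let _ := HL in [in L].
HB.instance Definition _ := GRing.isDivringClosed.Build F set_pred HL.
Definition set_subfield : divringClosed F := GRing.DivringClosed.clone F set_pred _.
Lemma set_subfieldE x : x \in set_subfield <-> L x.
Proof. by split=> [/set_mem|/mem_set]. Qed.
End Pred.

Section SubType.
Context (L : divringClosed F).
(** As a field type, the subfield comes with a morphism into F, which is what [algebraicOver] and
    [integralOver] speak of. *)
Definition subf_type := {x : F | x \in L}.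
HB.instance Definition _ := SubType.on subf_type.
HB.instance Definition _ := Choice.on subf_type.
HB.instance Definition _ := [SubChoice_isSubIntegralDomain of subf_type by <:].
HB.instance Definition _ := [SubIntegralDomain_isSubField of subf_type by <:].
Definition subf : fieldType := GRing.Field.clone subf_type _.
(* Kept opaque so that simplification does not expose the subtype projection. *)
Fact subf_val_subproof :
  {f : {rmorphism subf -> F} | forall x : subf_type, f x = val x}.
Proof. by exists (val : subf_type -> F). Qed.
Definition subf_val : {rmorphism subf -> F} := sval subf_val_subproof.
Lemma subf_valP (x : subf) : subf_val x \in L.
Proof. by rewrite (svalP subf_val_subproof x); exact: (valP (x : subf_type)). Qed.
Lemma subf_valE x : x \in L -> exists y, subf_val y = x.
Proof.
by move=> h; exists (Sub x h : subf_type); rewrite (svalP subf_val_subproof _).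
Qed.

Lemma map_subf_over (p : {poly subf}) : map_poly subf_val p \is a polyOver L.
Proof. by apply/polyOverP => i; rewrite coef_map subf_valP. Qed.

Lemma subf_polyE (p : {poly F}) : p \is a polyOver L ->
  exists q, map_poly subf_val q = p.
Proof.
move=> /polyOverP pL.
have [c cE] := choice (fun i => subf_valE (pL i)).
exists (\poly_(i < size p) c i).
apply/polyP => i; rewrite coef_map coef_poly; case: ltnP => [_|/(nth_default 0)->].
  exact: cE.
by rewrite /= rmorph0.
Qed.

Lemma algE u : alg L u <-> algebraicOver subf_val u.
Proof.
split=> [[p p0 [/subf_polyE [q qp] pu]]|[p p0 pu]].
  by exists q; [rewrite -(map_poly_eq0 subf_val) qp|rewrite qp].
exists (map_poly subf_val p); first by rewrite map_poly_eq0.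
by split=> //; apply: map_subf_over.
Qed.
End SubType.

Definition acl_pred (L : {pred F}) : {pred F} := fun u => `[< alg L u >].

Lemma acl_closed L : divring_closed (acl_pred L).
Proof.
split=> [|x y /asboolP/algE ax /asboolP/algE ay|x y /asboolP/algE ax /asboolP/algE ay];
  apply/asboolP/algE; [exact: algebraic1|exact: algebraic_sub|exact: algebraic_div].
Qed.
HB.instance Definition _ L :=
  GRing.isDivringClosed.Build F (acl_pred L) (@acl_closed L).
Definition acl L : divringClosed F := GRing.DivringClosed.clone F (acl_pred L) _.

Lemma aclP L u : reflect (alg L u) (u \in acl L). Proof. exact: asboolP. Qed.

Lemma sub_acl L : {subset L <= acl L}.
Proof.
move=> x xL; apply/aclP; exists ('X - x%:P); first by rewrite polyXsubC_eq0.
by rewrite polyOverXsubC root_XsubC.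
Qed.

Lemma alg_mono (L M : {pred F}) u : {subset L <= M} -> alg L u -> alg M u.
Proof.
by move=> LM [p p0 [pL pu]]; exists p => //; split=> //; exact: (polyOverS LM).
Qed.

Lemma acl_mono L M : {subset L <= M} -> {subset acl L <= acl M}.
Proof. by move=> LM u /aclP/(alg_mono LM)/aclP. Qed.

Lemma acl_acl L : acl (acl L) =i acl L.
Proof.
move=> u; apply/idP/idP => [|/sub_acl//].
move=> /aclP[p p0 [pL pu]]; apply/aclP/algE/integral_algebraic.
apply: (integral_root p0 pu) => _ /(nthP 0)[i _ <-].
by apply/integral_algebraic/algE/aclP; apply: (polyOverP pL).
Qed.

Lemma acl_sub L M : {subset L <= acl M} -> {subset acl L <= acl M}.
Proof. by move=> LM u /(acl_mono LM); rewrite acl_acl. Qed.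

Lemma horner1 (x : F) : 1.[x] = 1 :> F.
Proof. exact: hornerC. Qed.

Section Adjoin.
Context (L : divringClosed F) (x : F).
Definition adj_pred : {pred F} := fun u =>
  `[< exists p, p \is a polyOver L /\ exists q, [/\ q \is a polyOver L,
      q.[x] != 0 & u = p.[x] / q.[x]] >].
Lemma adjP u : reflect (exists p, p \is a polyOver L /\ exists q,
   [/\ q \is a polyOver L, q.[x] != 0 & u = p.[x] / q.[x]]) (u \in adj_pred).
Proof. exact: asboolP. Qed.
Lemma adj_closed : divring_closed adj_pred.
Proof.
split=> [|u v /adjP[p [pL [q [qL q0 ->]]]] /adjP[p' [pL' [q' [qL' q0' ->]]]]
         |u v /adjP[p [pL [q [qL q0 ->]]]] /adjP[p' [pL' [q' [qL' q0' ->]]]]].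
- apply/adjP; exists 1; split; first exact: rpred1.
  by exists 1; rewrite horner1 oner_eq0 divr1; split=> //; apply: rpred1.
- apply/adjP; exists (p * q' - p' * q); split; first by rewrite rpredB ?rpredM.
  exists (q * q'); rewrite rpredM //; split=> //; rewrite !hornerE ?mulf_neq0//.
  by rewrite -mulNr addf_div // mulNr.
- have [p0'|p0'] := eqVneq p'.[x] 0.
    apply/adjP; exists 0; rewrite rpred0; split=> //; exists 1; rewrite rpred1.
    by rewrite horner1 horner0 p0' !mul0r invr0 mulr0 oner_eq0.
  apply/adjP; exists (p * q'); split; first by rewrite rpredM.
  exists (q * p'); rewrite rpredM //; split=> //; rewrite !hornerE ?mulf_neq0//.
  by rewrite invf_div mulf_div.
Qed.
HB.instance Definition _ := GRing.isDivringClosed.Build F adj_pred adj_closed.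
Definition adj : divringClosed F := GRing.DivringClosed.clone F adj_pred _.
Lemma sub_adj : {subset L <= adj}.
Proof.
move=> u uL; apply/adjP; exists u%:P; rewrite polyOverC; split=> //.
by exists 1; rewrite rpred1 horner1 oner_eq0 divr1 ?hornerC ?hornerX.
Qed.
Lemma adj_id : x \in adj.
Proof.
apply/adjP; exists 'X; rewrite polyOverX; split=> //.
by exists 1; rewrite rpred1 horner1 oner_eq0 divr1 ?hornerC ?hornerX.
Qed.
Lemma adj_horner p : p \is a polyOver L -> p.[x] \in adj.
Proof.
move=> pL; apply/adjP; exists p; split=> //.
by exists 1; rewrite rpred1 horner1 oner_eq0 divr1 ?hornerC ?hornerX.
Qed.
Lemma adj_min M : {subset L <= M} -> x \in M -> {subset adj <= M}.
Proof.
move=> LM xM u /adjP[p [pL [q [qL q0 ->]]]].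
by rewrite rpred_div // rpred_horner //; apply/(polyOverS LM).
Qed.
End Adjoin.

(* A bivariate polynomial is read as a polynomial in the outer variable, the
   inner variable standing for the generator of a simple extension. *)
Definition over2 (L : {pred F}) (G : {poly {poly F}}) := forall i j, G`_i`_j \in L.

Lemma over2_coef L G i : over2 L G -> G`_i \is a polyOver L.
Proof. by move=> GL; apply/polyOverP. Qed.

Lemma over2_swap L G : over2 L G -> over2 L (swapXY G).
Proof. by move=> GL i j; rewrite coef_swapXY. Qed.

(** Horner induction, [B] collecting the denominators of the coefficients. Relations over L(x)
    thereby become bivariate polynomials over L, where the two variables can be exchanged. *)
Lemma clear_denominators L x (p : {poly F}) : p \is a polyOver (adj L x) ->
  exists2 B : {poly F}, B \is a polyOver L /\ B.[x] != 0 &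
  exists2 G, over2 L G & map_poly (horner_eval x) G = B.[x] *: p.
Proof.
elim/poly_ind: p => [_|p c IH pc].
  exists 1; first by rewrite rpred1 hornerC oner_eq0.
  by exists 0; rewrite ?rmorph0 ?scaler0 // => i j; rewrite !coef0 rpred0.
have pL : p \is a polyOver (adj L x).
  apply/polyOverP => i; have /polyOverP/(_ i.+1) := pc.
  by rewrite coefD coefMX coefC /= addr0.
have cL : c \in adj L x.
  by have /polyOverP/(_ 0%N) := pc; rewrite coefD coefMX coefC /= add0r.
have [B [BL B0] [G GL GE]] := IH pL.
have /adjP[r [rL [q [qL q0 cE]]]] := cL.
exists (B * q); first by rewrite rpredM // hornerM mulf_neq0.
exists (G * 'X * q%:P + (r * B)%:P).
  move=> i j; apply: (@polyOverP _ _ (_ : {poly F}) _) j.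
  rewrite coefD coefMC coefMX coefC.
  have GiL k : G`_k \is a polyOver L by exact: over2_coef.
  apply: rpredD.
    by apply: rpredM => //; case: ifP => _; rewrite ?rpred0.
  by case: ifP => _; rewrite ?rpred0 // rpredM.
rewrite rmorphD !rmorphM /= GE map_polyX !map_polyC /= !horner_evalE !hornerM cE.
rewrite scalerDr; congr (_ + _); first by rewrite -!scalerAl mulrC mul_polyC scalerA mulrC.
rewrite -mul_polyC -!rmorphM; congr _%:P.
by rewrite [RHS]mulrACA mulfV // mulr1 mulrC.
Qed.

Lemma horner2E (G : {poly {poly F}}) x y :
  (map_poly (horner_eval x) G).[y] = G.[y%:P].[x].
Proof. by rewrite -horner_swapXY horner2_swapXY. Qed.

Lemma alg_adj L x y : y \in acl (adj L x) ->
  exists2 G, over2 L G & map_poly (horner_eval x) G != 0 /\ G.[y%:P].[x] = 0.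
Proof.
move=> /aclP[p p0 [pL /rootP py]].
have [B [_ B0] [G GL GE]] := clear_denominators pL.
exists G => //; rewrite GE scaler_eq0 negb_or B0 p0; split=> //.
by rewrite -horner2E GE hornerZ py mulr0.
Qed.

(** If [G] vanishes identically in the inner variable once y replaces the outer one, every
    coefficient with respect to the inner variable kills y, and the leading one is a non-zero
    polynomial over L. *)
Lemma over2_horner0 L G y : over2 L G -> G != 0 -> G.[y%:P] = 0 -> y \in acl L.
Proof.
move=> GL G0 Gy.
have sG0 : swapXY G != 0 by rewrite swapXY_eq0.
apply/aclP; exists (lead_coef (swapXY G)); first by rewrite lead_coef_eq0.
split; first exact/over2_coef/over2_swap.
apply/rootP; rewrite lead_coefE.
have /polyP/(_ (size (swapXY G)).-1) : (swapXY (swapXY G)).[y%:P] = 0.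
  by rewrite swapXYK.
by rewrite horner_swapXY coef_map coef0.
Qed.

Lemma over2_hornerC L G (y : F) : over2 L G -> G.[y%:P] \is a polyOver (adj L y).
Proof.
move=> GL; apply/polyOverP => i; rewrite -[G]swapXYK horner_swapXY coef_map /=.
by rewrite horner_evalE adj_horner //; apply/over2_coef/over2_swap.
Qed.

(** Steinitz exchange: the relation G(x, y) = 0 is read as an equation for x over L(y). It does not
    degenerate, for otherwise y would be algebraic over L. *)
Lemma exchange L x y : y \in acl (adj L x) -> y \notin acl L -> x \in acl (adj L y).
Proof.
move=> /alg_adj[G GL [G0 Gyx]] /negP yL.
apply/aclP; exists G.[y%:P].
  apply/eqP => Gy0; apply: yL; apply: (over2_horner0 GL _ Gy0).
  by apply: contraNneq G0 => ->; rewrite rmorph0.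
by split; [exact: over2_hornerC|apply/rootP].
Qed.

Lemma acl_adj L x : x \in acl L -> acl (adj L x) =i acl L.
Proof.
move=> xL u; apply/idP/idP; last by apply: acl_mono; exact: sub_adj.
by apply: acl_sub; apply: adj_min => //; exact: sub_acl.
Qed.

Lemma transc_eq0 L x (p : {poly F}) : x \notin acl L -> p \is a polyOver L ->
  p.[x] = 0 -> p = 0.
Proof.
move=> xL pL px; apply/eqP; apply: contraNT xL => p0; apply/aclP; exists p => //.
by split=> //; apply/rootP.
Qed.

Lemma transc_inj L x (p q : {poly F}) : x \notin acl L -> p \is a polyOver L ->
  q \is a polyOver L -> p.[x] = q.[x] -> p = q.
Proof.
move=> xL pL qL e; apply/eqP; rewrite -subr_eq0; apply/eqP.
by apply: (transc_eq0 xL); rewrite ?rpredB // !hornerE e subrr.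
Qed.

(** For u = p(x)/q(x), the polynomial r = p - u q kills x. If r = 0, then u is a quotient of
    coefficients, hence in L; otherwise x is algebraic over L(u), hence over L. *)
Lemma adj_acl L x u : x \notin acl L -> u \in adj L x -> u \in acl L -> u \in L.
Proof.
move=> xL /adjP[p [pL [q [qL q0 uE]]]] uL; apply: contraNT xL => nuL.
pose r := p - u *: q.
have rx : r.[x] = 0 by rewrite !hornerE uE divfK // subrr.
have [/eqP r0|r0] := eqVneq r 0.
  have [i qi] : exists i, q`_i != 0.
    apply: contrapT => /forallNP h; move/negP: q0; apply; apply/eqP.
    by rewrite (_ : q = 0) ?horner0 //; apply/polyP => i; rewrite coef0;
      apply/eqP; apply/negPn/negP/h.
  move: r0; rewrite subr_eq0 => /eqP/polyP/(_ i); rewrite coefZ => pi.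
  move/negP: nuL; case; rewrite -(mulfK qi u) -pi rpred_div //.
    exact: (polyOverP pL). exact: (polyOverP qL).
rewrite -(acl_adj uL); apply/aclP; exists r => //; split; last exact/rootP.
by rewrite rpredB ?polyOverZ ?adj_id //; apply: (polyOverS (@sub_adj _ _)).
Qed.

End Subfield.

(** * Extension of field morphisms *)

(** [Zorn_bigcup] also covers the empty chain; applying it to the sets [A] such that [A0] together
    with [A] satisfies [P] turns the empty union into [A0]. *)
Lemma zorn_above T (P : set (set T)) (A0 : set T) : P A0 ->
  (forall C : set (set T), C !=set0 -> C `<=` P -> total_on C subset ->
     P (\bigcup_(A in C) A)) ->
  exists A, [/\ A0 `<=` A, P A & forall B, A `<=` B -> P B -> B `<=` A].
Proof.
move=> P0 Pchain.
have [C CP Ctot|A [PA maxA]] := @Zorn_bigcup T [set A | P (A0 `|` A)].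
  have [[A CA]|C0] := pselect (C !=set0); last first.
    rewrite /= (_ : \bigcup_(X in C) X = set0) ?setU0 //.
    by apply/seteqP; split=> // x [A CA]; case: C0; exists A.
  rewrite /=; have -> : A0 `|` \bigcup_(X in C) X =
      \bigcup_(X in [set A0 `|` X | X in C]) X.
    apply/seteqP; split=> x.
      case=> [A0x|[B CB Bx]]; [exists (A0 `|` A)|exists (A0 `|` B)] => //.
      - by exists A.
      - by left.
      - by exists B.
      - by right.
    by case=> _ [B CB <-] [A0x|Bx]; [left|right; exists B].
  apply: Pchain => [|_ [B CB <-]|_ _ [B CB <-] [D CD <-]].
  - by exists (A0 `|` A), A.
  - exact: CP.
  - by have [BD|DB] := Ctot _ _ CB CD; [left|right]; apply: setUS.
exists (A0 `|` A); split=> // B AB PB.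
apply: contrapT => BA; apply: (maxA B).
  split; first by move=> x Ax; apply: AB; right.
  by move=> BA'; apply: BA => x /BA' Ax; right.
by rewrite /= (setUidPr _ _).2 // => x A0x; apply: AB; left.
Qed.

Section PartialMorphisms.
Context {F : fieldType}.

(** A morphism from a subfield of F to F, stored as its graph: extension is inclusion, unions of
    chains serve Zorn's lemma, and inversion is a swap of coordinates. The last clause makes the
    graph single-valued. *)
Definition partial_morphism (G : set (F * F)) :=
  [/\ G (1, 1),
      forall x y x' y', G (x, y) -> G (x', y') -> G (x - x', y - y'),
      forall x y x' y', G (x, y) -> G (x', y') -> G (x / x', y / y')
    & forall y, G (0, y) -> y = 0].

Definition graph_dom (G : set (F * F)) : {pred F} :=
  fun x => `[< exists y, G (x, y) >].
Definition graph_ran (G : set (F * F)) : {pred F} :=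
  fun y => `[< exists x, G (x, y) >].

Lemma partial_morphism_fun G x y y' : partial_morphism G ->
  G (x, y) -> G (x, y') -> y = y'.
Proof.
move=> [_ GB _ G0] Gy Gy'; apply/eqP; rewrite -subr_eq0; apply/eqP/G0.
by rewrite -(subrr x); apply: GB.
Qed.

Lemma mk_rmorphism (K : fieldType) (f : K -> F) :
  zmod_morphism f -> monoid_morphism f -> exists g : {rmorphism K -> F}, g =1 f.
Proof.
move=> fB fM.
pose fA := GRing.isZmodMorphism.Build K F f fB.
pose fR := GRing.isMonoidMorphism.Build K F f fM.
by exists (HB.pack f fA fR : {rmorphism K -> F}).
Qed.

(** An abstract field with two embeddings treats domain and range alike, so that the same lemmas
    apply to the graph and to its swap. *)
Lemma partial_morphismE G : partial_morphism G ->
  exists (K : fieldType) (j phi : {rmorphism K -> F}),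
    forall x y, G (x, y) <-> exists c, j c = x /\ phi c = y.
Proof.
move=> Gm; have [G1 GB GD G0] := Gm.
have domc : divring_closed (graph_dom G).
  split; first by apply/asboolP; exists 1.
    move=> x y /asboolP[x' Gx] /asboolP[y' Gy]; apply/asboolP.
    by exists (x' - y'); apply: GB.
  move=> x y /asboolP[x' Gx] /asboolP[y' Gy]; apply/asboolP.
  by exists (x' / y'); apply: GD.
pose dm := GRing.isDivringClosed.Build F (graph_dom G) domc.
pose D : divringClosed F := HB.pack (graph_dom G) dm.
have /choice[f fG] : forall c : subf D, exists y, G (subf_val D c, y).
  by move=> c; apply/asboolP; exact: (subf_valP c).
have GM x y x' y' : G (x, y) -> G (x', y') -> G (x * x', y * y').
  by move=> Gx /(GD _ _ _ _ G1); rewrite !div1r => /(GD _ _ _ _ Gx); rewrite !invrK.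
have fB : zmod_morphism f.
  move=> c d; apply: (partial_morphism_fun Gm (fG _)).
  by rewrite rmorphB; apply: GB.
have fM : monoid_morphism f.
  split=> [|c d]; apply: (partial_morphism_fun Gm (fG _)); first by rewrite rmorph1.
  by rewrite rmorphM; apply: GM.
have [phi phiE] := mk_rmorphism fB fM.
exists (subf D), (subf_val D), phi => x y; split=> [Gxy|[c [<- <-]]]; last first.
  by rewrite phiE.
have [c cx] : exists c : subf D, subf_val D c = x.
  by apply: subf_valE; apply/asboolP; exists y.
exists c; split=> //; rewrite phiE.
by apply: (partial_morphism_fun Gm (fG _)); rewrite cx.
Qed.

Section Simple.
Context {K : fieldType} (j phi : {rmorphism K -> F}).

Lemma min_poly_ex x : algebraicOver j x ->
  exists p, [/\ p != 0, root (map_poly j p) x &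
    forall q, root (map_poly j q) x -> p %| q].
Proof.
move=> [p0 p00 p0x].
pose Q n := `[< exists p, [/\ p != 0, root (map_poly j p) x & size p = n] >].
have exQ : exists n, Q n by exists (size p0); apply/asboolP; exists p0.
case: (ex_minnP exQ) => n /asboolP[p [pn0 px sp]] minn.
exists p; split=> // q qx; apply/negPn/negP => /negP npq.
have r0 : q %% p != 0 by apply/negP => /eqP/modp_eq0P.
have := minn (size (q %% p)); rewrite -sp leqNgt ltn_modp pn0 => /(_ _)/negP; apply=> //.
apply/asboolP; exists (q %% p); split=> //; apply/rootP.
move: qx; rewrite {1}(divp_eq q p) rmorphD rmorphM /= rootE hornerD hornerM.
by rewrite (rootP px) mulr0 add0r => /eqP.
Qed.

(** The graph sends q(x) to q(y). It is well defined because p divides every q that kills x, and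
    polynomial expressions in x suffice because x is algebraic. *)
Lemma simple_extension x y p : root (map_poly j p) x -> root (map_poly phi p) y ->
  (forall q, root (map_poly j q) x -> p %| q) -> p != 0 ->
  exists G, [/\ partial_morphism G, G (x, y) & forall c, G (j c, phi c)].
Proof.
move=> px py minp p0.
pose G : set (F * F) := [set u | exists q, u = ((map_poly j q).[x], (map_poly phi q).[y])].
have root0 q : (map_poly j q).[x] = 0 -> (map_poly phi q).[y] = 0.
  move=> /rootP/minp/dvdpP[r ->]; rewrite rmorphM hornerM /= (rootP py).
  by rewrite mulr0.
exists G; split.
- split.
  + by exists 1; rewrite !rmorph1 !horner1.
  + move=> _ _ _ _ [q [-> ->]] [r [-> ->]]; exists (q - r).
    by rewrite !rmorphB !hornerD !hornerN.
  + move=> _ _ _ _ [q [-> ->]] [r [-> ->]].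
    have [rx|rx] := eqVneq (map_poly j r).[x] 0.
      exists 0; rewrite !rmorph0 !horner0 rx (root0 _ rx).
      by rewrite !invr0 !mulr0.
    (* A common divisor d of p and r does not kill x, since p would then divide d and hence r. So
       the cofactor e of d in p kills x, p divides e, and d is constant. *)
    have cop : coprimep p r.
      apply/coprimepP => d dp dr; rewrite -size_poly_eq1.
      have d0 : d != 0 by apply: contraNneq p0 => d0; rewrite -dvd0p -d0.
      have [e pE] := dvdpP _ _ dp.
      have : root (map_poly j e) x || root (map_poly j d) x.
        by rewrite -rootM -rmorphM /= -pE.
      have /negP/negbTE-> : ~ root (map_poly j d) x.
        move=> /minp pd; have /dvdp_trans/(_ dr)/dvdpP[s rE] := pd.
        by move/eqP: rx; apply; rewrite rE rmorphM hornerM /= (rootP px) mulr0.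
      rewrite orbF => /minp pe; have e0 : e != 0.
        by apply: contraNneq p0 => e0; rewrite pE e0 mul0r.
      have := dvdp_leq e0 pe; rewrite pE size_mul // -subn1 leq_subLR addnC.
      by rewrite leq_add2r => sd; rewrite eqn_leq sd size_poly_gt0.
    have [[u v] /= uv] := Bezout_eq1_coprimepP _ _ cop.
    (* The Bezout coefficient v represents the inverse on both sides of the graph at once, through j
       at x and through phi at y. *)
    have inv (psi : {rmorphism K -> F}) z : root (map_poly psi p) z ->
        ((map_poly psi r).[z])^-1 = (map_poly psi v).[z].
      move=> /rootP pz; apply: mulr1_eq.
      have : (map_poly psi (u * p + v * r)).[z] = 1 by rewrite uv rmorph1 horner1.
      by rewrite rmorphD !rmorphM !hornerE /= pz mulr0 add0r mulrC.
    by exists (q * v); rewrite !rmorphM !hornerM /= !inv.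
  + by move=> _ [q [/esym/root0 -> ->]].
- exists 'X; by rewrite !map_polyX !hornerX.
- by move=> c; exists c%:P; rewrite !map_polyC !hornerC.
Qed.
End Simple.

Lemma polyOver_coef (S : {pred F}) (p : {poly F}) i : 0 \in S ->
  p \is a polyOver S -> p`_i \in S.
Proof.
move=> S0 /(all_nthP 0) pS.
by have [/pS //|/(nth_default 0)->] := ltnP i (size p).
Qed.

Lemma graph_dom_alg G (K : fieldType) (j phi : {rmorphism K -> F}) x :
  (forall x y, G (x, y) <-> exists c, j c = x /\ phi c = y) ->
  alg (graph_dom G) x -> algebraicOver j x.
Proof.
move=> GE [p p0 [pL px]].
have pj i : exists c, j c = p`_i.
  have /asboolP[y /GE[c [cE _]]] : p`_i \in graph_dom G.
    apply: (polyOver_coef _ _ pL); apply/asboolP; exists 0; apply/GE.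
    by exists 0; rewrite !rmorph0.
  by exists c.
have [c cE] := choice pj.
have qE : map_poly j (\poly_(i < size p) c i) = p.
  apply/polyP => i; rewrite coef_map coef_poly; case: ltnP => [_|/(nth_default 0)->].
    exact: cE.
  by rewrite /= rmorph0.
exists (\poly_(i < size p) c i); last by rewrite qE.
by rewrite -(map_poly_eq0 j) qE.
Qed.

Definition graph_swap (G : set (F * F)) : set (F * F) := [set u | G (u.2, u.1)].

End PartialMorphisms.

Section Extension.
Context {F : closedFieldType}.

(** A maximal extension is total, since a minimal polynomial over its domain has its image under the
    morphism solvable in F. It is onto because z is a root of the image of a polynomial that splits
    in F, so z is the image of one of its roots. *)
Lemma extend_partial (G0 : set (F * F)) : partial_morphism G0 ->
  (forall x, alg (graph_dom G0) x) -> (forall y, alg (graph_ran G0) y) ->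
  exists g : {rmorphism F -> F}, bijective g /\ forall x y, G0 (x, y) -> g x = y.
Proof.
move=> G0m G0dom G0ran.
have [||G [G0G Gm maxG]] := @zorn_above _ partial_morphism G0; first by [].
  move=> C [A CA] CP Ctot.
  have dir u v : (\bigcup_(A in C) A) u -> (\bigcup_(A in C) A) v ->
      exists2 B, C B & B u /\ B v.
    move=> [B CB Bu] [D CD Dv].
    by have [BD|DB] := Ctot _ _ CB CD; [exists D|exists B] => //; split=> //;
      [apply: BD|apply: DB].
  split=> [|x y x' y' Cx Cx'|x y x' y' Cx Cx'|y [B CB]].
  - by exists A => //; case: (CP _ CA).
  - by have [B CB [Bx Bx']] := dir _ _ Cx Cx'; exists B => //; case: (CP _ CB) => _ + _ _; apply.
  - by have [B CB [Bx Bx']] := dir _ _ Cx Cx'; exists B => //; case: (CP _ CB) => _ _ + _; apply.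
  - by case: (CP _ CB) => _ _ _; apply.
have [K [j [phi GE]]] := partial_morphismE Gm.
have tot x : exists y, G (x, y).
  have ax : algebraicOver j x.
    apply: graph_dom_alg GE _; case: (G0dom x) => p p0 [pL px].
    exists p => //; split=> //; apply: polyOverS pL => z /asboolP[y /G0G Gzy].
    by apply/asboolP; exists y.
  have [p [p0 px minp]] := min_poly_ex ax.
  have [y py] : exists y, root (map_poly phi p) y.
    apply/closed_rootP; rewrite size_map_poly; apply/eqP => sp1.
    have [c c0 pE] := size_poly1P _ (introT eqP sp1).
    by move: px; rewrite pE map_polyC rootC fmorph_eq0 (negbTE c0).
  have [G' [G'm G'xy GG']] := simple_extension px py minp p0.
  exists y; apply: (maxG G') => //.
  by move=> [a b] /GE[c [<- <-]].
have [g gG] := choice tot.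
have [G1 GB GD _] := Gm.
have GM x y x' y' : G (x, y) -> G (x', y') -> G (x * x', y * y').
  by move=> Gx /(GD _ _ _ _ G1); rewrite !div1r => /(GD _ _ _ _ Gx); rewrite !invrK.
have fB : zmod_morphism g.
  by move=> c d; apply: (partial_morphism_fun Gm (gG _)); apply: GB.
have fM : monoid_morphism g.
  split=> [|c d]; apply: (partial_morphism_fun Gm (gG _)) => //.
  exact: GM.
have [h hE] := mk_rmorphism fB fM.
have hG x y : G (x, y) -> h x = y.
  by move=> Gxy; rewrite hE; apply: (partial_morphism_fun Gm (gG _)).
have jh c : h (j c) = phi c by apply: hG; apply/GE; exists c.
exists h; split; last by move=> x y /G0G; apply: hG.
have surj z : exists x, h x = z.
  have az : algebraicOver phi z.
    apply: (@graph_dom_alg _ (graph_swap G) K phi j).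
      by move=> x y; split=> [/GE[c [? ?]]|[c [? ?]]]; [exists c|apply/GE; exists c].
    case: (G0ran z) => p p0 [pL px]; exists p => //; split=> //.
    apply: polyOverS pL => y /asboolP[x /G0G Gzy].
    by apply/asboolP; exists x.
  have [p p0 pz] := az.
  have [r pE] := closed_field_poly_normal (map_poly j p).
  have : map_poly phi p = map_poly h (map_poly j p).
    by rewrite -map_poly_comp; apply: eq_map_poly => c /=; rewrite jh.
  move: pz => /[swap] ->; rewrite {}pE map_polyZ rootZ; last first.
    by rewrite fmorph_eq0 lead_coef_eq0 map_poly_eq0.
  rewrite rmorph_prod /=.
  under eq_bigr do rewrite map_polyXsubC.
  rewrite -(big_map h xpredT (fun y => 'X - y%:P)) root_prod_XsubC.
  by move=> /mapP[x _ ->]; exists x.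
have [h' h'K] := choice surj.
by exists h' => // x; apply: (fmorph_inj h); rewrite h'K.
Qed.
End Extension.

Section MaximalSubfields.
Context {F : fieldType}.
Implicit Types L M : divringClosed F.

Lemma chain_mem (C : set (set F)) (s : seq F) : C !=set0 -> total_on C subset ->
  {in s, forall x, (\bigcup_(A in C) A) x} -> exists2 A, C A & {in s, forall x, A x}.
Proof.
move=> [A CA] Ctot; elim: s => [|x s IH] h; first by exists A.
have /IH[B CB sB] : {in s, forall x, (\bigcup_(A in C) A) x}.
  by move=> y ys; apply: h; rewrite inE ys orbT.
have [D CD Dx] := h x (mem_head _ _).
have [BD|DB] := Ctot _ _ CB CD; [exists D|exists B] => // y; rewrite inE.
  by move=> /orP[/eqP->//|/sB]; apply: BD.
by move=> /orP[/eqP->|/sB//]; apply: DB.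
Qed.

Lemma chain_subfield (C : set (set F)) : C !=set0 -> total_on C subset ->
  C `<=` @is_subfield F -> is_subfield (\bigcup_(A in C) A).
Proof.
move=> C0 Ctot Csub; split=> [|x y /set_mem Cx /set_mem Cy|x y /set_mem Cx /set_mem Cy].
- by have [A CA] := C0; apply/mem_set; exists A => //; case: (Csub _ CA) => /set_mem.
- have /(chain_mem C0 Ctot)[A CA Axy] :
      {in [:: x; y], forall x, (\bigcup_(A in C) A) x}.
    by move=> u; rewrite !inE => /orP[]/eqP->.
  apply/mem_set; exists A => //; have [_ + _] := Csub _ CA.
  by move=> /(_ x y) h; apply/set_mem/h; apply/mem_set/Axy; rewrite !inE eqxx ?orbT.
- have /(chain_mem C0 Ctot)[A CA Axy] :
      {in [:: x; y], forall x, (\bigcup_(A in C) A) x}.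
    by move=> u; rewrite !inE => /orP[]/eqP->.
  apply/mem_set; exists A => //; have [_ _] := Csub _ CA.
  by move=> /(_ x y) h; apply/set_mem/h; apply/mem_set/Axy; rewrite !inE eqxx ?orbT.
Qed.

Lemma maximal_subfield (P : set F -> Prop) L :
  P [set` L] ->
  (forall C : set (set F), C !=set0 -> total_on C subset ->
     C `<=` @is_subfield F -> C `<=` P -> P (\bigcup_(A in C) A)) ->
  exists L' : divringClosed F, [/\ {subset L <= L'}, P [set` L'] &
    forall M, {subset L' <= M} -> P [set` M] -> {subset M <= L'}].
Proof.
move=> PL PC.
have Lsub M : is_subfield [set` M].
  split=> [|x y|x y]; rewrite ?mem_setE; first exact: rpred1.
    exact: rpredB.
  exact: rpred_div.
have [||A [LA [Asub PA] maxA]] :=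
    @zorn_above F (fun A => is_subfield A /\ P A) [set` L]; first by split.
  move=> C C0 CP Ctot; split; first by apply: chain_subfield => // A /CP[].
  by apply: PC => // A /CP[].
have AE : [set` set_subfield Asub] = A.
  by apply/seteqP; split=> x; rewrite /= set_subfieldE.
exists (set_subfield Asub); split=> [x xL||M AM PM x xM].
- by apply/set_subfieldE/LA.
- by rewrite AE.
- apply/set_subfieldE/(maxA [set` M]) => // y Ay.
  by apply: AM; apply/set_subfieldE.
Qed.

(** Adjoining an element transcendental over L' creates no new element algebraic over L, so a
    maximal L' meeting the closure of L only in L has F algebraic over it. This reduces Galois
    theory over L to the case where F is algebraic. *)
Lemma maximal_regular L : exists L' : divringClosed F, [/\ {subset L <= L'},
  forall u, u \in L' -> u \in acl L -> u \in L & forall x, x \in acl L'].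
Proof.
have [||L' [LL' PL' max]] :=
    @maximal_subfield (fun A => forall u, A u -> u \in acl L -> u \in L) L; first by [].
  by move=> C _ _ _ CP u [A CA Au]; apply: CP Au.
exists L'; split=> // x; apply/negPn/negP => xL'.
move/negP: (xL'); apply; apply: sub_acl.
apply: (max (adj L' x)); [exact: sub_adj| |exact: adj_id].
move=> u uL' uL; apply: PL' => //; apply: (adj_acl xL') => //.
exact: (acl_mono LL').
Qed.

(** By maximality any x outside R makes z algebraic over R(x); if x is transcendental over R,
    exchange makes it algebraic over R(z). So one transcendental is left, and the group fixing R(z)
    is compact. *)
Lemma maximal_transcendental L z : z \notin acl L -> exists R : divringClosed F,
  [/\ {subset L <= R}, z \notin acl R & forall x, x \in acl (adj R z)].
Proof.
move=> zL.
have [||R [LR zR max]] :=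
    @maximal_subfield (fun A => ~ alg (fun x => `[< A x >]) z) L.
- move=> zA; move/negP: zL; apply; apply/aclP; apply: alg_mono zA.
  by move=> x /asboolP.
- move=> C C0 Ctot Csub CP [p p0 [pC pz]].
  have /(chain_mem C0 Ctot)[A CA Ap] :
      {in (p : seq F), forall x, (\bigcup_(A in C) A) x}.
    by move=> x xp; move/allP: pC => /(_ x xp) /asboolP.
  apply: (CP A CA); exists p => //; split=> //.
  by apply/allP => x /Ap Ax; apply/asboolP.
have PE M : alg (fun x => `[< [set` M] x >]) z <-> z \in acl M.
  split=> [h|/aclP]; first by apply/aclP; apply: alg_mono h => x /asboolP.
  by apply: alg_mono => x xM; apply/asboolP.
have {}zR : z \notin acl R by apply/negP => /PE.
exists R; split=> // x; have [xR|xR] := boolP (x \in R); first exact/sub_acl/sub_adj.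
have [xaR|xaR] := boolP (x \in acl R); first by apply: acl_mono xaR; exact: sub_adj.
have : z \in acl (adj R x).
  apply/negPn/negP => zRx; move/negP: xR; apply.
  apply: (max (adj R x)); [exact: sub_adj| by move=> /PE; apply/negP|exact: adj_id].
by move=> /exchange; apply.
Qed.
End MaximalSubfields.

(** * Galois theory inside an algebraically closed field *)

Section Galois.
Context {k F : closedFieldType} (iota : {rmorphism k -> F}).
Hypothesis char0 : [pchar F] =i pred0.
Implicit Types L M : divringClosed F.

Definition fixes (L : {pred F}) (g : F -> F) := {in L, forall x, g x = x}.

Lemma mk_aut (G : set (F * F)) : partial_morphism G ->
  (forall c, G (iota c, iota c)) ->
  (forall x, alg (graph_dom G) x) -> (forall y, alg (graph_ran G) y) ->
  exists g : aut iota, forall x y, G (x, y) -> g x = y.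
Proof.
move=> Gm Gk Gd Gr; have [g [gB gG]] := extend_partial Gm Gd Gr.
by exists (Aut gB (fun c => gG _ _ (Gk c))).
Qed.

(** Separability in characteristic zero: if x were the only root, p would be a multiple of (X -
    x)^n. As p' is non-zero of smaller degree, it does not kill x, so n = 1 and x lies in K. *)
Lemma other_root (K : fieldType) (j : {rmorphism K -> F}) x p : p != 0 ->
  root (map_poly j p) x -> (forall q, root (map_poly j q) x -> p %| q) ->
  (forall c, j c != x) -> exists2 y, root (map_poly j p) y & y != x.
Proof.
move=> p0 px minp xK; apply: contrapT => nex.
have [r pE] := closed_field_poly_normal (map_poly j p).
have lc0 : lead_coef (map_poly j p) != 0 by rewrite lead_coef_eq0 map_poly_eq0.
have rx : r = nseq (size r) x.
  apply/all_pred1P/allP => y yr; apply/negPn/negP => /= yx; apply: nex; exists y => //.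
  by rewrite pE rootZ // root_prod_XsubC.
have {}pE : map_poly j p = lead_coef (map_poly j p) *: ('X - x%:P) ^+ size r.
  by rewrite {1}pE {1}rx big_nseq -Monoid.iteropE.
have p'0 : p^`() != 0.
  apply/eqP => /polyP/(_ (size p).-2); rewrite coef_deriv coef0 => /eqP.
  have sp : (1 < size p)%N.
    rewrite ltnNge; apply/negP => /size1_polyC pC; move: px.
    by rewrite pC map_polyC rootC fmorph_eq0 -polyC_eq0 -pC (negbTE p0).
  have -> : (size p).-2.+1 = (size p).-1 by case: (size p) sp => [|[]].
  rewrite -mulr_natr mulf_eq0 -lead_coefE lead_coef_eq0 (negbTE p0) /=.
  rewrite -(fmorph_eq0 j) rmorph_nat ((pcharf0P _).1 char0).
  by case: (size p) sp => [|[]].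
have : ~~ root (map_poly j p^`()) x.
  apply/negP => /minp/(dvdp_leq p'0); rewrite leqNgt lt_size_deriv //.
have -> : map_poly j p^`() = (map_poly j p)^`() by rewrite deriv_map.
rewrite pE derivZ rootZ // deriv_exp derivXsubC mul1r.
case: (size r) pE => [|[|n]] pE.
- by move: px; rewrite pE expr0 alg_polyC rootC (negbTE lc0).
- move=> _; have [] := negP (xK (- p`_0 / p`_1)).
  have c0 := congr1 (fun q : {poly F} => q`_0) pE.
  have c1 := congr1 (fun q : {poly F} => q`_1) pE.
  move: c0 c1; rewrite !coef_map /= !coefZ expr1 !coefB !coefX !coefC /= subr0 sub0r mulr1.
  rewrite fmorph_div rmorphN /= => -> ->.
  by rewrite mulrN opprK mulrC mulKf.
- by rewrite /= exprS /root hornerMn hornerM hornerXsubC subrr mul0r mul0rn eqxx.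
Qed.

Lemma move_aut L x : (forall c, iota c \in L) -> (forall y, y \in acl L) ->
  x \notin L -> exists2 g : aut iota, fixes L g & g x != x.
Proof.
move=> kL Lalg xL.
have [p [p0 px minp]] := min_poly_ex ((algE L x).1 (aclP _ _ (Lalg x))).
have [|y py yx] := other_root p0 px minp.
  by move=> c; apply: contraNneq xL => <-; exact: subf_valP.
have [G [Gm Gxy Gc]] := simple_extension px py minp p0.
have GL z : z \in L -> G (z, z) by move=> /subf_valE[c <-].
have [|z|z|g gG] := mk_aut Gm.
- by move=> c; apply: GL.
- by apply: (alg_mono _ (aclP _ _ (Lalg z))) => u /GL Gu; apply/asboolP; exists u.
- by apply: (alg_mono _ (aclP _ _ (Lalg z))) => u /GL Gu; apply/asboolP; exists u.
- by exists g => [u /GL/gG//|]; rewrite (gG _ _ Gxy).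
Qed.

(** An element outside L but algebraic over L is also outside the field of [maximal_regular], over
    which F is algebraic, and can be moved to another root of its minimal polynomial there. *)
Lemma fixed_mem L x : (forall c, iota c \in L) -> x \in acl L ->
  (forall g : aut iota, fixes L g -> g x = x) -> x \in L.
Proof.
move=> kL xaL xfix; have [L' [LL' L'L L'alg]] := maximal_regular L.
apply: L'L => //; apply: contrapT => /negP xL'.
have [|g gL'] := move_aut _ L'alg xL'; first by move=> c; apply: LL'.
by rewrite xfix ?eqxx // => u /LL'; apply: gL'.
Qed.

End Galois.

(** * The topology of the automorphism group *)

Section AutGroup.
Context {k F : closedFieldType} (iota : {rmorphism k -> F}).
Implicit Types (g h u : aut iota) (H : set (aut iota)) (L : divringClosed F).

Lemma autM g h x : (g * h)%g x = g (h x). Proof. by []. Qed.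
Lemma autK g : cancel g (g^-1)%g. Proof. exact: aut_invK. Qed.
Lemma autVK g : cancel (g^-1)%g g. Proof. exact: aut_Kinv. Qed.
Lemma aut_inj g : injective g. Proof. exact: can_inj (autK g). Qed.
Lemma autV_fix g x : g x = x -> (g^-1)%g x = x.
Proof. by move=> gx; rewrite -{1}gx autK. Qed.
Lemma autV_eq g x y : g x = y -> (g^-1)%g y = x.
Proof. by move=> <-; rewrite autK. Qed.

Section Subgroup.
Context (H : set (aut iota)) (Hsub : is_subgroup H).
Lemma subgroup1 : H 1%g. Proof. by case: Hsub => /set_mem. Qed.
Lemma subgroupV g : H g -> H (g^-1)%g.
Proof. by move=> /mem_set Hg; apply/set_mem/(group_closedV Hsub). Qed.
Lemma subgroupM g h : H g -> H h -> H (g * h)%g.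
Proof. by move=> /mem_set Hg /mem_set Hh; apply/set_mem/(group_closedM Hsub). Qed.
Lemma subgroupX g n : H g -> H (g ^+ n)%g.
Proof.
move=> Hg; elim: n => [|n IH]; first exact: subgroup1.
by rewrite expgS; apply: subgroupM.
Qed.
End Subgroup.

Lemma is_subgroupP H : H 1%g -> (forall g h, H g -> H h -> H (g * h)%g) ->
  (forall g, H g -> H (g^-1)%g) -> is_subgroup H.
Proof.
move=> H1 HM HV; split; first exact: mem_set.
by move=> g h /set_mem Hg /set_mem Hh; apply/mem_set/HM => //; apply: HV.
Qed.

Lemma fixes_subgroup (L : {pred F}) : is_subgroup [set g : aut iota | fixes L g].
Proof.
apply: is_subgroupP => [|g h gL hL|g gL] x xL //.
  by rewrite autM hL // gL.
by rewrite autV_fix // gL.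
Qed.

Lemma fixes_gen (S : set F) g : (forall x, S x -> g x = x) ->
  forall x, subfield_gen iota S x -> g x = x.
Proof.
move=> gS x /(_ [set y | g y = y]); apply; split; first exact: fixed_field_is_subfield.
by move=> y [[c _ <-]|/gS//]; exact: aut_fix.
Qed.

Lemma nbhs_autP g (A : set (aut iota)) : nbhs g A <->
  exists s : seq F, forall h, {in s, h =1 g} -> A h.
Proof.
split=> [[L [S finS ->] LA]|[s sA]].
  have /finite_seqP[D SD] := finS.
  exists D => h hg; apply: LA; exists (g^-1 * h)%g; last by rewrite mulVKg.
  apply: fixes_gen => x Sx; rewrite autM hg ?autK //.
  by move: Sx; rewrite SD.
exists (subfield_gen iota [set` s]); first by exists [set` s] => //; exact: finite_seq.
move=> _ [u us <-]; apply: sA => x xs; rewrite autM us //.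
exact: sub_subfield_gen.
Qed.

Lemma ultra_seq (U : set_system (aut iota)) (f : aut iota -> F) (r : seq F) :
  UltraFilter U -> U [set g | f g \in r] -> exists y, U [set g | f g = y].
Proof.
move=> UU; elim: r => [|y r IH] Ur.
  by exfalso; apply: (@filter_not_empty _ U); apply: filterS Ur.
have [Uy|Uy] := in_ultra_setVsetC [set g | f g = y] UU; first by exists y.
apply: IH; apply: filterS2 Ur Uy => g /=; rewrite inE.
by move=> /orP[/eqP fy|//] nfy.
Qed.

Lemma orbit_bounded L x : x \in acl L ->
  exists r : seq F, forall g, fixes L g -> g x \in r.
Proof.
move=> /aclP[p p0 [pL px]].
have [r pE] := closed_field_poly_normal p; exists r => g gL.
rewrite -root_prod_XsubC -(@rootZ _ _ (lead_coef p)) ?lead_coef_eq0 // -pE.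
rewrite -[p](_ : map_poly g p = p).
  by apply/rootP; rewrite horner_map (rootP px) rmorph0.
by apply/polyP => i; rewrite coef_map; apply: gL; apply: (polyOverP pL).
Qed.

(** Every x has finitely many images, so an ultrafilter decides the value of g x for each x. It
    decides the value of g^-1 x as well, and these two limits are inverse to each other. *)
Lemma fixes_compact L : (forall x, x \in acl L) ->
  compact [set g : aut iota | fixes L g].
Proof.
move=> Lalg; rewrite compact_ultra => U UU UL.
have exU x : exists y, U [set g | g x = y].
  have [r rP] := orbit_bounded (Lalg x).
  by apply: (@ultra_seq U (fun g => g x) r); apply: filterS UL => g; exact: rP.
have exV x : exists y, U [set g : aut iota | (g^-1)%g x = y].
  have [r rP] := orbit_bounded (Lalg x).
  apply: (@ultra_seq U (fun g : aut iota => (g^-1)%g x) r); apply: filterS UL => g gL.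
  by apply: rP; apply: (subgroupV (fixes_subgroup L)).
have [f fU] := choice exU; have [f' f'U] := choice exV.
have get (A : set (aut iota)) : U A -> exists g, A g by exact: filter_ex.
have fB : zmod_morphism f.
  move=> x y; have [g [/= <- [<- <-]]] := get _ (filterI (fU (x - y)) (filterI (fU x) (fU y))).
  exact: rmorphB.
have fM : monoid_morphism f.
  split; first by have [g /= <-] := get _ (fU 1); exact: rmorph1.
  move=> x y; have [g [/= <- [<- <-]]] := get _ (filterI (fU (x * y)) (filterI (fU x) (fU y))).
  exact: rmorphM.
have [f0 f0E] := mk_rmorphism fB fM.
have fK : cancel f0 f'.
  move=> x; have [g [/= e1 e2]] := get _ (filterI (fU x) (f'U (f x))).
  by rewrite f0E -e2 -e1 autK.
have f'K : cancel f' f0.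
  move=> x; have [g [/= e1 e2]] := get _ (filterI (f'U x) (fU (f' x))).
  by rewrite f0E -e2 -e1 autVK.
have fk c : f0 (iota c) = iota c.
  by rewrite f0E; have [g /= <-] := get _ (fU (iota c)); exact: aut_fix.
exists (Aut (Bijective fK f'K) fk); split.
  move=> x xL /=; have [g [/= e gL]] := get _ (filterI (fU x) UL).
  by rewrite f0E -e gL.
move=> A /nbhs_autP[s sA]; suff : U [set g : aut iota | {in s, g =1 f}].
  by apply: filterS => g gs; apply: sA => x xs /=; rewrite f0E gs.
elim: s {sA} => [|x s IH]; first by apply: filterS (fU 0).
apply: filterS2 (fU x) IH => g /= gx gs y; rewrite inE => /orP[/eqP->//|].
exact: gs.
Qed.

HB.instance Definition _ := isPointed.Build (aut iota) 1%g.

Lemma compact_orbit H x : compact H -> exists r : seq F, forall g, H g -> g x \in r.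
Proof.
rewrite compact_cover => Hc.
have [||D _ Dc] := Hc F setT (fun y => [set g : aut iota | g x = y]).
- move=> y _; rewrite openE => g /= gx; apply/nbhs_autP; exists [:: x] => h hg /=.
  by rewrite hg ?mem_head.
- by move=> g Hg; exists (g x).
- by exists (finmap.enum_fset D) => g /Dc[y yD /= ->].
Qed.

Lemma compact_circ H g : is_subgroup H -> compact H -> H g -> aut_circ iota g.
Proof.
by move=> Hs Hc Hg A [_ HA]; apply: HA; exists H.
Qed.

Lemma circ_subgroup : is_subgroup (aut_circ iota).
Proof.
apply: is_subgroupP => [A [As _]|g h gc hc A AP|g gc A AP].
- exact: (subgroup1 As).
- by apply: (subgroupM AP.1); [apply: gc|apply: hc].
- by apply: (subgroupV AP.1); apply: gc.
Qed.

Lemma fixes_circ L g : (forall x, x \in acl L) -> fixes L g -> aut_circ iota g.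
Proof. by move=> /fixes_compact; apply: compact_circ; exact: fixes_subgroup. Qed.

End AutGroup.

(** * Reflections, translations and rotations in G° *)

Section Involutions.
Context {k F : closedFieldType} (iota : {rmorphism k -> F}).
Hypothesis char0 : [pchar F] =i pred0.
Implicit Types (g h u : aut iota) (H : set (aut iota)) (L M : divringClosed F).

Lemma natr_inj : injective (fun n : nat => n%:R : F).
Proof.
move=> m n; wlog lmn : m n / (m <= n)%N => [hw|].
  by case/orP: (leq_total m n) => /hw // + /esym => /[apply].
move=> /eqP; rewrite eq_sym -subr_eq0 -natrB // ((pcharf0P _).1 char0).
by rewrite subn_eq0 => nm; apply/eqP; rewrite eqn_leq lmn.
Qed.


Lemma fixes_horner (L : {pred F}) g (p : {poly F}) x : fixes L g ->
  0 \in L -> p \is a polyOver L -> g p.[x] = p.[g x].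
Proof.
move=> gL L0 pL; rewrite -horner_map (_ : map_poly g p = p) //.
by apply/polyP => i; rewrite coef_map; apply: gL; apply: polyOver_coef.
Qed.

Lemma fixes_adj L g x : fixes L g -> g x = x -> fixes (adj L x) g.
Proof.
move=> gL gx u /adjP[p [pL [q [qL q0 ->]]]].
by rewrite fmorph_div !(fixes_horner _ gL) ?rpred0 // gx.
Qed.

Lemma fixes_sub (L M : {pred F}) g : {subset L <= M} -> fixes M g -> fixes L g.
Proof. by move=> LM gM x /LM/gM. Qed.

(** The substitution of b - t for t is an involution of R(t); its extension to F need not be one.
    Membership in G° comes from the fixed element t (b - t): t is quadratic over R(t (b - t)), so F
    is algebraic over that field and the group fixing it is compact. *)
Lemma affine_involution L t b : (forall c, iota c \in L) -> t \notin acl L ->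
  b \in L -> exists g, [/\ aut_circ iota g, fixes L g & g t = b - t].
Proof.
move=> kL tL bL; have [R [LR tR Ralg]] := maximal_transcendental tL.
have btR : b - t \notin acl R.
  apply: contra tR => btR; rewrite -(subKr b t) rpredB //.
  exact/sub_acl/LR.
pose G : set (F * F) := [set u | exists p, p \is a polyOver R /\ exists q,
   [/\ q \is a polyOver R, q.[t] != 0 &
     u = (p.[t] / q.[t], p.[b - t] / q.[b - t])]].
have nz (q : {poly F}) : q \is a polyOver R -> q.[t] != 0 -> q.[b - t] != 0.
  by move=> qR; apply: contraNneq => /(transc_eq0 btR qR) ->; rewrite horner0.
have Gm : partial_morphism G.
  split=> [|x y x' y'|x y x' y'|y].
  2,3: move=> [p [pR [q [qR q0 [-> ->]]]]] [p' [pR' [q' [qR' q0' [-> ->]]]]].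
  4: move=> [p [pR [q [qR q0 [pq0 ->]]]]].
  - exists 1; rewrite rpred1; split=> //; exists 1.
    by rewrite rpred1 !horner1 oner_eq0 divr1.
  - exists (p * q' - p' * q); split; first by rewrite rpredB ?rpredM.
    exists (q * q'); rewrite rpredM //; split=> //; rewrite !hornerE ?mulf_neq0 //.
    by rewrite -!mulNr !addf_div ?nz // !mulNr.
  - have [p0'|p0'] := eqVneq p'.[t] 0.
      rewrite (transc_eq0 tR pR' p0'); exists 0; rewrite rpred0; split=> //.
      exists 1; rewrite rpred1 !horner1 !horner0 oner_eq0.
      by rewrite !mul0r invr0 !mulr0.
    exists (p * q'); split; first by rewrite rpredM.
    exists (q * p'); rewrite rpredM //; split=> //; rewrite !hornerE ?mulf_neq0 //.
    by rewrite !invf_div !mulf_div.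
  - rewrite (_ : p = 0) ?horner0 ?mul0r //; apply: (transc_eq0 tR pR).
    by move/esym/eqP: pq0; rewrite mulf_eq0 invr_eq0 (negbTE q0) orbF => /eqP.
have GR x : x \in R -> G (x, x).
  move=> xR; exists x%:P; rewrite polyOverC; split=> //; exists 1.
  by rewrite rpred1 !horner1 oner_eq0 !divr1 !hornerC.
have [|x|x|g gG] := mk_aut (iota := iota) Gm.
- by move=> c; apply/GR/LR.
- apply: alg_mono (aclP _ _ (Ralg x)) => u /adjP[p [pR [q [qR q0 ->]]]].
  by apply/asboolP; exists (p.[b - t] / q.[b - t]), p; split=> //; exists q.
- apply: alg_mono (aclP _ _ (Ralg x)) => u /adjP[p [pR [q [qR q0 ->]]]].
  have cR (r : {poly F}) : r \is a polyOver R -> r \Po (b%:P - 'X) \is a polyOver R.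
    by move=> rR; rewrite polyOver_comp ?rpredB ?polyOverX ?polyOverC ?LR.
  have cE (r : {poly F}) : (r \Po (b%:P - 'X)).[b - t] = r.[t].
    by rewrite horner_comp !hornerE subKr.
  apply/asboolP; exists ((p \Po (b%:P - 'X)).[t] / (q \Po (b%:P - 'X)).[t]).
  exists (p \Po (b%:P - 'X)); split; first exact: cR.
  exists (q \Po (b%:P - 'X)); split; [exact: cR| |by rewrite !cE].
  apply: contraNneq q0 => /(transc_eq0 tR (cR _ qR)) q0.
  by rewrite -cE q0 horner0.
have gR : fixes R g by move=> x /GR/gG.
have gt : g t = b - t.
  apply: gG; exists 'X; rewrite polyOverX; split=> //; exists 1.
  by rewrite rpred1 !horner1 oner_eq0 !divr1 !hornerX.
have gb : g b = b by apply/gR/LR.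
exists g; split=> //; last by move=> x /LR/gR.
apply: (@fixes_circ _ _ _ (adj R (t * (b - t)))); last first.
  by apply: fixes_adj => //; rewrite rmorphM rmorphB gt gb subKr mulrC.
move=> x; apply: (acl_sub _ (Ralg x)); apply: adj_min.
  by move=> u uR; apply/sub_acl/sub_adj.
apply/aclP; exists ('X^2 - b *: 'X + (t * (b - t))%:P).
  apply/eqP => /polyP/(_ 2) /eqP.
  by rewrite !coefD coefN coefXn coefZ coefX coefC coef0 mulr0 subr0 addr0 oner_eq0.
split.
  rewrite rpredD ?rpredB ?polyOverXn ?polyOverZ ?polyOverX ?polyOverC ?adj_id //.
  exact/sub_adj/LR.
by apply/rootP; rewrite !hornerE expr2 mulrBr (mulrC b) addrA subrK subrr.
Qed.

(** For b non-zero the orbit of t is infinite, so a translation lies in no compact subgroup; it is a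
    product of two reflections instead. *)
Lemma translation L t b : (forall c, iota c \in L) -> t \notin acl L ->
  b \in L -> exists g, [/\ aut_circ iota g, fixes L g & g t = t + b].
Proof.
move=> kL tL bL.
have [g1 [g1c g1L g1t]] := affine_involution kL tL (rpred0 L).
have [g2 [g2c g2L g2t]] := affine_involution kL tL bL.
exists (g1 * g2)%g; split.
- exact: (subgroupM (circ_subgroup iota)).
- by move=> x xL; rewrite autM g2L // g1L.
- by rewrite autM g2t rmorphB g1t g1L // sub0r opprK addrC.
Qed.

(** The usual product of three transvections: t to t + e, then e to e - t, then t to t + e again. *)
Lemma rotation L t e : (forall c, iota c \in L) -> t \notin acl (adj L e) ->
  e \notin acl (adj L t) ->
  exists g, [/\ aut_circ iota g, fixes L g, g t = e & g e = - t].
Proof.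
move=> kL te et.
have kadj x c : iota c \in adj L x by apply/sub_adj.
have [a [ac aL at_]] := translation (kadj e) te (adj_id _ _).
have mt : - t \in adj L t by rewrite rpredN adj_id.
have [b [bc bL be]] := translation (kadj t) et mt.
have ae : a e = e by apply/aL/adj_id.
have bt : b t = t by apply/bL/adj_id.
exists (a * (b * a))%g; split.
- by do 2?[apply: (subgroupM (circ_subgroup iota)) => //].
- by move=> x xL; rewrite !autM aL ?sub_adj // bL ?sub_adj // aL ?sub_adj.
- by rewrite !autM at_ rmorphD bt be subrKC ae.
- by rewrite !autM ae be rmorphB ae at_ opprD addrCA subrr addr0.
Qed.

End Involutions.

(** * Finite orbits and separating elements *)

Section Orbits.
Context {k F : closedFieldType} (iota : {rmorphism k -> F}).
Implicit Types (g h u : aut iota) (H K : set (aut iota)) (L M : divringClosed F).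

Definition is_orbit K (y : F) (O : seq F) :=
  uniq O /\ forall z, z \in O <-> exists2 g : aut iota, K g & g y = z.

Lemma orbit_ex K y : (exists r : seq F, forall g, K g -> g y \in r) ->
  exists O, is_orbit K y O.
Proof.
move=> [r rP]; exists [seq z <- undup r | `[< exists2 g : aut iota, K g & g y = z >]].
split=> [|z]; first by rewrite filter_uniq ?undup_uniq.
rewrite mem_filter mem_undup; split=> [/andP[/asboolP//]|ex].
by apply/andP; split; [exact/asboolP|case: ex => g Kg <-; exact: rP].
Qed.

Section Orbit.
Context (K : set (aut iota)) (Ksub : is_subgroup K) (y : F) (O : seq F)
  (OP : is_orbit K y O).

Lemma orbit_refl : y \in O.
Proof. by apply/OP.2; exists 1%g => //; exact: subgroup1. Qed.

Lemma orbit_perm g : K g -> perm_eq (map g O) O.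
Proof.
move=> Kg; have Ou := OP.1.
have gu : uniq (map g O) by rewrite map_inj_uniq //; exact: aut_inj.
apply: uniq_perm => //; apply: (uniq_min_size gu _ _).2; last by rewrite size_map.
move=> _ /mapP[z /OP.2[h Kh <-] ->]; apply/OP.2; exists (g * h)%g => //.
exact: subgroupM.
Qed.

Lemma orbit_prod_fixed (g : aut iota) (phi : F -> F) : K g ->
  {in O, forall z, g (phi z) = phi (g z)} ->
  g (\prod_(z <- O) phi z) = \prod_(z <- O) phi z.
Proof.
move=> Kg gphi; rewrite rmorph_prod -[RHS](perm_big _ (orbit_perm Kg)) big_map big_seq [RHS]big_seq.
by apply: eq_bigr => z /gphi.
Qed.

Lemma orbit_sum_fixed (g : aut iota) (phi : F -> F) : K g ->
  {in O, forall z, g (phi z) = phi (g z)} ->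
  g (\sum_(z <- O) phi z) = \sum_(z <- O) phi z.
Proof.
move=> Kg gphi; rewrite rmorph_sum -[RHS](perm_big _ (orbit_perm Kg)) big_map big_seq [RHS]big_seq.
by apply: eq_bigr => z /gphi.
Qed.

Lemma orbit_poly_fixed (g : aut iota) (phi : F -> F) : K g ->
  {in O, forall z, g (phi z) = phi (g z)} ->
  map_poly g (\prod_(z <- O) ('X - (phi z)%:P)) = \prod_(z <- O) ('X - (phi z)%:P).
Proof.
move=> Kg gphi; rewrite rmorph_prod /= -[RHS](perm_big _ (orbit_perm Kg)) big_map.
rewrite big_seq [RHS]big_seq; apply: eq_bigr => z /gphi zE.
by rewrite map_polyXsubC zE.
Qed.

(** On the orbit of y, the conjugates of a are a function of those of y. Norms of a can then be
    written as products of [phi] over the orbit of y. *)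
Lemma orbit_transfer (a : F) :
  (forall g, K g -> g y = y -> g a = a) ->
  exists phi : F -> F, forall g, K g -> phi (g y) = g a.
Proof.
move=> Ka.
have ex z : exists w, forall g, K g -> g y = z -> w = g a.
  have [[g Kg gy]|nex] := pselect (exists2 g : aut iota, K g & g y = z); last first.
    by exists 0 => g Kg gz; case: nex; exists g.
  exists (g a) => h Kh hy; apply: (aut_inj (g := (h^-1)%g)); rewrite autK -autM.
  apply: Ka; first by apply: subgroupM => //; exact: subgroupV.
  by rewrite autM gy -hy autK.
by have [phi phiP] := choice ex; exists phi => g Kg; apply: phiP.
Qed.
End Orbit.

Lemma bounded_orbit L y : y \in acl L ->
  exists O, is_orbit [set g | fixes L g] y O.
Proof. by move=> /(orbit_bounded iota) h; apply: orbit_ex. Qed.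

End Orbits.

Section Separation.
Context {k F : closedFieldType} (iota : {rmorphism k -> F}).
Hypothesis char0 : [pchar F] =i pred0.
Implicit Types (g h u : aut iota) (H K : set (aut iota)) (L M : divringClosed F).

Lemma finite_seq_inj (f : nat -> F) (r : seq F) : injective f -> exists n, f n \notin r.
Proof.
move=> fI; apply: contrapT => /forallNP all_in.
have /(uniq_leq_size _) : {subset [seq f n | n <- seq.iota 0 (size r).+1] <= r}.
  by move=> _ /mapP[n _ ->]; apply/negPn/negP/all_in.
rewrite map_inj_uniq ?iota_uniq // size_map size_iota => /(_ isT).
by rewrite ltnn.
Qed.

(** The powers of g send x to x + n w, while the conjugates of x over L are finite in number. *)
Lemma fixes_translate L g x w : fixes L g -> x \in acl L ->
  g x = x + w -> g w = w -> w = 0.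
Proof.
move=> gL xL gx gw; have [r rP] := orbit_bounded iota xL.
have gX n : (g ^+ n)%g x = x + w *+ n.
  elim: n => [|n IH]; first by rewrite mulr0n addr0.
  by rewrite expgS autM IH rmorphD rmorphMn gx gw mulrS addrA.
apply/eqP/negPn/negP => w0.
have [|n] := @finite_seq_inj (fun n => x + w *+ n) r.
  move=> m n /addrI; rewrite -[w *+ m]mulr_natr -[w *+ n]mulr_natr => /(mulfI w0).
  exact: natr_inj.
by rewrite -gX rP //; exact: (subgroupX (fixes_subgroup iota L) n gL).
Qed.

(** The primitive element argument: z = x + n y works once the integer n avoids the finitely many
    ratios of differences of conjugates of x and of y. *)
Lemma separate2 L x y : x \in acl L -> y \in acl L -> exists2 z, z \in acl L &
  forall g h, fixes L g -> fixes L h -> g z = h z -> g x = h x /\ g y = h y.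
Proof.
move=> xL yL; have [r rP] := orbit_bounded iota xL; have [s sP] := orbit_bounded iota yL.
have [n nP] := @finite_seq_inj (fun n => n%:R)
  [seq (a.1 - a.2) / (b.2 - b.1) | a <- [seq (c, d) | c <- r, d <- r],
     b <- [seq (c, d) | c <- s, d <- s]] (natr_inj char0).
exists (x + n%:R * y).
  by rewrite rpredD // rpredM // rpred_nat.
move=> g h gL hL; rewrite !rmorphD !rmorphM !rmorph_nat => e.
have [gy|gy] := eqVneq (g y) (h y).
  by split=> //; move: e; rewrite gy => /addIr.
case/negP: nP; apply/allpairsP; exists ((h x, g x), (h y, g y)) => /=; split.
- by apply/allpairsP; exists (h x, g x); rewrite !rP.
- by apply/allpairsP; exists (h y, g y); rewrite !sP.
- apply: (mulIf (x := g y - h y)); first by rewrite subr_eq0.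
  rewrite divfK ?subr_eq0 // mulrBr.
  by apply/eqP; rewrite subr_eq addrAC eq_sym subr_eq -e addrC.
Qed.

Lemma separate L (s : seq F) : {in s, forall x, x \in acl L} ->
  exists2 y, y \in acl L & forall g h, fixes L g -> fixes L h -> g y = h y ->
    {in s, g =1 h}.
Proof.
elim: s => [_|x s IH sL]; first by exists 0; rewrite ?rpred0.
have [y yL yP] : exists2 y, y \in acl L & forall g h, fixes L g -> fixes L h ->
    g y = h y -> {in s, g =1 h}.
  by apply: IH => z zs; apply: sL; rewrite inE zs orbT.
have [z zL zP] := separate2 (sL x (mem_head _ _)) yL; exists z => // g h gL hL gz.
have [ghx ghy] := zP g h gL hL gz.
by move=> w; rewrite inE => /orP[/eqP->//|]; exact: yP.
Qed.

End Separation.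

(** * Kummer theory *)

Section RootsOfUnity.
Context {k F : closedFieldType} (iota : {rmorphism k -> F}).

Lemma base_closed_pred : divring_closed [in range iota].
Proof.
split=> [|_ _ /set_mem[a _ <-] /set_mem[b _ <-]|_ _ /set_mem[a _ <-] /set_mem[b _ <-]];
  apply/mem_set; [exists 1|exists (a - b)|exists (a / b)] => //.
- exact: rmorph1.
- exact: rmorphB.
- exact: fmorph_div.
Qed.

Definition base : divringClosed F := set_subfield base_closed_pred.
Lemma baseP x : x \in base <-> exists c, iota c = x.
Proof. by rewrite set_subfieldE; split=> [[c _ <-]|[c <-]]; exists c. Qed.
Lemma base_iota c : iota c \in base. Proof. by apply/baseP; exists c. Qed.

Lemma acl_base x : x \in acl base -> x \in base.
Proof.
move=> /aclP[p p0 [pk px]].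
have [q qE] : exists q, map_poly iota q = p.
  have ex i : exists c, iota c = p`_i by apply/baseP/(polyOverP pk).
  have [c cE] := choice ex; exists (\poly_(i < size p) c i).
  apply/polyP => i; rewrite coef_map coef_poly; case: ltnP => [_|/(nth_default 0)->].
    exact: cE.
  by rewrite /= rmorph0.
have [r rE] := closed_field_poly_normal q.
move: px; rewrite -qE rE map_polyZ rootZ; last first.
  by rewrite fmorph_eq0 lead_coef_eq0 -(map_poly_eq0 iota) qE.
rewrite rmorph_prod /=; under eq_bigr do rewrite map_polyXsubC.
rewrite -(big_map iota xpredT (fun y => 'X - y%:P)) root_prod_XsubC.
by move=> /mapP[c _ ->]; exact: base_iota.
Qed.

Lemma root_of_unity_base n (x : F) : (0 < n)%N -> x ^+ n = 1 -> x \in base.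
Proof.
move=> n0 xn; apply/acl_base/aclP; exists ('X^n - 1).
  by rewrite -size_poly_eq0 size_XnsubC.
by rewrite rpredB ?polyOverXn ?rpred1 // /root hornerD hornerN hornerXn horner1 xn subrr.
Qed.

Lemma prime_prim_root p (z : F) : prime p -> z ^+ p = 1 -> z != 1 ->
  p.-primitive_root z.
Proof.
move=> pp zp z1; have [m mz mp] := prim_order_exists (prime_gt0 pp) zp.
move/primeP: pp => [_ /(_ _ mp)/orP[/eqP m1|/eqP <-//]].
by move: (prim_expr_order mz); rewrite m1 expr1 => /eqP; rewrite (negbTE z1).
Qed.

Lemma nth_root n (x : F) : (0 < n)%N -> exists y, y ^+ n = x.
Proof.
move=> n0; have /closed_rootP[y] : size ('X^n - x%:P) != 1%N.
  by rewrite size_XnsubC // eqSS -lt0n.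
by rewrite /root hornerD hornerN hornerXn hornerC subr_eq0 => /eqP; exists y.
Qed.

Lemma mup_exp (x : F) (q : {poly F}) n : q != 0 -> mup x (q ^+ n) = (n * mup x q)%N.
Proof.
move=> q0; elim: n => [|n IH]; first by rewrite mupNroot // /root horner1 oner_eq0.
by rewrite exprS mupM ?expf_neq0 // IH mulSn.
Qed.

Lemma horner_eval_X (G : {poly {poly F}}) x :
  G.['X].[x] = (map_poly (horner_eval x) G).[x].
Proof. by have := horner_map (horner_eval x) G 'X; rewrite /= !horner_evalE hornerX. Qed.

End RootsOfUnity.

Section Kummer.
Context {k F : closedFieldType} (iota : {rmorphism k -> F}).
Hypothesis char0 : [pchar F] =i pred0.
Implicit Types (g h u : aut iota) (H K : set (aut iota)) (L M : divringClosed F).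

(* [t] and [t'] are p-th roots of [c - z] and [c - z'] for a large prime p and a
   generic constant c; if [t] lay in [L(y, t')] then Kummer theory would give
   [t = a t'^j], and the valuation of the norm of [a] at [z = c] would be d/p. *)
Lemma kummer_independent (R : divringClosed F) (z y z' : F) : (forall c, iota c \in R) ->
  z \notin acl R -> (forall x, x \in acl (adj R z)) ->
  (forall g, fixes (adj R z) g -> g y = y -> g z' = z') -> 
  (forall g, fixes (adj R z) g -> g z' != z) -> (forall c, iota c != z') ->
  exists p c, prime p /\ forall t t', t ^+ p = iota c - z -> t' ^+ p = iota c - z' ->
    exists g, [/\ fixes (adj R z) g, g y = y, g t' = t' & g t != t].
Proof.
move=> kR zR Lalg yz' z'z kz'; set L := adj R z in Lalg yz' z'z *.
have kL c : iota c \in L by apply/sub_adj.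
pose U := [set g : aut iota | fixes L g].
have Usub : is_subgroup U := fixes_subgroup iota L.
have [O OP] := bounded_orbit iota (Lalg y).
have equiv phi a : (forall g, U g -> phi (g y) = g a) ->
    forall g, U g -> {in O, forall w, g (phi w) = phi (g w)}.
  move=> phiP g Ug w /OP.2[h Uh <-].
  by rewrite phiP // -!autM phiP //; exact: (subgroupM Usub).
have [psi psiP] := orbit_transfer Usub yz'.
(* The value of [e] at c is the norm of c - z', counted over the orbit of y. As no conjugate of z'
   is z, [e] does not vanish at z. *)
pose e := \prod_(w <- O) ('X - (psi w)%:P).
have eL : e \is a polyOver L.
  apply/polyOverP => i; apply: (fixed_mem char0 kL (Lalg _)) => g gL.
  by rewrite -coef_map (orbit_poly_fixed Usub OP gL) //; exact: (equiv _ _ psiP).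
have ez : e.[z] != 0.
  rewrite horner_prod prodf_seq_neq0; apply/allP => w /OP.2[h Uh <-] /=.
  by rewrite !hornerE psiP // subr_eq0 eq_sym z'z.
have [B [BR Bz] [G GR GE]] := clear_denominators eL.
have Gz : G.['X].[z] != 0 by rewrite horner_eval_X GE hornerZ mulf_neq0.
(* The constant c is an integer avoiding the roots of B(X) G(X, X): at z = c the coefficients of [e]
   then have no pole, and the norm of c - z' does not vanish. *)
have [n] := @finite_seq_inj F (fun n => n%:R)
  (let r := closed_field_poly_normal (B * G.['X]) in projT1 r) (natr_inj char0).
case: closed_field_poly_normal => r rE /= nr.
have c0 : (B * G.['X]).[n%:R] != 0.
  rewrite -rootE rE rootZ ?root_prod_XsubC // lead_coef_eq0.
  by apply: contraNneq (mulf_neq0 Bz Gz) => BG; rewrite -hornerM BG horner0.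
have [p dp pp] := prime_above (size O).
exists p, n%:R; split=> // t t'; rewrite rmorph_nat; set c : F := n%:R in nr c0 *.
move=> tp t'p; apply: contrapT => /forallNP ng.
have cE : c = iota n%:R by rewrite rmorph_nat.
have cz : c - z != 0.
  by rewrite subr_eq0; apply: contraNneq zR => <-; rewrite cE; exact/sub_acl.
have cz' : c - z' != 0 by rewrite subr_eq0 cE.
have p0 := prime_gt0 pp.
have t0 : t != 0.
  by apply: contraNneq cz => t0; rewrite -tp t0 expr0n gtn_eqF.
have t'0 : t' != 0.
  by apply: contraNneq cz' => t0'; rewrite -t'p t0' expr0n gtn_eqF.
have zL : z \in L by exact: adj_id.
have gc g : g c = c by rewrite cE aut_fix.
have ugb g x : x ^+ p = 1 -> g x = x.
  by move=> /(root_of_unity_base iota p0)/baseP[a <-]; exact: aut_fix.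
have gtp g : fixes L g -> (g t / t) ^+ p = 1.
  by move=> gL; rewrite expr_div_n -rmorphXn /= tp rmorphB gc gL // divff.
have gt'p g : fixes L g -> g y = y -> (g t' / t') ^+ p = 1.
  by move=> gL gy; rewrite expr_div_n -rmorphXn /= t'p rmorphB gc yz' // divff.
have {ng} tt' g : fixes L g -> g y = y -> g t' = t' -> g t = t.
  by move=> gL gy gt'; apply: contrapT => /eqP gt; apply: (ng g).
(* If some g0 fixing y moves t, it moves t' too, say t' to zeta t' and t to zeta^j t. Any g fixing y
   agrees at t' with a power of g0, hence also at t, so t / t'^j is fixed. *)
have [j aD] : exists j, forall g, U g -> g y = y -> g (t / t' ^+ j) = t / t' ^+ j.
  have [allfix|] := pselect (forall g, U g -> g y = y -> g t = t).
    by exists 0%N => g Ug gy; rewrite expr0 divr1; exact: allfix.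
  move=> /existsNP[g0] /not_implyP[Ug0] /not_implyP[g0y] /eqP g0t.
  pose zeta := g0 t' / t'.
  have zeta1 : zeta != 1.
    by apply: contraNneq g0t => /divr1_eq g0t'; apply/eqP/tt'.
  have zp : p.-primitive_root zeta by apply: prime_prim_root => //; exact: gt'p.
  have [j jE] := prim_rootP zp (gtp _ Ug0).
  exists j => g Ug gy.
  have [b bE] := prim_rootP zp (gt'p _ Ug gy).
  have zetap : zeta ^+ p = 1 := prim_expr_order zp.
  have g0X m x w : g0 x = w * x -> (g0 w = w) -> (g0 ^+ m)%g x = w ^+ m * x.
    move=> g0x g0w; elim: m => [|m IH]; first by rewrite expr0 mul1r.
    by rewrite expgS autM IH rmorphM rmorphXn g0w g0x mulrA exprSr.
  have zj : (zeta ^+ j) ^+ p = 1 by rewrite exprAC zetap expr1n.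
  have g0t' : (g0 ^+ b)%g t' = g t'.
    by rewrite (g0X b t' zeta); [rewrite -bE divfK|rewrite divfK|exact: ugb].
  have /tt' : fixes L ((g0 ^+ b)^-1 * g)%g.
    by apply: (subgroupM Usub) => //; apply: (subgroupV Usub); exact: (subgroupX Usub).
  have g0by : (g0 ^+ b)%g y = y.
    by elim: (b : nat) => // m IH; rewrite expgS autM IH.
  rewrite !autM gy autV_fix // -g0t' autK => /(_ erefl erefl) /(congr1 (g0 ^+ b)%g).
  rewrite autVK (g0X b t (zeta ^+ j)); [|by rewrite -jE divfK|exact: ugb].
  move=> gt; rewrite fmorph_div rmorphXn /= gt -g0t'.
  rewrite (g0X b t' zeta); [|by rewrite divfK|exact: ugb].
  rewrite [_ ^+ j ^+ b]exprAC [(_ * t') ^+ j]exprMn invfM mulrACA mulfV ?mul1r //.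
  by rewrite !expf_neq0 // mulf_neq0 ?invr_eq0 // fmorph_eq0.
set a := t / t' ^+ j in aD.
have [phi phiP] := orbit_transfer Usub aD.
pose N := \prod_(w <- O) phi w.
have NL : N \in L.
  apply: (fixed_mem char0 kL (Lalg _)) => g gL.
  by apply: (orbit_prod_fixed Usub OP gL); exact: (equiv _ _ phiP).
(* The norm of the identity a^p (c - z')^j = c - z, where the right-hand side lies in the base field
   R(z). *)
have NE : N ^+ p * e.[c] ^+ j = (c - z) ^+ size O.
  rewrite -prodrXl horner_prod -prodrXl -big_split /= big_seq.
  rewrite (eq_bigr (fun=> c - z)) -?big_seq ?big_const_seq ?count_predT ?iter_mulr_1 //.
  move=> w /OP.2[h Uh <-]; rewrite phiP // !hornerE psiP //.
  rewrite -rmorphXn /= expr_div_n tp exprAC t'p.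
  rewrite -{3}[c](gc h) -rmorphB -rmorphXn -rmorphM /= divfK ?expf_neq0 //.
  by rewrite rmorphB gc Uh.
have /adjP[P [PR [Q [QR Qz NPQ]]]] := NL.
have GcR : G.[c%:P] \is a polyOver R.
  rewrite rpred_horner // ?polyOverC ?cE //; apply/polyOverP => i; exact: over2_coef.
have Gcz : G.[c%:P].[z] = B.[z] * e.[c] by rewrite -horner2E GE hornerZ.
have cXR : c%:P - 'X \is a polyOver R by rewrite rpredB ?polyOverX ?polyOverC ?cE.
have polyE : P ^+ p * G.[c%:P] ^+ j = (c%:P - 'X) ^+ size O * Q ^+ p * B ^+ j.
  apply: (transc_inj zR); rewrite ?rpredM ?rpredX //.
  rewrite !hornerE Gcz -NE NPQ [_ * e.[c] ^+ j * _]mulrAC -exprMn divfK //.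
  by rewrite exprMn -!mulrA [B.[z] ^+ j * _]mulrC.
have B0 : B != 0 by apply: contraNneq Bz => ->; rewrite horner0.
have Q0 : Q != 0 by apply: contraNneq Qz => ->; rewrite horner0.
have cX0 : c%:P - 'X != 0 by rewrite -opprB oppr_eq0 polyXsubC_eq0.
have P0 : P != 0.
  have : (c%:P - 'X) ^+ size O * Q ^+ p * B ^+ j != 0.
    by rewrite !mulf_neq0 ?expf_neq0.
  by apply: contraNneq => P0; rewrite -polyE P0 expr0n gtn_eqF // mul0r.
move: c0; rewrite hornerM mulf_eq0 negb_or => /andP[Bc Gc].
have Gcc : ~~ root (G.[c%:P] ^+ j) c.
  by rewrite /root horner_exp expf_neq0 // -horner2E -horner_eval_X.
have Bcj : ~~ root (B ^+ j) c by rewrite /root horner_exp expf_neq0.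
have mupcX : mup c (c%:P - 'X) = 1%N.
  rewrite -opprB -scaleN1r -mul_polyC mupMr ?rootC ?oppr_eq0 ?oner_eq0 //.
  by rewrite -['X - _]expr1 mup_XsubCX eqxx.
(* Multiplicities at c give p mup(P) = d + p mup(Q) with d the size of the orbit; since d < p this
   forces d = 0, yet y is in its orbit. *)
have := congr1 (mup c) polyE.
rewrite (mupMl _ Gcc) (mupMl _ Bcj) mupM ?expf_neq0 // !mup_exp // mupcX muln1.
move=> /(congr1 (modn^~ p)); rewrite modnMr addnC [(p * _)%N]mulnC modnMDl modn_small // => O0.
have := orbit_refl Usub OP; move/esym/eqP: O0; rewrite size_eq0 => /eqP->.
by [].
Qed.
End Kummer.

(** * Commutators inside the normalized subgroup *)

Section Commutators.
Context {k F : closedFieldType} (iota : {rmorphism k -> F}).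
Hypothesis char0 : [pchar F] =i pred0.
Implicit Types (g h u : aut iota) (L M : divringClosed F).

Definition kummer_move h (z t zeta : F) :=
  exists p c, [/\ prime p, t ^+ p = iota c - z, p.-primitive_root zeta & h t = zeta * t].

Lemma kummer_zeta h z t zeta : kummer_move h z t zeta ->
  zeta \in base iota /\ zeta != 1.
Proof.
move=> [p [c [pp _ zp _]]]; split.
  exact: root_of_unity_base (prime_gt0 pp) (prim_expr_order zp).
apply: contraTneq isT => z1; move: (prime_gt1 pp); move: zp; rewrite z1.
move=> /prim_order_dvd/(_ 1%N); rewrite expr1 eqxx dvdn1 => /eqP->.
by rewrite ltnn.
Qed.

Lemma kummer_transc h z t zeta L : (forall c, iota c \in L) ->
  kummer_move h z t zeta -> z \notin acl L -> t \notin acl L.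
Proof.
move=> kL [p [c [_ tp _ _]]]; apply: contra => tL.
by rewrite -[z](subKr (iota c)) -tp rpredB ?rpredX // sub_acl.
Qed.

(** Since u fixes t^p = c - z, it multiplies t by a power of zeta. So an automorphism fixing z can
    be corrected at t by a power of h. *)
Lemma kummer_power h z t zeta u : kummer_move h z t zeta -> t != 0 -> u z = z ->
  exists n, (h ^+ n)%g t = u t.
Proof.
move=> hm t0 uz; have [zb _] := kummer_zeta hm.
have [p [c [pp tp zp ht]]] := hm.
have [n nE] : {n : 'I_p | u t / t = zeta ^+ n}.
  apply/(prim_rootP zp); rewrite expr_div_n -rmorphXn /= tp rmorphB aut_fix uz.
  by rewrite divff // -tp expf_neq0.
exists n; apply: (mulIf (x := t^-1)); first by rewrite invr_eq0.
rewrite nE; apply: (canLR (mulfK t0)).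
elim: (n : nat) => [|m IH]; first by rewrite expr0 mul1r.
have /baseP[a az] := zb.
by rewrite expgS autM IH rmorphM rmorphXn ht /= -az aut_fix exprS mulrCA mulrA.
Qed.

Section Normal.
Context (H : set (aut iota)) (Hsub : is_subgroup H).
Hypothesis Hnorm : forall g h, aut_circ iota g -> H h -> H (g * h * g^-1)%g.

(* If [u] fixes [sigma x] and [x], then [u sigma^-1 u^-1 sigma] fixes [x];
   if [u] only fixes [sigma x], it agrees with [u] at [x]. *)
Lemma kummer_commutator (sigma : aut iota) (W : divringClosed F) z (s : seq F) :
  (forall c, iota c \in W) -> z \notin acl W -> H sigma -> sigma z != z ->
  {in W, forall w, sigma w \in W} ->
  exists h t zeta, [/\ H h, fixes W h, {in s, forall x, h x = x} & kummer_move h z t zeta].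
Proof.
move=> kW zW Hs sz sW.
have [R [WR zR Ralg]] := maximal_transcendental zW.
have kR c : iota c \in R by exact: WR.
(* The commutator acts as u at x only if u fixes [sigma x], hence the images under sigma; fixing the
   separating y will fix the whole list. *)
pose s' := [:: z, sigma z & s ++ map sigma s].
have [|y yL yP] := @separate _ _ iota char0 (adj R z) s'; first by move=> x _.
have fix_s' g : fixes (adj R z) g -> g y = y -> {in s', forall x, g x = x}.
  move=> gL gy x xs; apply: (yP g 1%g gL) => //.
have [|g gL|c|p [c [pp tP]]] :=
    @kummer_independent _ _ iota char0 R z y (sigma z) kR zR Ralg.
- by move=> g gL gy; apply: (fix_s' g) => //; rewrite !inE eqxx orbT.
- apply: contraNneq sz => gsz; apply/eqP; apply: (aut_inj (g := g)).
  by rewrite gsz gL // adj_id.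
- apply: contraNneq zR => csz; apply/sub_acl.
  by rewrite -(autK sigma z) -csz (autV_fix (aut_fix sigma c)).
have [t tp] := nth_root (iota c - z) (prime_gt0 pp).
(* The second root is [sigma t], a p-th root of c - sigma z: fixing it makes the commutator act on t
   as u does. *)
have [|u [uL uy ut ut0]] := tP t (sigma t) tp.
  by rewrite -rmorphXn /= tp rmorphB aut_fix.
have us' := fix_s' _ uL uy.
have uc := fixes_circ Ralg uL.
have hE x : u (sigma x) = sigma x -> (u * sigma^-1 * u^-1 * sigma)%g x = u x.
  by move=> usx; rewrite !autM (autV_fix usx) autK.
have t0 : t != 0.
  by apply: contraNneq ut0 => ->; rewrite rmorph0.
exists (u * sigma^-1 * u^-1 * sigma)%g, t, (u t / t); split.
- by apply: (subgroupM Hsub) => //; apply: Hnorm => //; exact: subgroupV.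
- move=> w wW; rewrite hE; first by rewrite uL // sub_adj // WR.
  by rewrite uL // sub_adj // WR // sW.
- move=> x xs; rewrite hE us' //; rewrite !inE mem_cat ?xs ?orbT //.
  by rewrite map_f ?orbT.
- exists p, c; split=> //; last by rewrite hE ?divfK.
  apply: prime_prim_root => //.
    rewrite expr_div_n -rmorphXn /= tp rmorphB aut_fix us' ?mem_head // divff //.
    by rewrite -tp expf_neq0.
  by apply: contraNneq ut0 => /divr1_eq/eqP.
Qed.

(** The commutator of the homothety t to zeta t with the translation by beta is the translation by
    (zeta - 1) beta; hence beta = b / (zeta - 1). *)
Lemma kummer_translation L h z t zeta b : (forall c, iota c \in L) -> H h ->
  fixes L h -> kummer_move h z t zeta -> t \notin acl L -> b \in L ->
  exists T, [/\ H T, fixes L T & T t = t + b].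
Proof.
move=> kL Hh hL hm tL bL; have [/baseP[a az] z1] := kummer_zeta hm.
have [p [c [pp _ zp ht]]] := hm.
have z1' : zeta - 1 != 0 by rewrite subr_eq0.
have beL : b / (zeta - 1) \in L by rewrite rpred_div // rpredB ?rpred1 // -az.
have [g [gc gL gt]] := translation kL tL beL.
exists (h^-1 * (g * h * g^-1))%g; split.
- by apply: (subgroupM Hsub); [exact: subgroupV|exact: Hnorm].
- by move=> x xL; rewrite !autM (autV_fix (gL x xL)) hL // gL // autV_fix // hL.
- rewrite !autM.
  have -> : (g^-1)%g t = t - b / (zeta - 1).
    by apply: autV_eq; rewrite rmorphB gt (gL _ beL) addrK.
  have zfix (u : aut iota) : u zeta = zeta by rewrite -az aut_fix.
  rewrite rmorphB (hL _ beL) ht rmorphB rmorphM zfix gt (gL _ beL).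
  have hVL x : x \in L -> (h^-1)%g x = x by move=> xL; rewrite autV_fix // hL.
  rewrite rmorphB (hVL _ beL) rmorphM zfix rmorphD (hVL _ beL).
  have z0 : zeta != 0.
    apply: contraTneq (oner_neq0 F) => z0; rewrite -(prim_expr_order zp) z0.
    by rewrite expr0n gtn_eqF ?prime_gt0 // eqxx.
  have -> : (h^-1)%g t = zeta^-1 * t.
    by apply: autV_eq; rewrite rmorphM ht fmorphV zfix mulKf.
  rewrite mulrDr mulVKf; last exact: z0.
  rewrite -addrA; congr (_ + _).
  by rewrite -[X in _ - X]mul1r -mulrBl mulrC divfK.
Qed.
End Normal.
End Commutators.

(** * Fields invariant under a shift *)

Section Shift.
Context {k F : closedFieldType} (iota : {rmorphism k -> F}).
Hypothesis char0 : [pchar F] =i pred0.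
Implicit Types (g h u : aut iota) (L M : divringClosed F).

Lemma autX_add g x e n : g x = x + e -> g e = e -> (g ^+ n)%g x = x + e *+ n.
Proof.
move=> gx ge; elim: n => [|n IH]; first by rewrite mulr0n addr0.
by rewrite expgS autM IH rmorphD rmorphMn gx ge mulrS addrA.
Qed.

Lemma infinite_roots (q : {poly F}) (f : nat -> F) : injective f ->
  (forall n, q.[f n] = 0) -> q = 0.
Proof.
move=> fI qf; apply/eqP/negPn/negP => q0.
have [r qE] := closed_field_poly_normal q.
have [n /negP] := finite_seq_inj r fI; apply.
by rewrite -root_prod_XsubC -(@rootZ _ _ (lead_coef q)) ?lead_coef_eq0 // -qE; apply/rootP.
Qed.

(** Powers of g carry a relation G(x, w) = 0 to G(x + n e, w) = 0. With infinitely many roots, G(.,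
    w) vanishes identically, which is a relation for w over L alone. *)
Lemma shift_fixed L g x e w : fixes L g -> e \in L -> e != 0 -> g x = x + e ->
  w \in acl (adj L x) -> g w = w -> w \in acl L.
Proof.
move=> gL eL e0 gx /alg_adj[G GL [G0 Gw]] gw.
apply: (over2_horner0 GL); first by apply: contraNneq G0 => ->; rewrite rmorph0.
have fixG : fixes (adj L w) g by exact: fixes_adj.
apply: (@infinite_roots _ (fun n => x + e *+ n)) => [m n /addrI|n].
  by rewrite -[e *+ m]mulr_natr -[e *+ n]mulr_natr => /(mulfI e0)/(natr_inj char0).
rewrite -(autX_add _ gx (gL _ eL)).
have fixGn : fixes (adj L w) (g ^+ n)%g.
  exact: (subgroupX (fixes_subgroup iota (adj L w))).
rewrite -(fixes_horner x fixGn) ?rpred0 ?over2_hornerC //.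
by rewrite Gw rmorph0.
Qed.
End Shift.

(** * Integral elements with bounded pole at infinity *)

Section Bounded.
Context {F : closedFieldType} (C : divringClosed F).
Local Notation K := (subf C).

(* Kept opaque so that simplification does not unfold the composition. *)
Fact ev_subproof (a : F) :
  {f : {rmorphism {poly K} -> F} | forall p, f p = (map_poly (subf_val C) p).[a]}.
Proof. by exists (horner_eval a \o map_poly (subf_val C)). Qed.
Definition ev a : {rmorphism {poly K} -> F} := sval (ev_subproof a).

Lemma evE a p : ev a p = (map_poly (subf_val C) p).[a].
Proof. exact: (svalP (ev_subproof a)). Qed.
Lemma ev_adj a p : ev a p \in adj C a.
Proof. by rewrite evE; apply: adj_horner; exact: map_subf_over. Qed.

Lemma ev_inj a : a \notin acl C -> injective (ev a).
Proof.
move=> aC p q; rewrite !evE => e; apply: (map_poly_inj (subf_val C)).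
by apply: (transc_inj aC) => //; exact: map_subf_over.
Qed.

Lemma ev1 a : ev a 1 = 1. Proof. exact: rmorph1. Qed.
Lemma evX a n : ev a 'X^n = a ^+ n.
Proof. by rewrite evE map_polyXn hornerXn. Qed.
Lemma evC a c : ev a c%:P = subf_val C c.
Proof. by rewrite evE map_polyC hornerC. Qed.

(** The reversed polynomial: it moves from the ring C[a] to C[1/a], that is, to the place at
    infinity. *)
Lemma ev_rev a (p : {poly K}) n : a != 0 -> (size p <= n.+1)%N ->
  exists2 q : {poly K}, (size q <= n.+1)%N & ev a^-1 q = ev a p / a ^+ n.
Proof.
move=> a0 pn; exists (\sum_(j < n.+1) p`_j *: 'X^(n - j)).
  rewrite (leq_trans (size_sum _ _ _)) //; apply/bigmax_leqP => j _.
  by rewrite (leq_trans (size_scale_leq _ _)) // size_polyXn ltnS leq_subr.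
rewrite rmorph_sum [in RHS]evE (@horner_coef_wide _ n.+1); last first.
  by rewrite size_map_poly.
rewrite mulr_suml; apply: eq_bigr => j _; rewrite -mul_polyC rmorphM evC evX coef_map.
rewrite -mulrA; congr (_ * _); rewrite exprVn.
have -> : a ^+ n = a ^+ j * a ^+ (n - j) by rewrite -exprD subnKC // -ltnS.
by rewrite invfM mulrA divff ?mul1r // expf_neq0.
Qed.

Lemma monic_root_sum a (r : {poly {poly K}}) u : r \is monic ->
  root (map_poly (ev a) r) u ->
  \sum_(i < (size r).-1) ev a r`_i * u ^+ i + u ^+ (size r).-1 = 0.
Proof.
move=> rm /rootP; rewrite (@horner_coef_wide _ (size r).-1.+1); last first.
  by rewrite (leq_trans (size_poly _ _)) // leqSpred.
rewrite big_ord_recr coef_map -lead_coefE (monicP rm) /= ev1 mul1r => e.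
rewrite -[RHS]e; congr (_ + _); apply: eq_bigr => i _.
by rewrite coef_map.
Qed.

Lemma adj_ev a x : x \in adj C a -> exists p q, ev a q != 0 /\ x = ev a p / ev a q.
Proof.
move=> /adjP[p [/subf_polyE[p' <-] [q [/subf_polyE[q' <-] q0 ->]]]].
by exists p', q'; rewrite !evE.
Qed.

Lemma adj_inv a x : x \in adj C a -> x \in adj C a^-1.
Proof.
apply: adj_min; first exact: sub_adj.
by rewrite -rpredV adj_id.
Qed.

(** The rational root argument: with s = p/q in lowest terms, a monic equation for s makes q divide
    a power of p, so q is constant. *)
Lemma integrally_closed a s : a \notin acl C -> s \in adj C a ->
  integralOver (ev a) s -> exists q, s = ev a q.
Proof.
move=> aC /adj_ev[p0 [q0 [q00 sE0]]] [r rm rs].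
have q0n0 : q0 != 0 by apply: contraNneq q00 => ->; rewrite rmorph0.
have [p [q [qn0 cop sE]]] : exists p q, [/\ ev a q != 0, coprimep p q & s = ev a p / ev a q].
  exists (p0 %/ gcdp p0 q0), (q0 %/ gcdp p0 q0).
  have g0 : ev a (gcdp p0 q0) != 0.
    apply: contraNneq q00 => g0; rewrite -(divpK (dvdp_gcdr p0 q0)).
    by rewrite (rmorphM (ev a)) g0 mulr0.
  have qE : ev a q0 = ev a (q0 %/ gcdp p0 q0) * ev a (gcdp p0 q0).
    by rewrite -(rmorphM (ev a)) divpK ?dvdp_gcdr.
  have pE : ev a p0 = ev a (p0 %/ gcdp p0 q0) * ev a (gcdp p0 q0).
    by rewrite -(rmorphM (ev a)) divpK ?dvdp_gcdl.
  split; last by rewrite sE0 pE qE invfM mulrACA divff // mulr1.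
    by apply: contraNneq q00 => e; rewrite qE e mul0r.
  by rewrite coprimep_div_gcd // q0n0 orbT.
have := monic_root_sum rm rs; set d := (size r).-1.
move=> /eqP; rewrite addrC addr_eq0 => /eqP e.
have key : p ^+ d = - \sum_(i < d) r`_i * p ^+ i * q ^+ (d - i).
  apply: (ev_inj aC); rewrite rmorphXn rmorphN rmorph_sum.
  have -> : ev a p = s * ev a q by rewrite sE divfK.
  rewrite exprMn e mulNr mulr_suml; congr (- _); apply: eq_bigr => i _.
  rewrite !rmorphM !rmorphXn.
  have -> : ev a p = s * ev a q by rewrite sE divfK.
  rewrite exprMn -!mulrA; congr (_ * (_ * _)).
  by rewrite -exprD subnKC // ltnW.
have qpd : q %| p ^+ d.
  apply/dvdpP; exists (- \sum_(i < d) r`_i * p ^+ i * q ^+ (d - i.+1)).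
  rewrite key mulNr mulr_suml; congr (- _); apply: eq_bigr => i _.
  by rewrite -[RHS]mulrA -exprSr subnSK.
have : coprimep q (p ^+ d) by rewrite coprimep_sym coprimep_expl.
move=> /coprimepP/(_ q (dvdpp q) qpd); rewrite -size_poly_eq1 => /size_poly1P[c c0 qE].
exists (c^-1 *: p); rewrite sE qE evC -mul_polyC rmorphM evC mulrC.
by rewrite fmorphV.
Qed.

(** Integrality over C[a] with a uniform bound N on the degrees of the coefficients, which bounds
    the pole of u at infinity. Unlike a bound on u itself, it visibly survives conjugation and the
    shift of a. *)
Definition bounded (a : F) (N : nat) (u : F) := exists r : {poly {poly K}},
  [/\ r \is monic, forall i : nat, (size (r`_i)%R <= N.+1)%N & root (map_poly (ev a) r) u].

Lemma bounded_integral a N u : bounded a N u -> integralOver (ev a) u.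
Proof. by move=> [r [rm _ ru]]; exists r. Qed.

Lemma bounded_integral_inv a N u : a != 0 -> bounded a N u ->
  integralOver (ev a^-1) (u / a ^+ N).
Proof.
move=> a0 [r [rm rN ru]].
have := monic_root_sum rm ru; set d := (size r).-1 => e.
(* These are the coefficients of the monic equation of u / a^N. For i < d the degree of r_i is at
   most N, hence at most N (d - i), so [c i] is a polynomial in 1/a. *)
pose c i := ev a r`_i / a ^+ (N * (d - i)).
pose p := 'X^d + \poly_(i < d) c i.
have sp : (size (\poly_(i < d) c i) < size ('X^d : {poly F}))%N.
  by rewrite size_polyXn ltnS size_poly.
apply: (@integral_root_monic _ _ _ _ p).
- by rewrite monicE lead_coefDl // lead_coefXn.
- apply/rootP; rewrite hornerD hornerXn horner_poly.
  apply: (mulIf (x := (a ^+ N) ^+ d)); first by rewrite !expf_neq0.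
  rewrite mul0r -[RHS]e addrC mulrDl mulr_suml; congr (_ + _); last first.
    by rewrite -exprMn divfK ?expf_neq0.
  apply: eq_bigr => i _; rewrite /c expr_div_n -!mulrA; congr (_ * _).
  have -> : (a ^+ N) ^+ d = a ^+ (N * (d - i)) * (a ^+ N) ^+ i.
    by rewrite -!exprM -exprD -mulnDr subnK // ltnW.
  rewrite [a ^+ (N * (d - i)) * _]mulrC mulKf ?expf_neq0 //.
  by rewrite mulrCA mulVf ?mulr1 ?expf_neq0.
- apply/integral_poly => i; rewrite coefD coefXn coef_poly.
  case: (ltnP i d) => id.
    rewrite ltn_eqF // add0r.
    have [|q _ qE] := @ev_rev a r`_i (N * (d - i)) a0.
      rewrite (leq_trans (rN i)) // ltnS leq_pmulr // subn_gt0 //.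
    by rewrite /c -qE; exact: integral_id.
  by rewrite addr0; exact: integral_nat.
Qed.

(** C[1/a] is integrally closed as well, so q(a) / a^M is a polynomial in 1/a, and the degree of q
    is at most M. *)
Lemma ev_size_bound a M s q : a \notin acl C -> s = ev a q ->
  integralOver (ev a^-1) (s / a ^+ M) -> (size q <= M.+1)%N.
Proof.
move=> aC sE sint.
have a0 : a != 0 by apply: contraNneq aC => ->; exact: rpred0.
have aVC : a^-1 \notin acl C by rewrite rpredV.
have [|q2 q2E] := integrally_closed aVC _ sint.
  by rewrite adj_inv // rpred_div ?rpredX ?adj_id // sE ev_adj.
have [q3 q3s] := ev_rev (n := size q2) (invr_neq0 a0) (leqnSn _).
rewrite invrK => q3E.
have [->|q0] := eqVneq q 0; first by rewrite size_poly0.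
have : 'X^(size q2) * q = 'X^M * q3.
  apply: (ev_inj aC); rewrite !rmorphM !evX q3E -q2E -sE exprVn invrK.
  by rewrite mulrA [a ^+ M * _]mulrCA divff ?expf_neq0 // mulr1 mulrC.
move=> /(congr1 (fun p : {poly K} => size p)).
have [->|q30] := eqVneq q3 0.
  rewrite mulr0 size_poly0 => /eqP.
  by rewrite size_poly_eq0 mulf_eq0 (negbTE q0) -size_poly_eq0 size_polyXn.
rewrite !size_monicM ?monicXn // !size_polyXn /= => e.
have : (size q2 + size q <= M + (size q2).+1)%N by rewrite e leq_add2l.
by rewrite addnS -addSn addnC leq_add2r.
Qed.

End Bounded.

(** Invertibility of the Vandermonde matrix, obtained by testing against the polynomial that
    vanishes on all of O but one point. *)
Lemma power_sums_eq0 (F : fieldType) (O : seq F) (w : F -> F) : uniq O ->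
  (forall j, (j < size O)%N -> \sum_(y <- O) w y * y ^+ j = 0) ->
  {in O, forall y, w y = 0}.
Proof.
move=> Ou wO y yO.
have wp (p : {poly F}) : (size p <= size O)%N -> \sum_(z <- O) w z * p.[z] = 0.
  move=> sp; under eq_bigr => z _ do rewrite (horner_coef_wide _ sp) mulr_sumr.
  rewrite exchange_big big1 // => j _ /=.
  under eq_bigr => z _ do rewrite mulrCA.
  by rewrite -mulr_sumr wO ?mulr0.
have O0 : (0 < size O)%N by case: (O) yO.
have := wp (\prod_(z <- rem y O) ('X - z%:P)).
rewrite size_prod_XsubC size_rem // (prednK O0).
move=> /(_ (leqnn _)); set q := \prod_(z <- _) _ => e.
have : w y * q.[y] = 0.
  rewrite -[RHS]e (big_rem y) //= big_seq big1 ?addr0 // => z zO.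
  by have /rootP-> : root q z; rewrite ?mulr0 // root_prod_XsubC.
move=> /eqP; rewrite mulf_eq0 => /orP[/eqP //|].
by rewrite -rootE root_prod_XsubC mem_rem_uniqF.
Qed.

(** One more vector than coordinates forces a relation. It is returned as a polynomial so that it
    can act as an operator p(T). *)
Lemma linear_dependence (K : fieldType) (I : finType) (c : nat -> I -> K) :
  exists2 p : {poly K}, p != 0 & forall i, \sum_(m < size p) p`_m * c m i = 0.
Proof.
pose n := #|I|.+1.
pose A : 'M[K]_(n, #|I|) := \matrix_(m < n, i < #|I|) c m (enum_val i).
have /rowV0Pn[v vA v0] : kermx A != 0.
  by rewrite -mxrank_eq0 mxrank_ker subn_eq0 -ltnNge ltnS rank_leq_col.
pose p := \poly_(m < n) v 0 (inord m).
exists p => [|i].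
  apply: contraNneq v0 => p0; apply/eqP/rowP => m; rewrite mxE.
  have := congr1 (fun q : {poly K} => q`_m) p0.
  by rewrite coef_poly ltn_ord inord_val coef0.
have := sub_kermxP vA => /rowP/(_ (enum_rank i)); rewrite !mxE => e.
rewrite -[RHS]e (big_ord_widen_cond n (fun=> true) (fun m => p`_m * c m i)) ?size_poly //.
rewrite big_mkcond /=; apply: eq_bigr => m _; rewrite mxE enum_rankK.
case: ltnP => [mp|/(nth_default 0) pm]; first by rewrite coef_poly ltn_ord inord_val.
have -> : v 0 m = p`_m by rewrite coef_poly ltn_ord inord_val.
by rewrite pm mul0r.
Qed.

Section OneVariable.
Context {k F : closedFieldType} (iota : {rmorphism k -> F}).
Hypothesis char0 : [pchar F] =i pred0.
Context (C : divringClosed F) (kC : forall c, iota c \in C)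
  (Cacl : {subset acl C <= C}) (a : F) (aC : a \notin C).
Implicit Types (g h u T : aut iota) (L M : divringClosed F).
Local Notation K := (subf C).
Local Notation L := (adj C a).

Let aaC : a \notin acl C. Proof. by apply: contra aC => /Cacl. Qed.

Lemma aut_ev g p : fixes C g -> g (ev C a p) = ev C (g a) p.
Proof.
move=> gC; rewrite !evE (fixes_horner _ gC) ?rpred0 //.
exact: map_subf_over.
Qed.

Lemma bounded_fixes g N x : fixes C g -> g a = a ->
  bounded C a N x -> bounded C a N (g x).
Proof.
move=> gC ga [r [rm rN rx]]; exists r; split=> //; apply/rootP.
have -> : map_poly (ev C a) r = map_poly g (map_poly (ev C a) r).
  by apply/polyP => i; rewrite !coef_map /= aut_ev // ga.
by rewrite horner_map (rootP rx) rmorph0.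
Qed.

Lemma bounded_shift T N x : fixes C T -> T a = a + 1 ->
  bounded C a N x -> bounded C a N (T x).
Proof.
move=> TC Ta [r [rm rN rx]].
have evs p : ev C a (p \Po ('X + 1)) = ev C (a + 1) p.
  have XE : map_poly (subf_val C) ('X + 1) = 'X + 1.
    by rewrite rmorphD rmorph1; congr (_ + _); exact: map_polyX.
  by rewrite !evE map_comp_poly horner_comp /= XE hornerD hornerX horner1.
have sX1 : size ('X + 1 : {poly K}) = 2%N by rewrite -polyC1 size_XaddC.
exists (map_poly (comp_poly ('X + 1)) r); split.
- rewrite monicE lead_coef_map_inj ?comp_poly0 //; last first.
    move=> p q /eqP; rewrite -subr_eq0 -comp_polyB comp_poly2_eq0 ?sX1 // subr_eq0.
    by move/eqP.
  by rewrite (monicP rm) comp_polyC.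
- by move=> i; rewrite coef_map_id0 ?comp_poly0 // size_comp_poly2 ?sX1.
- apply/rootP; have -> : map_poly (ev C a) (map_poly (comp_poly ('X + 1)) r) =
      map_poly T (map_poly (ev C a) r).
    apply/polyP => i; rewrite !coef_map_id0 ?rmorph0 ?comp_poly0 //.
    by rewrite aut_ev // Ta -evs.
  by rewrite horner_map (rootP rx) rmorph0.
Qed.

Lemma bounded_multiple x : x \in acl L ->
  exists l N, ev C a l != 0 /\ bounded C a N (ev C a l * x).
Proof.
move=> /alg_adj[G GC [G0 Gx]].
have /choice[Gc GcE] : forall i, exists p : {poly K}, map_poly (subf_val C) p = G`_i.
  by move=> i; apply: subf_polyE; exact: over2_coef.
have lG0 : G != 0 by apply: contraNneq G0 => ->; rewrite rmorph0.
set d := (size G).-1; pose l := Gc d.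
have evG i : ev C a (Gc i) = (G`_i).[a] by rewrite evE GcE.
have l0 : ev C a l != 0.
  rewrite evG; apply: contraNneq lG0 => /(transc_eq0 aaC (over2_coef _ GC)) /eqP.
  by rewrite -lead_coefE lead_coef_eq0.
have e : \sum_(i < d) ev C a (Gc i) * x ^+ i + ev C a l * x ^+ d = 0.
  move: Gx; rewrite -horner2E (@horner_coef_wide _ d.+1); last first.
    by rewrite (leq_trans (size_poly _ _)) // leqSpred.
  rewrite big_ord_recr coef_map /= horner_evalE -evG => e.
  rewrite -[RHS]e; congr (_ + _).
  by apply: eq_bigr => i _; rewrite coef_map /= horner_evalE -evG.
have d0 : (0 < d)%N.
  rewrite lt0n; apply: contraNneq l0 => d0; move: e; rewrite d0 big_ord0 add0r.
  by rewrite expr0 mulr1 => ->.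
(* Multiplying the relation for x, with leading coefficient l, by l^(d-1) makes it monic in l x. *)
pose c i := Gc i * l ^+ (d.-1 - i).
pose r : {poly {poly K}} := 'X^d + \poly_(i < d) c i.
have sp : (size (\poly_(i < d) c i)%R < size ('X^d : {poly {poly K}}))%N.
  by rewrite size_polyXn ltnS size_poly.
exists l, (\max_(i < (size r)) size (r`_i)%R)%N; split=> //; exists r; split.
- by rewrite monicE lead_coefDl // lead_coefXn.
- move=> i; case: (ltnP i (size r)) => [ir|/(nth_default 0)->]; last by rewrite size_poly0.
  by rewrite leqW // (@leq_bigmax _ (fun i : 'I__ => size (r`_i)%R) (Ordinal ir)).
- apply/rootP; rewrite rmorphD /= map_polyXn hornerD hornerXn.
  rewrite (@horner_coef_wide _ d); last first.
    by rewrite (leq_trans (size_poly _ _)) // size_poly.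
  rewrite addrC exprMn.
  have -> : ev C a l ^+ d * x ^+ d = ev C a l ^+ d.-1 * (ev C a l * x ^+ d).
    by rewrite mulrA -exprSr prednK.
  have -> : \sum_(i < d) (map_poly (ev C a) (\poly_(i0 < d) c i0))`_i * (ev C a l * x) ^+ i =
      ev C a l ^+ d.-1 * \sum_(i < d) ev C a (Gc i) * x ^+ i.
    rewrite mulr_sumr; apply: eq_bigr => i _; rewrite coef_map coef_poly ltn_ord /=.
    have -> : ev C a l ^+ d.-1 = ev C a l ^+ (d.-1 - i) * ev C a l ^+ i.
      by rewrite -exprD subnK // -ltnS prednK.
    rewrite /c rmorphM rmorphXn exprMn -!mulrA [LHS]mulrCA; congr (_ * _).
    exact: mulrCA.
  by rewrite -mulrDr e mulr0.
Qed.
End OneVariable.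

(** * Shift operators on an invariant field *)

Section ShiftInvariant.
Context {k F : closedFieldType} (iota : {rmorphism k -> F}).
Hypothesis char0 : [pchar F] =i pred0.
Context (C : divringClosed F) (kC : forall c, iota c \in C)
  (Cacl : {subset acl C <= C}) (a : F) (aC : a \notin C).
Context (T : aut iota) (TC : fixes C T) (Ta : T a = a + 1).
Implicit Types (g h u : aut iota).
Local Notation K := (subf C).
Local Notation L := (adj C a).
Context (M : divringClosed F) (LM : {subset L <= M}) (Malg : {subset M <= acl L})
  (MT : {in M, forall v, T v \in M})
  (MU : forall g, fixes L g -> {in M, forall v, g v \in M})
  (comm : forall g, fixes L g -> {in M, forall v, T (g v) = g (T v)}).

Let aaC : a \notin acl C. Proof. by apply: contra aC => /Cacl. Qed.
Let U := [set g : aut iota | fixes L g].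
Let Usub : is_subgroup U := fixes_subgroup iota L.
Let kL c : iota c \in L. Proof. exact/sub_adj. Qed.

Lemma iter_mem m : {in M, forall v, (T ^+ m)%g v \in M}.
Proof. by elim: m => // m IH v vM; rewrite expgS autM; apply/MT/IH. Qed.

Lemma iter_comm g m : fixes L g ->
  {in M, forall v, g ((T ^+ m)%g v) = (T ^+ m)%g (g v)}.
Proof.
by move=> gL v vM; elim: m => // m IH; rewrite expgS !autM -comm ?iter_mem // IH.
Qed.

(** The norm of w to C(a), a product over n conjugates, has eigenvalue x^n. A shift keeps leading
    coefficients, so for a fraction in a this eigenvalue is 1. Hence T^n fixes w while shifting a by
    n, and w is algebraic over C. *)
Lemma shift_eigenvector w x : w \in M -> x \in C -> T w = x * w -> w \in C.
Proof.
move=> wM xC Tw; have [->|w0] := eqVneq w 0; first exact: rpred0.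
have [O OP] := bounded_orbit iota (Malg wM).
have OE y : y \in O -> [/\ y \in M, y != 0 & T y = x * y].
  move=> /OP.2[g gL <-]; rewrite fmorph_eq0 comm // Tw rmorphM MU //.
  by rewrite (gL x) // sub_adj.
pose c := \prod_(y <- O) y.
have c0 : c != 0 by rewrite prodf_seq_neq0; apply/allP => y /OE[].
have cL : c \in L.
  apply: (fixed_mem char0 kL); last by move=> g gL; apply: (orbit_prod_fixed Usub OP gL).
  by rewrite /c big_seq rpred_prod // => y /OE[/Malg].
have Tc : T c = x ^+ size O * c.
  rewrite /c rmorph_prod big_seq (eq_bigr (fun y => x * y)) => [|y /OE[]//].
  by rewrite -big_seq big_split /= big_const_seq count_predT iter_mulr_1.
have /adjP[P [PC [Q [QC Qa cE]]]] := cL.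
have TP (p : {poly F}) : p \is a polyOver C -> T p.[a] = (p \Po ('X + 1)).[a].
  move=> pC; rewrite (fixes_horner _ TC) ?rpred0 // Ta horner_comp.
  by rewrite hornerD hornerX horner1.
have sX1 : size ('X + 1 : {poly F}) = 2%N by rewrite -polyC1 size_XaddC.
have lX1 (p : {poly F}) : lead_coef (p \Po ('X + 1)) = lead_coef p.
  by rewrite lead_coef_comp ?sX1 // -polyC1 lead_coefXaddC expr1n mulr1.
have TQ : (Q \Po ('X + 1)).[a] != 0 by rewrite -TP // fmorph_eq0.
have XC : 'X + 1 \is a polyOver C by rewrite rpredD ?polyOverX ?rpred1.
have : (P \Po ('X + 1)) * Q = (x ^+ size O)%:P * P * (Q \Po ('X + 1)).
  apply: (transc_inj aaC); rewrite ?rpredM ?polyOver_comp // ?polyOverC ?rpredX //.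
  rewrite !hornerM hornerC; apply/eqP; rewrite -eqr_div //.
  by move: Tc; rewrite cE fmorph_div !TP // mulrA => ->.
move=> /(congr1 lead_coef); rewrite !lead_coefM !lX1 lead_coefC -mulrA.
have P0 : P != 0 by apply: contraNneq c0 => P0; rewrite cE P0 horner0 mul0r.
have Q0 : Q != 0 by apply: contraNneq Qa => ->; rewrite horner0.
rewrite -[LHS]mul1r => /mulIf xn.
have {}xn : 1 = x ^+ size O by apply: xn; rewrite mulf_neq0 ?lead_coef_eq0.
have On : (0 < size O)%N by case: (O) (orbit_refl Usub OP).
have Tn m : (T ^+ m)%g w = x ^+ m * w.
  elim: m => [|m IH]; first by rewrite expr0 mul1r.
  by rewrite expgS autM IH rmorphM rmorphXn (TC xC) Tw mulrA exprSr.
apply: Cacl; apply: (shift_fixed char0 (g := (T ^+ size O)%g) (x := a) (e := 1 *+ size O)).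
- exact: (subgroupX (fixes_subgroup iota C)).
- by rewrite rpredMn ?rpred1.
- by rewrite ((pcharf0P _).1 char0) -lt0n.
- by apply: autX_add; rewrite ?rmorph1.
- exact: Malg.
- by rewrite Tn -xn mul1r.
Qed.

Definition shift_op (p : {poly K}) v :=
  \sum_(i < size p) subf_val C p`_i * (T ^+ i)%g v.

Lemma shift_op_wide n (p : {poly K}) v : (size p <= n)%N ->
  shift_op p v = \sum_(i < n) subf_val C p`_i * (T ^+ i)%g v.
Proof.
move=> pn; rewrite /shift_op (big_ord_widen_cond n (fun=> true)
  (fun i => subf_val C p`_i * (T ^+ i)%g v)) // big_mkcond /=.
apply: eq_bigr => i _; case: ltnP => // /(nth_default 0)->.
by rewrite (rmorph0 (subf_val C)) mul0r.
Qed.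

Lemma shift_op_XsubC (q : {poly K}) x v :
  shift_op (q * ('X - x%:P)) v = shift_op q (T v - subf_val C x * v).
Proof.
rewrite (@shift_op_wide (size q).+1); last first.
  rewrite (leq_trans (size_polyMleq _ _)) // size_XsubC addn2 //.
have -> : \sum_(i < (size q).+1) subf_val C (q * ('X - x%:P))`_i * (T ^+ i)%g v =
  \sum_(i < (size q).+1) subf_val C (q * 'X)`_i * (T ^+ i)%g v -
  subf_val C x * \sum_(i < (size q).+1) subf_val C q`_i * (T ^+ i)%g v.
  rewrite mulr_sumr -sumrB; apply: eq_bigr => i _.
  by rewrite mulrBr coefB coefMC rmorphB rmorphM mulrBl [in RHS]mulrA [subf_val C x * _]mulrC.
rewrite -(@shift_op_wide (size q).+1 q v) // big_ord_recl coefMX /= rmorph0 mul0r add0r.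
rewrite mulr_sumr -sumrB; apply: eq_bigr => i _.
have -> : bump 0 i = i.+1 by [].
rewrite coefMX /= expgSr autM rmorphB rmorphM mulrBr [subf_val C x * _]mulrCA.
have -> : (T ^+ i)%g (subf_val C x) = subf_val C x; last by [].
have TiC : fixes C (T ^+ i)%g by exact: (subgroupX (fixes_subgroup iota C) i TC).
exact/TiC/subf_valP.
Qed.

(** Induction on the degree of p, which has a root x as C is algebraically closed. By induction g
    fixes T v - x v, so w = g v - v satisfies T w = x w and is a constant; then g translates v by a
    constant, which must be 0 because v has finitely many conjugates. *)
Lemma shift_op_fixed n (p : {poly K}) v g : (size p <= n)%N -> p != 0 -> v \in M ->
  shift_op p v = 0 -> fixes L g -> g v = v.
Proof.
elim: n p v => [|n IH] p v pn p0 vM pv gL.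
  by move: pn; rewrite leqn0 size_poly_eq0 (negbTE p0).
have [sp|sp] := eqVneq (size p) 1%N.
  have [c c0 pE] := size_poly1P _ (introT eqP sp).
  move: pv; rewrite (@shift_op_wide 1) ?sp // big_ord1 pE coefC /= => /eqP.
  by rewrite mulf_eq0 fmorph_eq0 (negbTE c0) /= => /eqP->; rewrite rmorph0.
have [x xp] : exists x, root p x.
  have /closed_rootP[r rp] : size (map_poly (subf_val C) p) != 1%N by rewrite size_map_poly.
  have /Cacl/subf_valE[x xr] : r \in acl C.
    apply/aclP; exists (map_poly (subf_val C) p); first by rewrite map_poly_eq0.
    by split=> //; exact: map_subf_over.
  by exists x; rewrite -(fmorph_root (subf_val C)) xr.
have /factor_theorem[q pE] := xp.
have q0 : q != 0 by apply: contraNneq p0 => q0; rewrite pE q0 mul0r.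
have xC := subf_valP x.
have xM : subf_val C x \in M by apply/LM/sub_adj.
pose v' := T v - subf_val C x * v.
have v'M : v' \in M by rewrite rpredB ?MT // rpredM.
have gv' : g v' = v'.
  apply: (IH q) => //; last by rewrite -shift_op_XsubC -pE.
  by rewrite -ltnS (leq_trans _ pn) // pE size_Mmonic ?monicXsubC // size_XsubC addn2.
pose w := g v - v.
have TvE : T v = v' + subf_val C x * v by rewrite subrK.
have gx : g (subf_val C x) = subf_val C x by apply/gL/sub_adj.
have Tw : T w = subf_val C x * w.
  rewrite rmorphB comm // TvE rmorphD gv' rmorphM gx.
  by rewrite opprD addrACA subrr add0r mulrBr.
have wC : w \in C by apply: shift_eigenvector Tw; rewrite // rpredB ?MU.
have w0 : w = 0.
  apply: (fixes_translate char0 gL (Malg vM)); first by rewrite addrC subrK.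
  by apply/gL/sub_adj.
by apply/eqP; rewrite -subr_eq0; apply/eqP.
Qed.
End ShiftInvariant.

Section ShiftInvariantSubfield.
Context {k F : closedFieldType} (iota : {rmorphism k -> F}).
Hypothesis char0 : [pchar F] =i pred0.
Context (C : divringClosed F) (kC : forall c, iota c \in C)
  (Cacl : {subset acl C <= C}) (a : F) (aC : a \notin C).
Context (T : aut iota) (TC : fixes C T) (Ta : T a = a + 1).
Implicit Types (g h u : aut iota).
Local Notation K := (subf C).
Local Notation L := (adj C a).
Context (M : divringClosed F) (LM : {subset L <= M}) (Malg : {subset M <= acl L})
  (MT : {in M, forall v, T v \in M})
  (MU : forall g, fixes L g -> {in M, forall v, g v \in M})
  (comm : forall g, fixes L g -> {in M, forall v, T (g v) = g (T v)}).

Let aaC : a \notin acl C. Proof. by apply: contra aC => /Cacl. Qed.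
Let U := [set g : aut iota | fixes L g].
Let Usub : is_subgroup U := fixes_subgroup iota L.
Let kL c : iota c \in L. Proof. exact/sub_adj. Qed.
Let a0 : a != 0. Proof. by apply: contraNneq aC => ->; rewrite rpred0. Qed.

Lemma integral_sum (R : comNzRingType) (f : {rmorphism R -> F}) (s : seq F) (G : F -> F) :
  {in s, forall y, integralOver f (G y)} -> integralOver f (\sum_(y <- s) G y).
Proof.
move=> sG; rewrite big_seq; apply: (big_ind (integralOver f)) => //.
- exact: integral0.
- exact: integral_add.
Qed.

Lemma integral_exp (R : comNzRingType) (f : {rmorphism R -> F}) x n :
  integralOver f x -> integralOver f (x ^+ n).
Proof.
move=> fx; elim: n => [|n IH]; first exact: integral1.
by rewrite exprS; apply: integral_mul.
Qed.

(** Finite dimension enters through traces. For a bounded multiple u of v, the sums of T^m(y) y^j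
    over the conjugates y of u lie in C(a), are integral, and are polynomials in a of degree bounded
    independently of m. A linear relation between their coefficients gives p with all sums of
    p(T)(y) y^j equal to 0, and Vandermonde gives p(T)(u) = 0. *)
Lemma shift_invariant_fixed v g : v \in M -> fixes L g -> g v = v.
Proof.
move=> vM gL; have [l [N [l0 lv]]] := bounded_multiple Cacl aC (Malg vM).
set u := ev C a l * v in lv.
have lM : ev C a l \in M by apply/LM/ev_adj.
have uM : u \in M by rewrite rpredM.
suff gu : g u = u.
  by move: gu; rewrite rmorphM (gL (ev C a l)) ?ev_adj // => /(mulfI l0).
have [O OP] := bounded_orbit iota (Malg uM).
have Cfix h : fixes L h -> fixes C h by move=> hL x xC; rewrite hL // sub_adj.
have OE y : y \in O -> y \in M /\ bounded C a N y.
  move=> /OP.2[h hL <-]; split; first exact: MU.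
  by apply: bounded_fixes => //; [exact: Cfix|rewrite hL // adj_id].
have Tb m y : y \in O -> bounded C a N ((T ^+ m)%g y).
  move=> /OE[_ yb]; elim: m => // m IH; rewrite expgS autM.
  exact: bounded_shift.
pose s m j := \sum_(y <- O) (T ^+ m)%g y * y ^+ j.
have sL m j : s m j \in L.
  apply: (fixed_mem char0 kL); last first.
    move=> h hL; apply: (orbit_sum_fixed Usub OP hL) => y /OE[yM _].
    by rewrite rmorphM rmorphXn (iter_comm MT comm).
  rewrite /s big_seq rpred_sum // => y /OE[yM _].
  by rewrite rpredM ?rpredX ?Malg // (iter_mem MT).
(* The trace with exponent j has degree at most N (j + 1), which is at most N times the size of the
   orbit when j is below that size. *)
pose D := (N * (size O)).+1.
have sE m j : exists q : {poly K}, (j < size O)%N -> s m j = ev C a q /\ (size q <= D)%N.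
  have [jO|jO] := ltnP j (size O); last by exists 0.
  have [|q qE] := integrally_closed aaC (sL m j).
    apply: integral_sum => y yO; apply: integral_mul.
      exact: bounded_integral (Tb m y yO).
    by apply/integral_exp/(bounded_integral (proj2 (OE y yO))).
  exists q => _; split=> //.
  rewrite (leq_trans (ev_size_bound (M := (N * j.+1)%N) aaC qE _)) //; last first.
    by rewrite ltnS leq_mul2l jO orbT.
  rewrite /s mulr_suml; apply: integral_sum => y yO.
  have -> : (T ^+ m)%g y * y ^+ j / a ^+ (N * j.+1) =
      ((T ^+ m)%g y / a ^+ N) * (y / a ^+ N) ^+ j.
    by rewrite mulnS exprD exprM expr_div_n invfM mulrACA.
  apply: integral_mul; first exact: bounded_integral_inv (Tb m y yO).
  by apply/integral_exp/(bounded_integral_inv _ (proj2 (OE y yO))).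
have /choice[q qE] : forall mj : nat * nat, exists q : {poly K},
    (mj.2 < size O)%N -> s mj.1 mj.2 = ev C a q /\ (size q <= D)%N.
  by move=> [m j]; exact: sE.
have [p p0 pE] := @linear_dependence K ('I_(size O) * 'I_D)%type
  (fun m ji => (q (m, ji.1 : nat))`_(ji.2)).
apply: (shift_op_fixed char0 kC Cacl aC TC Ta LM Malg MT MU comm (leqnn _) p0) => //.
have uO := orbit_refl Usub OP.
apply: (power_sums_eq0 OP.1 _ uO (w := shift_op T p)) => j jO.
have psum : \sum_(m < size p) p`_m *: q (m : nat, j) = 0.
  apply/polyP => i; rewrite coef_sum coef0.
  have [iD|iD] := ltnP i D.
    by rewrite -[RHS](pE (Ordinal jO, Ordinal iD)); apply: eq_bigr => m _; rewrite coefZ.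
  rewrite big1 // => m _; have [_ qD] := qE (m : nat, j) jO.
  have qi : (q (m : nat, j))`_i = 0 by apply: nth_default; exact: leq_trans iD.
  by rewrite coefZ qi mulr0.
have := congr1 (ev C a) psum; rewrite rmorph_sum rmorph0 => e.
rewrite -[RHS]e /shift_op; under eq_bigr do rewrite mulr_suml.
rewrite exchange_big; apply: eq_bigr => m _ /=.
rewrite -mul_polyC rmorphM evC -(qE (m : nat, j) jO).1 mulr_sumr.
by apply: eq_bigr => y _; rewrite mulrA.
Qed.

End ShiftInvariantSubfield.

(** * Density over an independent family *)

Section Generated.
Context {k F : closedFieldType} (iota : {rmorphism k -> F}).
Implicit Types (g h u : aut iota) (s : seq F) (L M : divringClosed F).

Definition kgen s : divringClosed F := foldr (fun x L => adj L x) (base iota) s.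

Lemma kgen_min s M : {subset base iota <= M} -> {subset s <= M} -> {subset kgen s <= M}.
Proof.
move=> kM; elim: s => [_ //|x s IH] sM; apply: adj_min.
  by apply: IH => y ys; apply: sM; rewrite inE ys orbT.
by apply: sM; rewrite mem_head.
Qed.

Lemma kgen_base s : {subset base iota <= kgen s}.
Proof. by elim: s => // x s IH y /IH; apply: sub_adj. Qed.

Lemma kgen_iota s c : iota c \in kgen s.
Proof. exact/kgen_base/base_iota. Qed.

Lemma kgen_mem s : {subset s <= kgen s}.
Proof.
elim: s => // x s IH y; rewrite inE => /orP[/eqP->|/IH]; first exact: adj_id.
exact: sub_adj.
Qed.

Lemma kgen_mono s t : {subset s <= t} -> {subset kgen s <= kgen t}.
Proof.
by move=> st; apply: kgen_min; [exact: kgen_base|move=> x /st/kgen_mem].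
Qed.

Lemma fixes_kgen s g : {in s, forall x, g x = x} -> fixes (kgen s) g.
Proof.
elim: s => [_ _ /baseP[c <-]|x s IH gs]; first exact: aut_fix.
apply: fixes_adj; last by apply: gs; rewrite mem_head.
by apply: IH => y ys; apply: gs; rewrite inE ys orbT.
Qed.

Lemma aut_kgen s M g : {subset base iota <= M} -> {in s, forall x, g x \in M} ->
  {in kgen s, forall x, g x \in M}.
Proof.
move=> kM; elim: s => [_ x /[dup] /baseP[c <-]|x s IH gs u /adjP[p [pL [q [qL _ ->]]]]].
  by rewrite aut_fix; exact: kM.
have gL : {in kgen s, forall x, g x \in M}.
  by apply: IH => y ys; apply: gs; rewrite inE ys orbT.
have gx : g x \in M by apply: gs; rewrite mem_head.
have gp (r : {poly F}) : r \is a polyOver (kgen s) -> g r.[x] \in M.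
  move=> rL; rewrite -horner_map rpred_horner //; apply/polyOverP => i.
  by rewrite coef_map; apply: gL; apply: (polyOverP rL).
by rewrite fmorph_div rpred_div ?gp.
Qed.

Lemma aut_acl L M g : {in L, forall x, g x \in M} -> {in acl L, forall x, g x \in acl M}.
Proof.
move=> gL x /aclP[p p0 [pL px]]; apply/aclP; exists (map_poly g p).
  by rewrite map_poly_eq0.
split; last by rewrite fmorph_root.
by apply/polyOverP => i; rewrite coef_map; apply/gL/(polyOverP pL).
Qed.

Definition others (x : F) s := [seq y <- s | y != x].
(** [others x s] drops every copy of x, so a list with repetitions may be independent. *)
Definition indep s := {in s, forall x, x \notin acl (kgen (others x s))}.

Lemma othersP x s y : (y \in others x s) = (y != x) && (y \in s).
Proof. exact: mem_filter. Qed.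

(* Monic denominators of minimal degree are unique, hence canonical. *)
Lemma reduced_fraction L x v : x \notin acl L -> v \in adj L x ->
  exists p q : {poly F}, [/\ p \is a polyOver L, q \is a polyOver L, q.[x] != 0,
    v = p.[x] / q.[x] & forall g, {in L, forall y, g y \in L} -> g x = x -> g v = v ->
      map_poly g p = p /\ map_poly g q = q].
Proof.
move=> xL vL.
pose Q n := `[< exists p q : {poly F}, [/\ p \is a polyOver L, q \is a polyOver L,
  q \is monic, v * q.[x] = p.[x] & size q = n] >].
have scale (p q : {poly F}) : p \is a polyOver L -> q \is a polyOver L -> q != 0 ->
    v * q.[x] = p.[x] -> Q (size q).
  move=> pL qL q0 e; apply/asboolP.
  have lL : (lead_coef q)^-1 \in L by rewrite rpredV // lead_coefE (polyOverP qL).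
  exists ((lead_coef q)^-1 *: p), ((lead_coef q)^-1 *: q).
  rewrite !polyOverZ // monicE lead_coefZ mulVf ?lead_coef_eq0 // !hornerZ.
  by rewrite mulrCA e size_scale ?invr_eq0 ?lead_coef_eq0.
have exQ : exists n, Q n.
  have /adjP[p [pL [q [qL q0 vE]]]] := vL; exists (size q); apply: (scale p q) => //.
    by apply: contraNneq q0 => ->; rewrite horner0.
  by rewrite vE divfK.
case: (ex_minnP exQ) => n /asboolP[p [q [pL qL qm vq sq]]] minn.
have q0 : q.[x] != 0.
  by apply: contraTneq (monic_neq0 qm) => /(transc_eq0 xL qL) ->; rewrite eqxx.
exists p, q; split=> //; first by rewrite -vq mulfK.
move=> g gL gx gv.
have gLp (r : {poly F}) : r \is a polyOver L -> map_poly g r \is a polyOver L.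
  by move=> rL; apply/polyOverP => i; rewrite coef_map; apply/gL/(polyOverP rL).
have gr (r : {poly F}) : (map_poly g r).[x] = g r.[x] by rewrite -{1}gx horner_map.
have gq : map_poly g q = q.
  apply/eqP/negPn/negP => qq.
  have d0 : q - map_poly g q != 0 by rewrite subr_eq0 eq_sym.
  have /minn : Q (size (q - map_poly g q)).
    apply: (scale (p - map_poly g p)); rewrite ?rpredB ?gLp //.
    by rewrite !hornerD !hornerN !gr -vq rmorphM gv mulrBr.
  rewrite leqNgt -sq; case/negP.
  have sg : size (map_poly g q) = size q by rewrite size_map_poly.
  have q1 : (0 < size q)%N by rewrite size_poly_gt0 monic_neq0.
  rewrite -(prednK q1) ltnS; apply/leq_sizeP => i.
  rewrite leq_eqVlt => /orP[/eqP<-|ip]; rewrite coefB coef_map /=.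
    by rewrite -lead_coefE (monicP qm) rmorph1 subrr.
  by rewrite nth_default ?rmorph0 ?subrr // -(prednK q1).
split=> //; apply: (transc_inj xL); rewrite ?gLp //.
by rewrite gr -vq rmorphM gv -[q in RHS]gq gr.
Qed.
End Generated.

Section Density.
Context {k F : closedFieldType} (iota : {rmorphism k -> F}).
Hypothesis char0 : [pchar F] =i pred0.
Implicit Types (g h u : aut iota) (L M : divringClosed F).
Context (s : seq F) (sI : indep iota s).
Context (H : set (aut iota)) (Hsub : is_subgroup H).
Local Notation K := (kgen iota s).
Local Notation C x := (acl (kgen iota (others x s))).
Hypothesis HK : forall g h, fixes K g -> H h -> H (g * h * g^-1)%g.
Context (T : F -> aut iota) (HT : {in s, forall x, H (T x)})
  (TC : {in s, forall x, fixes (C x) (T x)}) (Tx : {in s, forall x, T x x = x + 1}).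

Let M0 v := v \in acl K /\ forall h, H h -> fixes K h -> h v = v.

Let K_C x : {subset K <= adj (C x) x}.
Proof.
apply: kgen_min => [y yk|y ys]; first exact/sub_adj/sub_acl/kgen_base.
have [->|yx] := eqVneq y x; first exact: adj_id.
by apply/sub_adj/sub_acl/kgen_mem; rewrite othersP yx.
Qed.

Let C_K x : {subset C x <= acl K}.
Proof. by apply/acl_mono/kgen_mono => y; rewrite othersP => /andP[]. Qed.

(** The one-variable theorem needs a field containing L = C_x(x), so it is applied to the elements
    algebraic over L and fixed by H :&: U_L, which include v because U_L is contained in U_K. [T x]
    preserves L, and its commutators with U_L lie in H :&: U_L; this is why [T x] commutes with U_L
    on that field. *)
Lemma fixed_mem_adj v x : M0 v -> x \in s -> v \in adj (C x) x.
Proof.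
move=> [vK vH] xs; set L := adj (C x) x.
have kC c : iota c \in C x by exact/sub_acl/kgen_iota.
have kL c : iota c \in L by exact/sub_adj.
have Cacl : {subset acl (C x) <= C x} by move=> y; rewrite acl_acl.
have xC : x \notin C x by exact: sI.
have TL : {in L, forall y, T x y \in L}.
  move=> y /adjP[p [pC [q [qC _ ->]]]].
  rewrite fmorph_div !(fixes_horner _ (TC xs)) ?rpred0 // Tx //.
  have xL : x + 1 \in L by rewrite rpredD ?rpred1 ?adj_id.
  have Cp : {subset C x <= L} by exact: sub_adj.
  by rewrite rpred_div // rpred_horner //; exact: (polyOverS Cp).
pose Mp := [set w | w \in acl L /\ forall h, H h -> fixes L h -> h w = w].
have Mpc : is_subfield Mp.
  split=> [|y z /set_mem[yL yH] /set_mem[zL zH]|y z /set_mem[yL yH] /set_mem[zL zH]];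
    apply/mem_set; split.
  - exact: rpred1.
  - by move=> h _ _; exact: rmorph1.
  - exact: rpredB.
  - by move=> h Hh hL; rewrite rmorphB yH // zH.
  - exact: rpred_div.
  - by move=> h Hh hL; rewrite fmorph_div yH // zH.
pose M := set_subfield Mpc.
have ME w : w \in M <-> Mp w by exact: set_subfieldE.
have LK g : fixes L g -> fixes K g by apply: fixes_sub; exact: K_C.
have vM : v \in M.
  by apply/ME; split; [exact: acl_mono (@K_C x) _ vK|move=> h Hh /LK; exact: vH].
have Hc g h : fixes L g -> H h -> H (g^-1 * (h * g))%g.
  move=> gL Hh; have := HK (g := (g^-1)%g) _ Hh; rewrite invgK mulgA; apply.
  by move=> y yK; rewrite autV_fix // LK.
have TV y : y \in L -> exists2 z, z \in L & T x z = y.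
  move=> yL; exists ((T x)^-1%g y); last by rewrite autVK.
  move: yL => /adjP[p [pC [q [qC _ ->]]]].
  have TVC : fixes (C x) (T x)^-1%g by move=> z zC; rewrite autV_fix // TC.
  rewrite fmorph_div !(fixes_horner _ TVC) ?rpred0 //.
  have xL : (T x)^-1%g x \in L.
    rewrite (_ : _ x = x - 1) ?rpredB ?rpred1 ?adj_id //.
    by apply: autV_eq; rewrite rmorphB rmorph1 Tx // addrK.
  have Cp : {subset C x <= L} by exact: sub_adj.
  by rewrite rpred_div // rpred_horner //; exact: (polyOverS Cp).
apply: (fixed_mem char0 kL); first exact: acl_mono (@K_C x) _ vK.
move=> g gL; apply: (shift_invariant_fixed char0 kC Cacl xC (TC xs) (Tx xs) (M := M)) => //.
- move=> w wL; apply/ME; split; first exact: sub_acl.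
  by move=> h _; apply.
- by move=> w /ME[].
- move=> w /ME[wL wH]; apply/ME; split; first exact: aut_acl TL _ wL.
  move=> h Hh hL; apply: (aut_inj (g := ((T x)^-1)%g)); rewrite autK -autM -autM.
  apply: wH; first by rewrite -mulgA; do ?apply: (subgroupM Hsub) => //;
    [apply: (subgroupV Hsub)|]; exact: HT.
  by move=> y yL; rewrite !autM hL ?autK // TL.
- move=> u uL w /ME[wL wH]; apply/ME; split.
    by apply: aut_acl wL => y yL; rewrite uL.
  move=> h Hh hL; apply: (aut_inj (g := (u^-1)%g)); rewrite autK -!autM.
  rewrite -mulgA; apply: wH; first exact: Hc.
  by move=> y yL; rewrite !autM uL // hL // autV_fix // uL.
- move=> u uL w /ME[wL wH].
  apply: (aut_inj (g := (u^-1)%g)); apply: (aut_inj (g := ((T x)^-1)%g)).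
  rewrite !autK -!autM; apply: wH.
    rewrite -!mulgA; apply: (subgroupM Hsub).
      by apply: (subgroupV Hsub); exact: HT.
    by apply: Hc => //; exact: HT.
  move=> y yL; rewrite !autM uL //.
  by rewrite [(u^-1)%g _]autV_fix ?uL ?TL // autK.
Qed.

Let T_others x y : x \in s -> y \in s -> x != y -> T x y = y.
Proof.
by move=> xs ys xy; apply/TC/sub_acl/kgen_mem => //; rewrite othersP eq_sym xy.
Qed.

Lemma all_shift_fixed (t : seq F) v : uniq t -> {subset t <= s} ->
  v \in acl (kgen iota t) -> {in s, forall x, T x v = v} -> v \in base iota.
Proof.
elim: t => [_ _ /acl_base //|x t IH /= /andP[xt ut] ts vt vT].
have xs : x \in s by apply: ts; rewrite mem_head.
have ts' : {subset t <= s} by move=> y yt; apply: ts; rewrite inE yt orbT.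
apply: IH => //; apply: (shift_fixed char0 _ (rpred1 _) (oner_neq0 _) (Tx xs) vt (vT _ xs)).
apply: fixes_kgen => y yt; apply: T_others => //; first exact: ts'.
by apply: contraNneq xt => ->.
Qed.

(** The list t holds the variables whose shifts may move v; once it is empty, v is a constant. For x
    in t, v is a fraction in x over C_x whose canonical coefficients are fixed by [T x], by H :&:
    U_K and by every shift already known to fix v, so induction applies to them. *)
Lemma shift_fixed_descent (t : seq F) v : M0 v ->
  {in s, forall x, x \notin t -> T x v = v} -> forall g, fixes K g -> g v = v.
Proof.
elim: t v => [|x t IH] v vM vT g gK.
  apply/gK/kgen_base/(@all_shift_fixed (undup s)) => //.
  - exact: undup_uniq.
  - by move=> x; rewrite mem_undup.
  - by apply: acl_mono vM.1; apply: kgen_mono => x; rewrite mem_undup.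
  - by move=> x xs; apply: vT.
have [xs|xs] := boolP (x \in s); last first.
  apply: IH gK => // y ys yt; apply: vT => //.
  by rewrite inE negb_or yt andbT; apply: contraNneq xs => <-.
have xC : x \notin acl (C x) by rewrite acl_acl; exact: sI.
have [p [q [pC qC q0 vE red]]] := reduced_fraction iota xC (fixed_mem_adj vM xs).
have coefs (r : {poly F}) : r \is a polyOver (C x) ->
    (forall u, {in C x, forall y, u y \in C x} -> u x = x -> u v = v -> map_poly u r = r) ->
    map_poly g r = r.
  move=> rC rred; apply/polyP => i; rewrite coef_map /=.
  have rfix u : {in C x, forall y, u y \in C x} -> u x = x -> u v = v -> u r`_i = r`_i.
    by move=> uC ux uv; rewrite -coef_map rred.
  apply: IH gK.
    split; first exact/C_K/(polyOverP rC).
    move=> h Hh hK; apply: rfix; last exact: vM.2.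
      apply: aut_acl => y yo; rewrite hK //; apply: kgen_mono yo => z.
      by rewrite othersP => /andP[].
    exact/hK/kgen_mem.
  move=> y ys yt; have [->|yx] := eqVneq y x; first exact/TC/(polyOverP rC).
  apply: rfix.
  - apply: aut_acl; apply: aut_kgen; first exact: kgen_base.
    move=> z zo; have [->|zy] := eqVneq z y.
      by rewrite Tx // rpredD ?rpred1 // kgen_mem // othersP yx.
    by rewrite T_others 1?eq_sym // ?kgen_mem //; move: zo; rewrite othersP => /andP[].
  - exact: T_others.
  - by apply: vT; rewrite // inE negb_or yx.
have gx : g x = x by exact/gK/kgen_mem.
have gr (r : {poly F}) : map_poly g r = r -> g r.[x] = r.[x].
  by move=> gr; rewrite -{2}gr -{2}gx horner_map.
rewrite vE fmorph_div !gr //; apply: coefs => // u uC ux uv; by case: (red u).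
Qed.

(** Let y separate S. The polynomial whose roots are the orbit of y under H :&: U_K has coefficients
    fixed by that group, hence by u; so u y is in the orbit, and some h in the group agrees with u
    at y, hence on S. *)
Lemma shifts_dense u (S : seq F) : fixes K u -> {in S, forall x, x \in acl K} ->
  exists h, [/\ H h, fixes K h & {in S, h =1 u}].
Proof.
move=> uK /(separate iota char0)[y yK yP].
pose H0 := [set h : aut iota | H h /\ fixes K h].
have H0sub : is_subgroup H0.
  apply: is_subgroupP => [|g h [Hg gK] [Hh hK]|g [Hg gK]]; split.
  - exact: subgroup1.
  - exact: (subgroup1 (fixes_subgroup iota K)).
  - exact: (subgroupM Hsub).
  - exact: (subgroupM (fixes_subgroup iota K) gK hK).
  - exact: (subgroupV Hsub).
  - exact: (subgroupV (fixes_subgroup iota K) gK).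
have [O OP] : exists O, is_orbit H0 y O.
  apply: orbit_ex; have [r rP] := orbit_bounded iota yK.
  by exists r => g [_ gK]; exact: rP.
pose p := \prod_(z <- O) ('X - z%:P).
have pK : p \is a polyOver (acl K).
  rewrite /p big_seq rpred_prod // => z /OP.2[g [_ gK] <-]; rewrite polyOverXsubC.
  by apply: aut_acl yK => x xK; rewrite gK.
have pu : map_poly u p = p.
  apply/polyP => i; rewrite coef_map; apply: (@shift_fixed_descent s) uK => //.
    split; first exact: (polyOverP pK).
    by move=> h Hh hK; rewrite -coef_map (orbit_poly_fixed H0sub OP (phi := id)).
  by move=> x ->.
have : root p (u y).
  by rewrite -pu fmorph_root root_prod_XsubC; exact: orbit_refl OP.
rewrite root_prod_XsubC => /OP.2[h [Hh hK] hy]; exists h; split=> //.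
exact: yP.
Qed.

End Density.

(** * Finite transcendence degree *)

Section Bases.
Context {k F : closedFieldType} (iota : {rmorphism k -> F}).
Implicit Types (g h u : aut iota) (s : seq F) (L M : divringClosed F).

Lemma extract_indep (Y : seq F) : exists s, [/\ {subset s <= Y}, indep iota s &
  {subset Y <= acl (kgen iota s)}].
Proof.
have [n] := ubnP (size Y); elim: n Y => // n IH Y; rewrite ltnS => Yn.
have [YI|] := pselect (indep iota Y).
  by exists Y; split=> // x xY; exact/sub_acl/kgen_mem.
move=> /existsNP[x] /not_implyP[xY] /negP; rewrite negbK => xd.
have [|s [sY sI Ys]] := IH (others x Y).
  apply: leq_trans Yn; rewrite size_filter -(count_predC (pred1 x) Y) -[ltnLHS]add0n.
  by rewrite ltn_add2r -has_count has_pred1.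
exists s; split=> // [y /sY|y yY]; first by rewrite othersP => /andP[].
have [->|yx] := eqVneq y x; last by apply: Ys; rewrite othersP yx.
by apply: acl_sub xd; apply: kgen_min => // z zk; exact/sub_acl/kgen_base.
Qed.

Lemma indep_replace s z t : indep iota s -> z \in s ->
  t \notin acl (kgen iota (others z s)) -> indep iota (t :: others z s).
Proof.
move=> sI zs tz.
have oE x : {subset others x (t :: others z s) <= t :: others x (others z s)}.
  by move=> y; rewrite othersP !inE !othersP => /andP[->]/orP[->//|->]; rewrite orbT.
have mono x : {subset acl (kgen iota (others x (t :: others z s))) <=
    acl (kgen iota (t :: others x (others z s)))} by exact/acl_mono/kgen_mono/oE.
move=> x; rewrite inE => /orP[/eqP->|xo].
  apply: contra tz; apply/acl_mono/kgen_mono => y.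
  by rewrite othersP inE => /andP[/negPf->].
apply/negP => /mono /exchange tx; move/negP: tz; apply.
have : t \in acl (adj (kgen iota (others x (others z s))) x).
  apply: tx; move: (xo); rewrite othersP => /andP[xz /sI]; apply: contra.
  by apply/acl_mono/kgen_mono => y; rewrite !othersP => /and3P[-> _ ->].
apply/acl_mono/adj_min; last exact: kgen_mem.
by apply: kgen_mono => y; rewrite othersP => /andP[].
Qed.

(** Conjugation by g turns a translation of t fixing the closure of k(s) into a translation of x
    fixing the closure of the remaining variables. *)
Lemma rotate_others s x t : indep iota (t :: s) -> x \in s -> t \notin s ->
  exists g, [/\ aut_circ iota g, g t = x &
    {in acl (kgen iota (others x (t :: s))), forall y, (g^-1)%g y \in acl (kgen iota s)}].
Proof.
move=> tI xs ts; have xt : x != t by apply: contraNneq ts => <-.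
have kO c : iota c \in kgen iota (others x s) by exact: kgen_iota.
have [||g [gc gO gt gx]] := rotation kO (t := t) (e := x).
- move: (tI t (mem_head _ _)); apply: contra; apply/acl_mono/(@kgen_mono _ _ _ (x :: _)).
  move=> y; rewrite othersP !inE othersP.
  have [->|_] := eqVneq y x; first by rewrite xt xs orbT.
  by move=> /= ys; rewrite ys orbT andbT; apply: contraNneq ts => <-.
- have := tI x; rewrite inE xs orbT => /(_ isT); apply: contra.
  apply/acl_mono/(@kgen_mono _ _ _ (t :: _)) => y; rewrite othersP !inE othersP.
  by case: eqVneq => [->|_ /= /andP[-> ->]]; rewrite ?orbT // eq_sym xt.
exists g; split=> //; apply: aut_acl; apply: aut_kgen; first exact: kgen_base.
move=> y; rewrite othersP inE => /andP[yx /orP[/eqP->|ys]].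
  by rewrite (autV_eq (y := t) (x := - x)) ?rpredN ?kgen_mem // rmorphN gx opprK.
have yO : y \in others x s by rewrite othersP yx.
by rewrite autV_fix ?kgen_mem //; exact/gO/kgen_mem.
Qed.

Lemma not_fixes_kgen s g : ~ fixes (kgen iota s) g -> exists2 z, z \in s & g z != z.
Proof.
move=> gs; apply: contrapT => nex; apply: gs; apply: fixes_kgen => x xs.
by apply/eqP/negPn/negP => gx; apply: nex; exists x.
Qed.

End Bases.

Section FiniteRank.
Context {k F : closedFieldType} (iota : {rmorphism k -> F}).
Hypothesis char0 : [pchar F] =i pred0.
Implicit Types (g h u : aut iota) (s : seq F) (L M : divringClosed F).
Context (H : set (aut iota)) (Hsub : is_subgroup H).
Hypothesis Hnorm : forall g h, aut_circ iota g -> H h -> H (g * h * g^-1)%g.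

(** As sigma need not preserve the closure C of k(o), the first commutator is taken over k, with the
    list o fixed. The resulting h preserves C and moves t, so a second commutator can be taken over
    C itself; this gives h' and then the translation T of t'. *)
Lemma kummer_tower s z (sigma : aut iota) : indep iota s -> z \in s ->
  H sigma -> sigma z != z ->
  let o := others z s in
  exists h h' t t' zeta zeta' T, [/\ [/\ H h, H h' & H T], kummer_move h z t zeta,
    kummer_move h' t t' zeta' & [/\ fixes (kgen iota o) h, fixes (acl (kgen iota o)) h',
    fixes (acl (kgen iota o)) T, t' \notin acl (kgen iota o) & T t' = t' + 1]].
Proof.
move=> sI zs Hs sz o; set C := acl (kgen iota o).
have zC : z \notin C by exact: sI.
have kC c : iota c \in C by exact/sub_acl/kgen_iota.
have zk : z \notin acl (base iota).
  by apply: contra zC; apply/acl_mono; exact: kgen_base.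
have [|h [t [zeta [Hh _ ho hm]]]] :=
  kummer_commutator char0 Hsub Hnorm (W := base iota) o (base_iota iota) zk Hs sz.
  by move=> _ /baseP[c <-]; rewrite aut_fix base_iota.
have hO : fixes (kgen iota o) h by exact: fixes_kgen.
have zaC : z \notin acl C by rewrite acl_acl.
have taC := kummer_transc kC hm zaC.
have ht : h t != t.
  have [zb z1] := kummer_zeta hm; have [p [c [_ _ _ ->]]] := hm.
  rewrite -subr_eq0 -{2}[t]mul1r -mulrBl mulf_neq0 ?subr_eq0 //.
  by apply: contraNneq taC => ->; exact: rpred0.
have hC : {in C, forall y, h y \in C}.
  by apply: aut_acl => y yO; rewrite hO.
have [h' [t' [zeta' [Hh' h'C _ hm']]]] :=
  kummer_commutator char0 Hsub Hnorm [::] kC taC Hh ht hC.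
have taC' := kummer_transc kC hm' taC.
have [T [HT TC Tt]] := kummer_translation Hsub Hnorm kC Hh' h'C hm' taC' (rpred1 _).
exists h, h', t, t', zeta, zeta', T; split=> //; split=> //.
by rewrite -acl_acl.
Qed.

Definition approximable g := forall S : seq F, exists2 h, H h & {in S, h =1 g}.

Lemma approximable_subgroup : is_subgroup approximable.
Proof.
apply: is_subgroupP => [S|g h gA hA S|g gA S].
- by exists 1%g => //; exact: subgroup1.
- have [h' Hh' h'E] := hA S; have [g' Hg' g'E] := gA (map h S).
  exists (g' * h')%g; first exact: subgroupM.
  by move=> x xS; rewrite autM h'E // g'E // map_f.
- have [h Hh hE] := gA (map (g^-1)%g S); exists (h^-1)%g; first exact: subgroupV.
  by move=> x xS; apply: autV_eq; rewrite hE ?map_f // autVK.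
Qed.

Lemma approximable_closure g : approximable g -> closure H g.
Proof.
move=> gA A /nbhs_autP[S SA]; have [h Hh hE] := gA S; exists h; split=> //.
exact: SA.
Qed.

(** F is still algebraic over k(t', o), and conjugates of T by rotations shift each of these
    variables. As g fixes z, a power of h corrects it to fix t, then a power of h' to fix t'; what
    remains fixes k(t', o), where H is dense. *)
Lemma fixes_basis_approximable s g (sigma : aut iota) : indep iota s ->
  (forall x, x \in acl (kgen iota s)) -> H sigma -> ~ fixes (kgen iota s) sigma ->
  fixes (kgen iota s) g -> approximable g.
Proof.
move=> sI span Hs /not_fixes_kgen[z zs sz] gs S.
have [h [h' [t [t' [zeta [zeta' [T [[Hh Hh' HT] hm hm' [ho h'o To t'o Tt]]]]]]]]] :=
  kummer_tower sI zs Hs sz.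
set o := others z s in ho h'o To t'o.
have t'I : indep iota (t' :: o) by exact: indep_replace.
have t'no : t' \notin o by apply: contra t'o => /(kgen_mem iota)/sub_acl.
have zT (L : divringClosed F) x y w g0 : (forall c, iota c \in L) ->
    kummer_move g0 x y w -> y \in acl L -> x \in acl L.
  by move=> kL gm; apply: contraTT => /(kummer_transc kL gm).
have kt' c : iota c \in kgen iota (t' :: o) by exact: kgen_iota.
have span' x : x \in acl (kgen iota (t' :: o)).
  apply: (acl_sub _ (span x)); apply: kgen_min => [y /(kgen_base (t' :: o))/sub_acl //|y ys].
  have [->|yz] := eqVneq y z.
    apply: (zT _ _ _ _ _ kt' hm); apply: (zT _ _ _ _ _ kt' hm').
    by apply/sub_acl/kgen_mem; rewrite mem_head.
  by apply/sub_acl/kgen_mem; rewrite inE othersP yz ys orbT.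
have HK u v : fixes (kgen iota (t' :: o)) u -> H v -> H (u * v * u^-1)%g.
  by move=> /(fixes_circ span')/Hnorm; apply.
have /choice[TT TTP] : forall x, exists Tx : aut iota, x \in t' :: o ->
    [/\ H Tx, fixes (acl (kgen iota (others x (t' :: o)))) Tx & Tx x = x + 1].
  move=> x; have [|xo] := boolP (x \in t' :: o); last by exists 1%g.
  rewrite inE => /orP[/eqP->|xo].
    exists T => _; split=> // y yo; apply: To; move: yo; apply/acl_mono/kgen_mono => w.
    by rewrite othersP inE => /andP[/negPf->].
  have [r [rc rt rV]] := rotate_others t'I xo t'no.
  exists (r * T * r^-1)%g => _; split.
  - exact: Hnorm.
  - by move=> y /rV yo; rewrite !autM To // autVK.
  - by rewrite !autM (autV_eq rt) Tt rmorphD rt rmorph1.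
have dense := shifts_dense char0 t'I Hsub HK (T := TT).
have {}dense u : fixes (kgen iota (t' :: o)) u ->
    exists h, [/\ H h, fixes (kgen iota (t' :: o)) h & {in S, h =1 u}].
  move=> uK; apply: dense => //.
  - by move=> x /TTP[].
  - by move=> x /TTP[].
  - by move=> x /TTP[].
have kO c : iota c \in kgen iota o by exact: kgen_iota.
have to := kummer_transc kO hm (sI z zs).
have tn0 : t != 0 by apply: contraNneq to => ->; exact: rpred0.
have tn0' : t' != 0 by apply: contraNneq t'o => ->; exact: rpred0.
have os x : x \in o -> x \in s by rewrite othersP => /andP[].
have [n hn] := kummer_power hm tn0 (gs z (kgen_mem iota zs)).
pose g1 := ((h ^+ n)^-1 * g)%g.
have hnO : fixes (kgen iota o) (h ^+ n)%g.
  exact: (subgroupX (fixes_subgroup iota (kgen iota o)) n ho).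
have g1t : g1 t = t by rewrite autM -hn autK.
have g1o x : x \in o -> g1 x = x.
  by move=> xo; rewrite autM gs ?kgen_mem ?os // autV_fix // hnO // kgen_mem.
have [m hm'n] := kummer_power hm' tn0' g1t.
have h'mO : fixes (acl (kgen iota o)) (h' ^+ m)%g.
  exact: (subgroupX (fixes_subgroup iota (acl (kgen iota o))) m h'o).
have [|h3 [Hh3 _ h3E]] := dense ((h' ^+ m)^-1 * g1)%g.
  apply: fixes_kgen => x; rewrite inE => /orP[/eqP->|xo]; first by rewrite autM -hm'n autK.
  by rewrite autM g1o // autV_fix // h'mO // sub_acl // kgen_mem.
exists (h ^+ n * (h' ^+ m * h3))%g.
  by do 2?[apply: (subgroupM Hsub) => //]; exact: subgroupX.
by move=> x xS; rewrite !autM h3E // !autM !autVK.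
Qed.

(** Only generators need treatment. The orbit polynomials of B under a compact subgroup have
    coefficients fixed by it, and F is algebraic over the field they generate; a basis s extracted
    from these coefficients is fixed by the subgroup. *)
Lemma circ_approximable (B : seq F) g : (forall x, x \in acl (kgen iota B)) ->
  H <> [set 1%g] -> aut_circ iota g -> approximable g.
Proof.
move=> Bspan Hnt; apply; split; first exact: approximable_subgroup.
move=> u [C0 [C0sub C0c] C0u].
have [sigma Hs [z sz]] : exists2 sigma, H sigma & exists z, sigma z != z.
  apply: contrapT => nex; apply: Hnt; apply/seteqP; split=> [h Hh|_ ->]; last exact: subgroup1.
  apply: aut_ext => x; apply/eqP/negPn/negP => hx; apply: nex; exists h => //.
  by exists x.
have zk : z \notin acl (base iota).
  by apply: contra sz => /acl_base/baseP[c <-]; rewrite aut_fix.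
have [|h [t [zeta [Hh hk _ hm]]]] :=
  kummer_commutator char0 Hsub Hnorm (W := base iota) [::] (base_iota iota) zk Hs sz.
  by move=> _ /baseP[c <-]; rewrite aut_fix base_iota.
have tk := kummer_transc (base_iota iota) hm zk.
(* The given sigma might fix k(s). A translation cannot, since its orbits are infinite while F is
   algebraic over k(s). *)
have [T [HT Tk Tt]] := kummer_translation Hsub Hnorm (base_iota iota) Hh hk hm tk (rpred1 _).
have orbits x : exists O, is_orbit C0 x O.
  by apply: orbit_ex; apply: compact_orbit C0c.
have /choice[O OP] := orbits.
pose P x := \prod_(z <- O x) ('X - z%:P).
have Pu x : map_poly u (P x) = P x.
  exact: (orbit_poly_fixed C0sub (OP x) (phi := id)).
pose Y := flatten [seq (P x : seq F) | x <- B].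
have Yspan x : x \in acl (kgen iota Y).
  apply: (acl_sub _ (Bspan x)); apply: kgen_min => [y /(kgen_base Y)/sub_acl //|b bB].
  apply/aclP; exists (P b); first by rewrite monic_neq0 // monic_prod_XsubC.
  split; last by rewrite root_prod_XsubC; exact: (orbit_refl C0sub (OP b)).
  apply/allP => c cP; apply: kgen_mem; apply/flatten_mapP; exists b => //.
have uY y : y \in Y -> u y = y.
  move=> /flatten_mapP[b _ /(nthP 0)[i _ <-]].
  by rewrite -coef_map Pu.
have [s [sY sI Ys]] := extract_indep iota Y.
have sspan x : x \in acl (kgen iota s).
  by apply: (acl_sub _ (Yspan x)); apply: kgen_min => // y /(kgen_base s)/sub_acl.
apply: (fixes_basis_approximable sI sspan HT) => [Ts|].
  have := fixes_translate char0 Ts (sspan t) Tt (rmorph1 _).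
  by move/eqP; rewrite oner_eq0.
by apply: fixes_kgen => x /sY/uY.
Qed.

End FiniteRank.

(** * Infinite transcendence degree *)

Section InfiniteRank.
Context {k F : closedFieldType} (iota : {rmorphism k -> F}).
Hypothesis char0 : [pchar F] =i pred0.
Implicit Types (g h u : aut iota) (s P : seq F) (L M : divringClosed F).
Context (H : set (aut iota)) (Hsub : is_subgroup H).
Hypothesis Hnormal : forall g h, H h -> H (g * h * g^-1)%g.
Hypothesis Hnontrivial : H <> [set 1%g].
Hypothesis new_element : forall P, exists e, e \notin acl (kgen iota P).

Let Hnorm g h : aut_circ iota g -> H h -> H (g * h * g^-1)%g.
Proof. by move=> _; apply: Hnormal. Qed.

Lemma exchange_notin L x y : x \notin acl L -> y \notin acl (adj L x) ->
  x \notin acl (adj L y).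
Proof. by move=> xL; apply: contra => /exchange; apply. Qed.

(** Rotations need independent pairs, and t and a may be dependent over L; both are rotated to a
    third element e independent of them. *)
Lemma transport L P t a : (forall c, iota c \in L) -> {subset L <= kgen iota P} ->
  t \notin acl L -> a \notin acl L -> exists2 g : aut iota, fixes L g & g t = a.
Proof.
move=> kL LP tL aL; have [e eP] := new_element (t :: a :: P).
have eL x : x \in [:: t; a] -> e \notin acl (adj L x).
  move=> xta; apply: contra eP; apply/acl_mono/adj_min => [y /LP|].
    by apply: kgen_mono => w wP; rewrite !inE wP !orbT.
  by apply: kgen_mem; move: xta; rewrite !inE => /orP[]->; rewrite ?orbT.
have et := eL t (mem_head _ _); have ea : e \notin acl (adj L a).
  by apply: eL; rewrite !inE eqxx orbT.
have [g1 [_ g1L g1t _]] := rotation kL (exchange_notin tL et) et.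
have [g2 [_ g2L g2a _]] := rotation kL (exchange_notin aL ea) ea.
exists (g2^-1 * g1)%g; last by rewrite autM g1t -g2a autK.
by move=> x xL; rewrite autM g1L // autV_fix // g2L.
Qed.

Lemma nontrivial_move : exists2 sigma, H sigma & exists z, sigma z != z.
Proof.
apply: contrapT => nex; apply: Hnontrivial; apply/seteqP.
split=> [h Hh|_ ->]; last exact: subgroup1.
apply: aut_ext => x; apply/eqP/negPn/negP => hx; apply: nex; exists h => //.
by exists x.
Qed.

Lemma move_outside P : exists sigma z, [/\ H sigma, z \notin acl (kgen iota P) & sigma z != z].
Proof.
have [sigma Hs [z sz]] := nontrivial_move; have [e eP] := new_element P.
(* If sigma fixes the new element e and moves only z in the closure of k(P), it moves e + z, which
   lies outside that closure. *)
have [se|se] := eqVneq (sigma e) e; last by exists sigma, e.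
have [zP|zP] := boolP (z \in acl (kgen iota P)); last by exists sigma, z.
exists sigma, (e + z); split=> //.
  by apply: contra eP => ezP; rewrite -(addrK z e) rpredB.
by rewrite rmorphD se (inj_eq (addrI e)).
Qed.

(** A conjugate of a translation sends a to a + b; conjugating it by q, which fixes a and sends b to
    b - a, gives an element of H sending a to b. *)
Lemma exchange_move P a b : a \notin acl (kgen iota (b :: P)) ->
  b \notin acl (kgen iota (a :: P)) ->
  exists sigma, [/\ H sigma, {in P, forall x, sigma x = x} & sigma a = b].
Proof.
move=> ab ba; set P' := b :: P in ab.
have [sigma [z [Hs zP sz]]] := move_outside P'.
have kP c : iota c \in kgen iota P' by exact: kgen_iota.
have zk : z \notin acl (base iota) by apply: contra zP; apply/acl_mono/kgen_base.
have [|h [t [zeta [Hh _ hP hm]]]] :=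
  kummer_commutator char0 Hsub Hnorm (W := base iota) P' (base_iota iota) zk Hs sz.
  by move=> _ /baseP[c <-]; rewrite aut_fix base_iota.
have tP := kummer_transc kP hm zP.
have bP' : b \in kgen iota P' by rewrite kgen_mem ?mem_head.
have [T [HT TP Tt]] := kummer_translation Hsub Hnorm kP Hh (fixes_kgen hP) hm tP bP'.
have [g gP gt] := transport kP (fun x xP => xP) tP ab.
have ka c : iota c \in kgen iota (a :: P) by exact: kgen_iota.
have maP : - a \in kgen iota (a :: P) by rewrite rpredN kgen_mem ?mem_head.
have [q [_ qP qb]] := translation ka ba maP.
have Pfix (M : divringClosed F) u : fixes M u -> {subset P <= M} -> {in P, forall x, u x = x}.
  by move=> uM PM x /PM/uM.
have qP' : {in P, forall x, q x = x}.
  by apply: (Pfix _ _ qP) => x xP; rewrite kgen_mem // inE xP orbT.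
have PP' : {subset P <= kgen iota P'}.
  by move=> x xP; rewrite kgen_mem // inE xP orbT.
have qa : q a = a by apply/qP; rewrite kgen_mem ?mem_head.
exists (q * (g * T * g^-1) * q^-1)%g; split; first by do 2!apply: Hnormal.
  move=> x xP; rewrite !autM (autV_fix (qP' _ xP)).
  by rewrite (autV_fix (gP _ (PP' _ xP))) TP ?PP' // gP ?PP' // qP'.
rewrite !autM (autV_fix qa) (autV_eq gt) Tt rmorphD gt (gP _ bP').
by rewrite rmorphD qa qb addrCA subrr addr0.
Qed.

(** Ordered form of independence over k(P): each entry is transcendental over the later ones and P.
    Unlike [indep] it excludes repetitions, and it suits induction on the list. *)
Fixpoint free P s := if s is a :: s' then
  a \notin acl (kgen iota (s' ++ P)) /\ free P s' else True.

Lemma free_cons P s w : free P s -> w \notin acl (kgen iota (s ++ P)) -> free (w :: P) s.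
Proof.
elim: s => // a s IH /= [aP sP] wP; split; last first.
  by apply: IH => //; apply: contra wP; apply/acl_mono/sub_adj.
have := exchange_notin aP wP; apply: contra; apply/acl_mono/(@kgen_mono _ _ _ _ (_ :: _)).
by move=> x; rewrite inE !mem_cat inE; case: (x == w); rewrite ?orbT.
Qed.

(** The heads a and a' may depend on each other or on the opposite tails, so both are sent to a
    common new element w; the tails are then matched by induction with w fixed. *)
Lemma free_transport s s' P : size s = size s' -> free P s -> free P s' ->
  exists sigma, [/\ H sigma, {in P, forall x, sigma x = x} & map sigma s = s'].
Proof.
elim: s s' P => [|a s IH] [|a' s'] P //=.
  by exists 1%g; split=> //; exact: subgroup1.
move=> [ss'] [aP sP] [aP' sP'].
have [w wN] := new_element (a :: a' :: s ++ s' ++ P).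
have wnotin Q : {subset Q <= a :: a' :: s ++ s' ++ P} -> w \notin acl (kgen iota Q).
  by move=> QP; apply: contra wN; apply/acl_mono/kgen_mono.
have wa : w \notin acl (kgen iota (a :: s ++ P)).
  apply: wnotin => x; rewrite !inE !mem_cat.
  by case/orP => [->//|/orP[]->]; rewrite ?orbT.
have wa' : w \notin acl (kgen iota (a' :: s' ++ P)).
  apply: wnotin => x; rewrite !inE !mem_cat.
  by case/orP => [->|/orP[]->]; rewrite ?orbT.
have [s1 [Hs1 s1P s1a]] := exchange_move (exchange_notin aP wa) wa.
have [s2 [Hs2 s2P s2a]] := exchange_move (exchange_notin aP' wa') wa'.
have [||r [Hr rP rs]] := IH s' (w :: P) ss'.
- by apply: free_cons => //; apply: contra wa; apply/acl_mono/sub_adj.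
- by apply: free_cons => //; apply: contra wa'; apply/acl_mono/sub_adj.
exists (s2^-1 * (r * s1))%g; split.
- by apply: (subgroupM Hsub); [exact: subgroupV|exact: subgroupM].
- move=> x xP; rewrite !autM s1P ?mem_cat ?xP ?orbT // rP ?inE ?xP ?orbT //.
  by rewrite autV_fix // s2P // mem_cat xP orbT.
- rewrite !autM s1a rP ?mem_head // -s2a autK; congr (_ :: _).
  rewrite -[RHS]rs; apply/eq_in_map => x xs; rewrite !autM.
  rewrite s1P ?mem_cat ?xs // autV_fix // s2P // mem_cat -rs map_f //.
Qed.

Lemma indep_free s : uniq s -> indep iota s -> free [::] s.
Proof.
elim: s => //= a s IH /andP[as_ su] sI; split.
  have := sI a (mem_head _ _); apply: contra; apply/acl_mono/kgen_mono => x.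
  rewrite cats0 othersP inE => xs; rewrite xs orbT andbT.
  by apply: contraNneq as_ => <-.
apply: IH => // x xs; have := sI x; rewrite inE xs orbT => /(_ isT); apply: contra.
by apply/acl_mono/kgen_mono => y; rewrite !othersP inE => /andP[-> ->]; rewrite orbT.
Qed.

Lemma free_map g s : free [::] s -> free [::] (map g s).
Proof.
elim: s => //= a s IH [aP sP]; split; last exact: IH.
apply: contra aP; rewrite !cats0 => ga; rewrite -(autK g a); move: ga.
apply: aut_acl; apply: aut_kgen; first exact: kgen_base.
by move=> _ /mapP[y ys ->]; rewrite autK kgen_mem.
Qed.

(** Here sigma fixes the other variables and sends x to a new w, so it preserves their closure C and
    one commutator over C suffices. The translated element t is then carried to x by conjugation. *)
Lemma shift_exists s x : indep iota s -> x \in s -> exists T,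
  [/\ H T, fixes (acl (kgen iota (others x s))) T & T x = x + 1].
Proof.
move=> sI xs; set o := others x s; set C := acl (kgen iota o).
have xo : x \notin acl (kgen iota o) by exact: sI.
have [w wx] := new_element (x :: o).
have [sigma [Hs so sx]] := exchange_move (exchange_notin xo wx) wx.
have kC c : iota c \in C by exact/sub_acl/kgen_iota.
have xC : x \notin acl C by rewrite acl_acl.
have sxx : sigma x != x.
  by rewrite sx; apply: contraNneq wx => ->; apply/sub_acl/kgen_mem; rewrite mem_head.
have sC : {in C, forall y, sigma y \in C}.
  by apply: aut_acl => y yo; rewrite (fixes_kgen so).
have [h [t [zeta [Hh hC _ hm]]]] :=
  kummer_commutator char0 Hsub Hnorm [::] kC xC Hs sxx sC.
have tC := kummer_transc kC hm xC.
have [T [HT TC Tt]] := kummer_translation Hsub Hnorm kC Hh hC hm tC (rpred1 _).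
rewrite acl_acl in tC.
have [g go gt] := transport (kgen_iota iota o) (fun y yo => yo) tC xo.
exists (g * T * g^-1)%g; split; first exact: Hnormal.
  move=> y yC; rewrite !autM TC ?autVK //; move: yC; apply: aut_acl => z zo.
  by rewrite autV_fix // go.
by rewrite !autM (autV_eq gt) Tt rmorphD gt rmorph1.
Qed.

Lemma normal_approximable g : approximable H g.
Proof.
move=> S; have [s0 [_ s0I Ss0]] := extract_indep iota S.
(* [indep] tolerates repetitions, [free] does not. *)
pose s := undup s0.
have mem_s : s =i s0 by exact: mem_undup.
have sI : indep iota s.
  move=> x; rewrite mem_s => /s0I; apply: contra; apply/acl_mono/kgen_mono => y.
  by rewrite !othersP mem_s.
have Ss : {in S, forall x, x \in acl (kgen iota s)}.
  by move=> x /Ss0; apply/acl_mono/kgen_mono => y; rewrite mem_s.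
have sf := indep_free (undup_uniq s0) sI.
have [|h0 [Hh0 _ h0s]] := free_transport _ sf (free_map g sf).
  by rewrite size_map.
have {}h0s : {in s, h0 =1 g} by exact/eq_in_map.
have /choice[T TP] : forall x, exists Tx : aut iota, x \in s ->
    [/\ H Tx, fixes (acl (kgen iota (others x s))) Tx & Tx x = x + 1].
  move=> x; have [xs|xs] := boolP (x \in s); last by exists 1%g.
  by have [Tx TxP] := shift_exists sI xs; exists Tx.
have uK : fixes (kgen iota s) (h0^-1 * g)%g.
  by apply: fixes_kgen => x xs; rewrite autM -h0s // autK.
have HK u v : fixes (kgen iota s) u -> H v -> H (u * v * u^-1)%g.
  by move=> _; apply: Hnormal.
have [x /TP[]//|x /TP[]//|x /TP[]//|h1 [Hh1 _ h1E]] :=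
  shifts_dense char0 sI Hsub HK (T := T) _ _ _ uK Ss.
exists (h0 * h1)%g; first exact: subgroupM.
by move=> x xS; rewrite autM h1E // autM autVK.
Qed.

End InfiniteRank.

(** * From algebraic independence of polynomials to algebraic closure *)

Section AlgebraicIndependence.
Context {k F : closedFieldType} (iota : {rmorphism k -> F}).

Lemma mwiden_morph n (S : comNzRingType) (phi : {rmorphism mpoly n.+1 k -> S})
    (c : mpoly n k) :
  phi (mwiden c) = mmap (fun a => phi (mpolyC _ a))
    (fun i => phi (mpolyX _ (mnm1 (widen_ord (leqnSn n) i)))) c.
Proof.
rewrite /mwiden /mmap rmorph_sum; apply: eq_bigr => m _.
rewrite rmorphM /mmap1 rmorph_prod; congr (_ * _); apply: eq_bigr => i _.
exact: rmorphXn.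
Qed.

Lemma muni_widen_var n (i : 'I_n) :
  muni (mpolyX k (mnm1 (widen_ord (leqnSn n) i))) = (mpolyX k (mnm1 i))%:P.
Proof.
rewrite muniE msuppX big_seq1 mcoeffX eqxx scale1r mnm1E -val_eqE /= ltn_eqF //.
rewrite expr0 alg_polyC; congr (mpolyX _ _)%:P.
by apply/mnmP => j; rewrite mnmE !mnm1E.
Qed.

Lemma muni_last_var n : muni (mpolyX k (mnm1 (@ord_max n))) = 'X.
Proof.
rewrite muniE msuppX big_seq1 mcoeffX eqxx scale1r mnm1E eqxx expr1.
rewrite -mul_polyC -[RHS]mul1r; congr (_ * _); rewrite -polyC1 -mpolyX0; congr (mpolyX _ _)%:P.
by apply/mnmP => j; rewrite mnmE mnm1E mnm0E -val_eqE /= gtn_eqF.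
Qed.

Lemma muni_mwiden n (c : mpoly n k) : muni (mwiden c) = c%:P.
Proof.
rewrite mwiden_morph /mmap [in RHS](mpolyE c) rmorph_sum; apply: eq_bigr => m _.
rewrite /= muniC -mul_mpolyC rmorphM; congr (_ * _).
rewrite mpolyXE_id rmorph_prod; apply: eq_bigr => i _; rewrite rmorphXn; congr (_ ^+ _).
exact: muni_widen_var.
Qed.

(** Serves to recover [G] when its multivariate form vanishes. *)
Lemma muni_mmulti n (G : {poly mpoly n k}) : muni (mmulti G) = G.
Proof.
rewrite /mmulti rmorph_sum -[RHS]coefK poly_def; apply: eq_bigr => i _.
rewrite rmorphM rmorphXn -mul_polyC; congr (_ * _); first exact: muni_mwiden.
by congr (_ ^+ _); exact: muni_last_var.
Qed.

Section Sequence.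
Context (B : set F) (BI : algebraically_independent iota B)
  (f : nat -> F) (fI : injective f) (fB : forall n, B (f n)).
Local Notation fs m := [seq f i | i <- seq.iota 0 m].

Fact mpoly_eval_subproof m : {phi : {rmorphism mpoly m k -> F} |
  forall p, phi p = mmap iota (fun i : 'I_m => f i) p}.
Proof. by exists (mmap iota (fun i : 'I_m => f i)). Qed.
Definition mpoly_eval m : {rmorphism mpoly m k -> F} := sval (mpoly_eval_subproof m).
Local Notation E := mpoly_eval.

Lemma mpoly_evalE m p : E m p = mmap iota (fun i : 'I_m => f i) p.
Proof. exact: (svalP (mpoly_eval_subproof m)). Qed.

Lemma mpoly_evalC m c : E m (mpolyC m c) = iota c.
Proof. by rewrite mpoly_evalE mmapC. Qed.

Lemma mpoly_eval_var m (i : 'I_m) : E m (mpolyX k (mnm1 i)) = f i.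
Proof. by rewrite mpoly_evalE mmapX mmap1U. Qed.

Lemma mpoly_eval_inj m : injective (E m).
Proof.
move=> p q e; apply/eqP; rewrite -subr_eq0; apply/eqP.
have e0 : E m (p - q) = 0 by rewrite rmorphB e subrr.
rewrite mpoly_evalE in e0.
apply: (BI (x := fun i : 'I_m => f i)) e0; first by move=> i j /fI/ord_inj.
by move=> i; exact: fB.
Qed.

Lemma kgen_fraction m x : x \in kgen iota (fs m) ->
  exists p q : mpoly m k, E m q != 0 /\ x = E m p / E m q.
Proof.
pose Q := [set x | exists p q : mpoly m k, E m q != 0 /\ x = E m p / E m q].
have QC c : Q (iota c).
  by exists (mpolyC _ c), 1; rewrite rmorph1 oner_neq0 mpoly_evalC divr1.
have Qc : is_subfield Q.
  split=> [|u v /set_mem[p [q [q0 ->]]] /set_mem[p' [q' [q0' ->]]]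
           |u v /set_mem[p [q [q0 ->]]] /set_mem[p' [q' [q0' ->]]]]; apply/mem_set.
  - by have := QC 1; rewrite rmorph1.
  - exists (p * q' - p' * q), (q * q'); rewrite !rmorphB !rmorphM mulf_neq0 //; split=> //.
    by rewrite -[- (E m p' / _)]mulNr addf_div // mulNr.
  - have [p0'|p0'] := eqVneq (E m p') 0.
      exists 0, 1; rewrite rmorph0 rmorph1 oner_neq0 p0'; split=> //.
      by rewrite !mul0r invr0 mulr0.
    exists (p * q'), (q * p'); rewrite !rmorphM mulf_neq0 //; split=> //.
    by rewrite invf_div mulf_div.
move=> xk; apply/(set_subfieldE Qc); move: xk; apply: kgen_min.
  by move=> _ /baseP[c <-]; apply/set_subfieldE.
move=> y /mapP[i]; rewrite mem_iota /= add0n => im ->; apply/set_subfieldE.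
by exists (mpolyX _ (mnm1 (Ordinal im))), 1; rewrite rmorph1 oner_neq0 mpoly_eval_var divr1.
Qed.

Lemma kgen_clear m (p : {poly F}) : p \is a polyOver (kgen iota (fs m)) ->
  exists b (G : {poly mpoly m k}), E m b != 0 /\ map_poly (E m) G = E m b *: p.
Proof.
elim/poly_ind: p => [_|p c IH pc].
  by exists 1, 0; rewrite rmorph1 oner_neq0 rmorph0 scaler0.
have [|b [G [b0 GE]]] := IH.
  apply/polyOverP => i; have /polyOverP/(_ i.+1) := pc.
  by rewrite coefD coefMX coefC /= addr0.
have /kgen_fraction[r [q [q0 cE]]] : c \in kgen iota (fs m).
  by have /polyOverP/(_ 0%N) := pc; rewrite coefD coefMX coefC /= add0r.
exists (b * q), (G * 'X * q%:P + (r * b)%:P); rewrite rmorphM mulf_neq0 //; split=> //.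
rewrite rmorphD !rmorphM /= GE map_polyX !map_polyC /= cE.
rewrite scalerDr; congr (_ + _); first by rewrite -!scalerAl mulrC mul_polyC scalerA mulrC.
rewrite -mul_polyC -!rmorphM; congr _%:P; rewrite !rmorphM.
by rewrite [RHS]mulrACA mulfV // mulr1 mulrC.
Qed.

(** An equation for [f m] with cleared denominators is a polynomial in m + 1 variables vanishing at
    f 0, ..., f m. Independence makes it 0, against the choice of the equation. *)
Lemma independent_next m : f m \notin acl (kgen iota (fs m)).
Proof.
apply/negP => /aclP[p p0 [/kgen_clear[b [G [b0 GE]]] pf]].
have : mmulti G = 0.
  apply: (@mpoly_eval_inj m.+1); rewrite rmorph0.
  have <- : (map_poly (E m) G).[f m] = 0 by rewrite GE hornerZ (rootP pf) mulr0.
  rewrite /mmulti rmorph_sum (@horner_coef_wide _ (size G)); last exact: size_poly.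
  apply: eq_bigr => i _; rewrite rmorphM rmorphXn coef_map mwiden_morph /=.
  rewrite mpoly_eval_var mpoly_evalE; congr (_ * _).
  apply: eq_bigr => u _; rewrite mpoly_evalC; congr (_ * _).
  by apply: eq_bigr => j _; rewrite mpoly_eval_var.
move=> /(congr1 (@muni _ _)); rewrite muni_mmulti muni0 => G0.
by move/eqP: GE; rewrite G0 rmorph0 eq_sym scaler_eq0 (negbTE b0) (negbTE p0).
Qed.

Lemma generated_prefix x : (forall y, B y -> exists n, f n = y) ->
  subfield_gen iota B x -> exists m, x \in kgen iota (fs m).
Proof.
move=> Bf; have mono m n : (m <= n)%N -> {subset kgen iota (fs m) <= kgen iota (fs n)}.
  move=> mn; apply: kgen_mono => _ /mapP[i im ->]; apply: map_f.
  by move: im; rewrite !mem_iota /= !add0n => /leq_trans; apply.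
move=> /(_ [set x | exists m, x \in kgen iota (fs m)]); apply; split.
  split=> [|u v /set_mem[m um] /set_mem[n vn]|u v /set_mem[m um] /set_mem[n vn]];
    apply/mem_set.
  - by exists 0%N; exact: rpred1.
  - by exists (maxn m n); rewrite rpredB //; [apply: mono um|apply: mono vn];
      rewrite ?leq_maxl ?leq_maxr.
  - by exists (maxn m n); rewrite rpred_div //; [apply: mono um|apply: mono vn];
      rewrite ?leq_maxl ?leq_maxr.
move=> y [[c _ <-]|/Bf[n <-]]; first by exists 0%N; exact: base_iota.
exists n.+1; by apply/kgen_mem/map_f; rewrite mem_iota /= add0n.
Qed.

(** A finite list is algebraic over finitely many elements of the basis, and the next one is
    transcendental over them. *)
Lemma independent_new : (forall y, B y -> exists n, f n = y) ->
  (forall u : F, algebraic_over_subfield (subfield_gen iota B) u) ->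
  forall P : seq F, exists e, e \notin acl (kgen iota P).
Proof.
move=> Bf Balg P.
have mono m n : (m <= n)%N -> {subset kgen iota (fs m) <= kgen iota (fs n)}.
  move=> mn; apply: kgen_mono => _ /mapP[i im ->]; apply: map_f.
  by move: im; rewrite !mem_iota /= !add0n => /leq_trans; apply.
have bound (L : nat -> divringClosed F) (r : seq F) :
    (forall m n, (m <= n)%N -> {subset L m <= L n}) ->
    {in r, forall x, exists m, x \in L m} -> exists m, {subset r <= L m}.
  move=> Lmono; elim: r => [_|x r IH xr]; first by exists 0%N.
  have [|m rm] := IH; first by move=> y yr; apply: xr; rewrite inE yr orbT.
  have [n xn] := xr x (mem_head _ _); exists (maxn m n) => y.
  rewrite inE => /orP[/eqP->|/rm ym]; first exact: Lmono (leq_maxr _ _) _ xn.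
  exact: Lmono (leq_maxl _ _) _ ym.
have [m Pm] : exists m, {subset P <= acl (kgen iota (fs m))}.
  apply: (bound (fun m => acl (kgen iota (fs m)))) => [m n mn|x _].
    exact/acl_mono/mono.
  have [p p0 [/allP pB px]] := Balg x.
  have [|m pm] := bound (fun m => kgen iota (fs m)) p mono.
    by move=> y /pB /set_mem; exact: generated_prefix.
  by exists m; apply/aclP; exists p => //; split=> //; apply/allP.
exists (f m); apply: contra (independent_next m); apply: acl_sub.
by apply: kgen_min => // x /(kgen_base (fs m))/sub_acl.
Qed.
End Sequence.

Lemma infinite_trdeg : has_trdeg iota [set: nat] ->
  forall P : seq F, exists e, e \notin acl (kgen iota P).
Proof.
move=> [B [BI Balg]]; rewrite card_eq_sym => BN.
(* The bijection lemma is stated for a pointed target type, so F is pointed by 0. *)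
pose p0 := isPointed.Build (GRing.ClosedField.sort F) 0.
pose Fp : pointedType := HB.pack (GRing.ClosedField.sort F) p0.
have [f [fB fI fS]] := elimT (@card_set_bijP nat Fp setT B) BN.
apply: (independent_new BI (f := f)) => //.
- by move=> m n; apply: fI; exact: mem_set.
- by move=> n; exact: fB.
- by move=> y /fS[n _ <-]; exists n.
Qed.

Lemma finite_trdeg n : has_trdeg iota `I_n ->
  exists P : seq F, forall x, x \in acl (kgen iota P).
Proof.
move=> [B [_ Balg] Bn]; have /finite_seqP[P BP] : finite_set B by exists n.
exists P => x; have [p p0 [/allP pB px]] := Balg x.
apply/aclP; exists p => //; split=> //; apply/allP => c /pB /set_mem.
have Pk : is_subfield [set` kgen iota P].
  split=> [|y z|y z]; rewrite ?mem_setE; first exact: rpred1.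
    exact: rpredB.
  exact: rpred_div.
move=> /(_ [set` kgen iota P]); apply; split=> //.
move=> y [[a _ <-]|]; first exact: kgen_iota.
by rewrite BP; exact: kgen_mem.
Qed.

End AlgebraicIndependence.

Theorem theorem2p9 (k F : closedFieldType) (iota : {rmorphism k -> F})
    (chark0 : [pchar k] =i pred0) :
  (forall n : nat, (1 <= n)%N -> has_trdeg iota `I_n ->
     forall H : set (aut iota),
       is_subgroup H -> H <> [set 1%g] ->
       normalized_by H (aut_circ iota) ->
       aut_circ iota `<=` closure H)
  /\
  (has_trdeg iota [set: nat] ->
     forall H : set (aut iota),
       is_subgroup H -> H <> [set 1%g] -> normalized_by H [set: aut iota] ->
       dense H).
Proof.
have char0 : [pchar F] =i pred0 by move=> p; rewrite (fmorph_pchar iota) chark0.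
split=> [n _ /finite_trdeg[B Bspan] H Hsub Hnt HN g gc|/infinite_trdeg new H Hsub Hnt HN].
  apply: approximable_closure; apply: (circ_approximable char0 Hsub) gc => // u h uc Hh.
  (* In the group library [h ^ g] stands for g^-1 h g, hence the inverse of u. *)
  have := HN (u^-1)%g h (subgroupV (circ_subgroup iota) uc) Hh.
  by rewrite conjgE invgK mulgA.
have Hnormal (u h : aut iota) : H h -> H (u * h * u^-1)%g.
  by move=> Hh; have := HN (u^-1)%g h I Hh; rewrite conjgE invgK mulgA.
move=> O [g Og]; rewrite openE => /(_ g Og) /nbhs_autP[S SO].
have [h Hh hg] := normal_approximable char0 Hsub Hnormal Hnt new g S.
by exists h; split=> //; exact: SO.
Qed.
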